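(* Let $k_1,k_2\ge5$, put $k=k_1+k_2$, and let $Q_1,Q_2\in\mathbb{Z}[X_1,\dots,X_{k}]$ be two integral quadratic forms satisfying Condition 1. Assume further that $Q_1$ and $Q_2$ are split, in the sense that $$Q_1(\mathbf{x},\mathbf{y})=q_1(\mathbf{x})+q_2(\mathbf{y}),\qquad Q_2(\mathbf{x},\mathbf{y})=q_3(\mathbf{x})+q_4(\mathbf{y}),$$ where $q_1,q_3$ are integral quadratic forms in the $k_1$ variables $\mathbf{x}$ and $q_2,q_4$ are integral quadratic forms in the $k_2$ variables $\mathbf{y}$. If for every prime $p$ the system $Q_1=Q_2=0$ has a nonzero solution in $\mathbb{Z}_p^k$, then $\mathfrak{S}(\underline{0})$ is real and positive. Suppose further that $w$ is a smooth non-negative weight of compact support on $\mathbb{R}^k$ which is strictly positive on a neighbourhood of the origin. Then if the system $Q_1=Q_2=0$ has a nonzero solution in $\mathbb{R}^k$, we have $\mathcal{J}_w(\underline{0})>0$.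
   Context: An integral quadratic form is one of the shape $Q(\mathbf{x})=\mathbf{x}^TQ\mathbf{x}$ with a symmetric integer matrix, also denoted $Q$. Write $\underline{Q}=(Q_1,Q_2)$, $\underline{a}\cdot\underline{Q}=a_1Q_1+a_2Q_2$, $e(t)=e^{2\pi i t}$, $e_q(t)=e(t/q)$, $\underline{0}=(0,0)$. Condition 1: for every nonzero $\mathbf{z}\in\overline{\mathbb{Q}}^k$ with $Q_1(\mathbf{z})=Q_2(\mathbf{z})=0$ the $2\times k$ matrix with rows $\nabla Q_1(\mathbf{z}),\nabla Q_2(\mathbf{z})$ has rank $2$. Singular integral: $\mathcal{J}_w(\underline{0})=\iint_{\mathbb{R}^2}\left(\int_{\mathbb{R}^k}e(\underline{\theta}\cdot\underline{Q}(\mathbf{z}))w(\mathbf{z})\,d\mathbf{z}\right)d\theta_1d\theta_2$. Singular series: $\mathfrak{S}(\underline{0})=\sum_{q=1}^\infty q^{-k}\sum_{1\le a_1,a_2\le q,\ (a_1,a_2,q)=1}\ \sum_{\mathbf{z}\bmod q}e_q(\underline{a}\cdot\underline{Q}(\mathbf{z}))$. *)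

(* Defs.v *)
From HB Require Import structures.
From mathcomp Require Import all_boot all_order all_algebra.
From mathcomp Require Import algC.
From mathcomp Require Import complex.
From mathcomp Require Import all_classical all_reals all_analysis.

Set Implicit Arguments.
Unset Strict Implicit.
Unset Printing Implicit Defensive.

Import Order.TTheory GRing.Theory Num.Theory.
Import numFieldNormedType.Exports.

Local Open Scope classical_set_scope.
Local Open Scope ring_scope.

Section QuadraticForms.

Definition integral_form k (Q : 'M[int]_k) : Prop := Q^T = Q.

Definition qform (A : comPzRingType) k (Q : 'M[int]_k) (x : 'cV[A]_k) : A :=
  (x^T *m map_mx intr Q *m x) 0 0.

(* The derivative at t = 0 of t |-> Q(z + t e_j), taken formally in A[t]. *)
Definition qpartial (A : comNzRingType) k (Q : 'M[int]_k) (z : 'cV[A]_k)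
    (j : 'I_k) : A :=
  (qform Q (map_mx polyC z + 'X *: delta_mx j 0))^`().[0].

Definition qgradient (A : comNzRingType) k (Q : 'M[int]_k) (z : 'cV[A]_k) :
  'rV[A]_k := \row_j qpartial Q z j.

Lemma qgradientE (A : comNzRingType) k (Q : 'M[int]_k) (z : 'cV[A]_k) :
  integral_form Q -> qgradient Q z = 2%:R *: (map_mx intr Q *m z)^T.
Proof.
move=> symQ; apply/rowP => j; rewrite !mxE /qpartial /qform.
set Z := map_mx polyC z; set e := delta_mx j 0.
set M : 'M[{poly A}]_k := map_mx intr Q; set N := map_mx intr Q.
have ME : M = map_mx polyC N.
  by apply/matrixP => i l; rewrite !mxE rmorph_int.
have symM : M^T = M by rewrite /M map_trmx symQ.
have ZMZ : (Z^T *m M *m Z) 0 0 = ((z^T *m N *m z) 0 0)%:P.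
  by rewrite ME map_trmx -!map_mxM mxE.
have eMZ : (e^T *m M *m Z) 0 0 = ((N *m z) j 0)%:P.
  by rewrite trmx_delta -mulmxA ME -map_mxM -rowE [LHS]mxE [LHS]mxE.
have ZMe : (Z^T *m M *m e) 0 0 = ((N *m z) j 0)%:P.
  have -> : Z^T *m M *m e = (e^T *m M *m Z)^T.
    by rewrite !trmx_mul trmxK symM mulmxA.
  by rewrite mxE.
have addE (X Y : 'M[{poly A}]_1) : (X + Y) 0 0 = X 0 0 + Y 0 0.
  by rewrite mxE.
have sclE a (X : 'M[{poly A}]_1) : (a *: X) 0 0 = a * X 0 0 by rewrite mxE.
have -> : ((Z + 'X *: e)^T *m M *m (Z + 'X *: e)) 0 0 =
    (Z^T *m M *m Z) 0 0 + 'X * (Z^T *m M *m e) 0 0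
    + ('X * (e^T *m M *m Z) 0 0 + 'X * ('X * (e^T *m M *m e) 0 0)).
  have -> : (Z + 'X *: e)^T = Z^T + 'X *: e^T by rewrite linearD linearZ.
  rewrite !mulmxDl !mulmxDr -!scalemxAl -!scalemxAr.
  by rewrite !(addE, sclE).
rewrite ZMZ eMZ ZMe !derivD !derivM !derivX !derivC !hornerE /=.
by rewrite !addr0 [in LHS]mxE mulr_natl mulr2n.
Qed.

Definition condition1 k (Q1 Q2 : 'M[int]_k) : Prop :=
  forall z : 'cV[algC]_k, z != 0 -> qform Q1 z = 0 -> qform Q2 z = 0 ->
    \rank (col_mx (qgradient Q1 z) (qgradient Q2 z)) = 2%N.

Definition split_form k1 k2 (Q : 'M[int]_(k1 + k2)) : Prop :=
  exists (q : 'M[int]_k1) (q' : 'M[int]_k2),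
    [/\ integral_form q, integral_form q' &
      forall (x : 'cV[int]_k1) (y : 'cV[int]_k2),
        qform Q (col_mx x y) = qform q x + qform q' y].

Definition nonzero_solution (A : comPzRingType) k (Q1 Q2 : 'M[int]_k) : Prop :=
  exists x : 'cV[A]_k, [/\ x != 0, qform Q1 x = 0 & qform Q2 x = 0].

End QuadraticForms.

Section PadicIntegers.
Variable p : nat.

Let d n := (Zp_trunc (p ^ n.+1)).+2.

Let dvd_d n : (d n %| d n.+1)%N.
Proof.
rewrite /d /Zp_trunc; case: p => [|[|q]]; rewrite ?exp0n ?exp1n //.
have lt1 m : (1 < q.+2 ^ m.+1)%N by rewrite -(exp1n m.+1) ltn_exp2r.
have sub m : (q.+2 ^ m.+1).-2.+2 = (q.+2 ^ m.+1)%N.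
  by case: (_ ^ _)%N (lt1 m) => [|[|]].
by rewrite !sub [in X in (_ %| X)%N]expnS dvdn_mull.
Qed.

Definition coherent (f : forall n, 'Z_(p ^ n.+1)) : Prop :=
  forall n, inZp (f n.+1 : nat) = f n.

(* The inverse limit of the rings Z/p^(n+1). For p <= 1 the modulus in 'Z_
   degenerates, and the type is Z_p only for p >= 2. *)
Record padic_int := PadicInt {
  padic_seq :> forall n, 'Z_(p ^ n.+1);
  padic_coherent : coherent padic_seq }.

Lemma padic_intP (x y : padic_int) : (forall n, x n = y n) -> x = y.
Proof.
case: x y => [x xP] [y yP] /= xy.
have {}xy : x = y by exact: functional_extensionality_dep.
by subst y; congr PadicInt; exact: Prop_irrelevance.
Qed.

Fact padic_zero_coherent : coherent (fun=> 0).
Proof. by move=> n; apply: val_inj; rewrite /= mod0n. Qed.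
Definition padic_zero := PadicInt padic_zero_coherent.

Fact padic_one_coherent : coherent (fun=> 1).
Proof.
by move=> n; apply: val_inj; rewrite /= (modn_dvdm _ (dvd_d n)) ?modn_small.
Qed.
Definition padic_one := PadicInt padic_one_coherent.

Fact padic_opp_coherent (x : padic_int) : coherent (fun n => - x n).
Proof.
move=> n; rewrite -(padic_coherent x n); apply: val_inj => /=.
have xd : (x n.+1 <= d n.+1)%N := ltnW (ltn_ord (x n.+1)).
have xd' : (x n.+1 %% d n <= d n)%N by rewrite ltnW // ltn_mod.
rewrite (modn_dvdm _ (dvd_d n)); apply/eqP.
rewrite -(eqn_modDr (x n.+1)) subnK // -modnDmr subnK // modnn.
exact: dvd_d.
Qed.
Definition padic_opp x := PadicInt (padic_opp_coherent x).

Fact padic_add_coherent (x y : padic_int) : coherent (fun n => x n + y n).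
Proof.
move=> n; rewrite -(padic_coherent x n) -(padic_coherent y n).
by apply: val_inj; rewrite /= (modn_dvdm _ (dvd_d n)) modnDm.
Qed.
Definition padic_add x y := PadicInt (padic_add_coherent x y).

Fact padic_mul_coherent (x y : padic_int) : coherent (fun n => x n * y n).
Proof.
move=> n; rewrite -(padic_coherent x n) -(padic_coherent y n).
by apply: val_inj; rewrite /= (modn_dvdm _ (dvd_d n)) modnMm.
Qed.
Definition padic_mul x y := PadicInt (padic_mul_coherent x y).

HB.instance Definition _ := gen_eqMixin padic_int.
HB.instance Definition _ := gen_choiceMixin padic_int.

Fact padic_addA : associative padic_add.
Proof. by move=> x y z; apply: padic_intP => n; exact: addrA. Qed.
Fact padic_addC : commutative padic_add.
Proof. by move=> x y; apply: padic_intP => n; exact: addrC. Qed.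
Fact padic_add0 : left_id padic_zero padic_add.
Proof. by move=> x; apply: padic_intP => n; exact: add0r. Qed.
Fact padic_addN : left_inverse padic_zero padic_opp padic_add.
Proof. by move=> x; apply: padic_intP => n; exact: addNr. Qed.

HB.instance Definition _ := GRing.isZmodule.Build padic_int
  padic_addA padic_addC padic_add0 padic_addN.

Fact padic_mulA : associative padic_mul.
Proof. by move=> x y z; apply: padic_intP => n; exact: mulrA. Qed.
Fact padic_mulC : commutative padic_mul.
Proof. by move=> x y; apply: padic_intP => n; exact: mulrC. Qed.
Fact padic_mul1 : left_id padic_one padic_mul.
Proof. by move=> x; apply: padic_intP => n; exact: mul1r. Qed.
Fact padic_mulDl : left_distributive padic_mul padic_add.
Proof. by move=> x y z; apply: padic_intP => n; exact: mulrDl. Qed.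
Fact padic_one_neq0 : padic_one != padic_zero.
Proof.
apply/eqP => /(congr1 (fun x : padic_int => x 0%N)) /= /eqP.
by rewrite (negbTE (oner_neq0 _)).
Qed.

HB.instance Definition _ := GRing.Zmodule_isComNzRing.Build padic_int
  padic_mulA padic_mulC padic_mul1 padic_mulDl padic_one_neq0.

End PadicIntegers.

Section LebesgueTuple.
Variable R : realType.
Local Notation T := (measurableTypeR R).
Local Open Scope ereal_scope.

(* Lebesgue measure on R^n, as an iterated product measure. *)
Fixpoint lebesgue_tuple n : set (n.-tuple T) -> \bar R :=
  match n with
  | 0 => \d_ ([tuple] : 0.-tuple T)
  | n'.+1 => pushforward (@lebesgue_measure R \x @lebesgue_tuple n')
      (fun u : T * n'.-tuple T => [the n'.+1.-tuple T of u.1 :: u.2])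
  end.

Let measure_spec d (U : measurableType d) (m : set U -> \bar R) :=
  [/\ m set0 = 0, (forall A, 0 <= m A), semi_sigma_additive m &
      sigma_finite setT m].

Let sigma_finite_measure_spec d (U : measurableType d)
  (m : {sigma_finite_measure set U -> \bar R}) : measure_spec m.
Proof.
split; [exact: measure0 | by move=> A; exact: measure_ge0 | |].
- exact: measure_semi_sigma_additive.
- exact: sigma_finiteT.
Qed.

Let pushforward_cons_spec n
    (ps : {measure set (T * n.-tuple T)%type -> \bar R}) :
  sigma_finite setT ps ->
  measure_spec (pushforward ps
    (fun u : T * n.-tuple T => [the n.+1.-tuple T of u.1 :: u.2])).
Proof.
move=> [F FT Ffin]; set f := (fun u : T * n.-tuple T => _).
have mf : measurable_fun setT f by exact: measurable_cons.
pose m := measure_function_pushforward__canonical__measure_function_Measure ps mf.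
split; [exact: (measure0 m) | by move=> A; exact: (measure_ge0 m) | |].
  exact: (@measure_semi_sigma_additive _ _ _ m).
pose g := fun v : n.+1.-tuple T => (thead v, [tuple of behead v]).
have fK : cancel f g.
  by move=> [x t]; rewrite /f /g; congr pair; exact: val_inj.
have mg : measurable_fun setT g.
  apply/measurable_fun_pairP; split; first exact: measurable_tnth.
  exact: measurable_behead.
exists (fun i => g @^-1` F i).
  apply/seteqP; split=> // v _.
  have : (setT : set (T * n.-tuple T)) (g v) by [].
  by rewrite FT => -[i _ Fi]; exists i.
move=> i; have [mF Foo] := Ffin i; split.
  by rewrite -[X in measurable X]setTI; exact: mg.
rewrite /pushforward (_ : _ @^-1` _ = F i)//.
by apply/seteqP; split=> u /=; rewrite fK.
Qed.

Let lebesgue_tuple_succ_spec n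
    (s : {sigma_finite_measure set (n.-tuple T) -> \bar R}) :
  measure_spec (pushforward (@lebesgue_measure R \x s)
    (fun u : T * n.-tuple T => [the n.+1.-tuple T of u.1 :: u.2])).
Proof.
apply: pushforward_cons_spec.
have /sigma_finiteP[F [TF ndF Foo]] := sigma_finiteT (@lebesgue_measure R).
have /sigma_finiteP[G [TG ndG Goo]] := sigma_finiteT s.
exists (fun i => F i `*` G i).
  rewrite -setXTT TF TG predeqE => -[x y]; split.
    move=> [/= [i _ Fix] [j _ Gjy]]; exists (maxn i j) => //; split.
    - by move: x Fix; exact/subsetPset/ndF/leq_maxl.
    - by move: y Gjy; exact/subsetPset/ndG/leq_maxr.
  by move=> [i _ []/= ? ?]; split; exists i.
move=> i; have [mF Foo_i] := Foo i; have [mG Goo_i] := Goo i.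
split; first exact: measurableX.
have E := product_measure1E (@lebesgue_measure R) s mF mG.
by rewrite [X in X < _]E lte_mul_pinfty// ge0_fin_numE.
Qed.

Let lebesgue_tuple_spec n : measure_spec (@lebesgue_tuple n).
Proof.
elim: n => [|n [m0 mge0 madd mfin]]; first exact: sigma_finite_measure_spec.
pose isM := isMeasure.Build _ _ _ (@lebesgue_tuple n) m0 mge0 madd.
pose m : {measure set _ -> \bar R} := HB.pack (@lebesgue_tuple n) isM.
pose isS := Measure_isSigmaFinite.Build _ _ _ m mfin.
pose s : {sigma_finite_measure set _ -> \bar R} := HB.pack (Measure.sort m) isS.
exact: (lebesgue_tuple_succ_spec s).
Qed.

HB.instance Definition _ n := isMeasure.Build _ _ _ (@lebesgue_tuple n)
  (let: And4 h _ _ _ := lebesgue_tuple_spec n in h)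
  (let: And4 _ h _ _ := lebesgue_tuple_spec n in h)
  (let: And4 _ _ h _ := lebesgue_tuple_spec n in h).
HB.instance Definition _ n := Measure_isSigmaFinite.Build _ _ _
  (@lebesgue_tuple n) (let: And4 _ _ _ h := lebesgue_tuple_spec n in h).

End LebesgueTuple.

Section ComplexIntegral.
Context d (T : measurableType d) (R : realType).
Variable mu : {measure set T -> \bar R}.

Definition cintegrable (f : T -> R[i]) : Prop :=
  mu.-integrable setT (EFin \o (fun x => complex.Re (f x))) /\
  mu.-integrable setT (EFin \o (fun x => complex.Im (f x))).

Definition cintegral (f : T -> R[i]) : R[i] :=
  Complex (\int[mu]_x complex.Re (f x)) (\int[mu]_x complex.Im (f x)).

End ComplexIntegral.

Section SmoothWeights.
Variables (R : realType) (k : nat).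

Fixpoint iter_partial (s : seq 'I_k) (w : 'cV[R]_k -> R) : 'cV[R]_k -> R :=
  if s is j :: s' then fun z => 'D_(delta_mx j 0) (iter_partial s' w) z else w.

Definition smooth (w : 'cV[R]_k -> R) : Prop :=
  forall s : seq 'I_k, continuous (iter_partial s w) /\
    forall j z, derivable (iter_partial s w) z (delta_mx j 0).

Definition compactly_supported (w : 'cV[R]_k -> R) : Prop :=
  compact (closure [set z | w z != 0]).

End SmoothWeights.

Section SingularSeriesAndIntegral.
Variables (R : realType) (k : nat) (Q1 Q2 : 'M[int]_k).

Definition e2pii (t : R) : R[i] :=
  Complex (cos (2 * pi * t)) (sin (2 * pi * t)).

Definition complete_sum (a1 a2 q : nat) : R[i] :=
  \sum_(z : 'cV['I_q]_k)
    let x : 'cV[int]_k := map_mx (fun i : 'I_q => (i : nat)%:Z) z in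
    e2pii ((a1%:Z * qform Q1 x + a2%:Z * qform Q2 x)%:~R / q%:R).

Definition singular_series_term (q : nat) : R[i] :=
  q%:R ^- k *
  \sum_(1 <= a1 < q.+1) \sum_(1 <= a2 < q.+1 | gcdn (gcdn a1 a2) q == 1%N)
    complete_sum a1 a2 q.

(* R[i]^o is R[i] with the topology of its complex modulus. *)
Definition singular_series_partial (N : nat) : R[i]^o :=
  \sum_(1 <= q < N.+1) singular_series_term q.

Definition singular_series : R[i] := limn singular_series_partial.

Definition oscillatory_integral (w : 'cV[R]_k -> R) (theta : R * R) : R[i] :=
  cintegral (@lebesgue_tuple R k) (fun t =>
    let z : 'cV[R]_k := \col_i tnth t i in
    e2pii (theta.1 * qform Q1 z + theta.2 * qform Q2 z) * (w z)%:C%C).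

Definition singular_integral (w : 'cV[R]_k -> R) : R[i] :=
  cintegral (@lebesgue_measure R \x @lebesgue_measure R)%E
    (oscillatory_integral w).

Definition singular_integral_converges (w : 'cV[R]_k -> R) : Prop :=
  cintegrable (@lebesgue_measure R \x @lebesgue_measure R)%E
    (oscillatory_integral w).

End SingularSeriesAndIntegral.

(* Main.v *)
Require Import Defs.
From HB Require Import structures.
From mathcomp Require Import all_boot all_order all_algebra.
From mathcomp Require Import perm algC complex ring lra zify.
From mathcomp Require Import all_classical all_reals all_analysis measurable_realfun.
Import Order.TTheory GRing.Theory Num.Theory.
Import numFieldNormedType.Exports.
Local Open Scope classical_set_scope.
Local Open Scope ring_scope.
Set Implicit Arguments.
Unset Strict Implicit.

(* By Condition 1 the matrices l Q1 + m Q2 have rank at least k - 1, uniformly in (l : m); since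
   k = k1 + k2 >= 10, this gives absolute convergence on both the p-adic and the real side.

   Singular series. Squaring a complete exponential sum gives
   |S(a, q)|^2 <= q^k #{h mod q : 2 (a1 Q1 + a2 Q2) h = 0} = O(q^(k+1)), so the series converges
   absolutely, its q-th term being O(q^-2). Summed over the divisors q of N, the terms give
   N^(2-k) times the number of solutions modulo N; this density is real, multiplicative and,
   by Hensel's lemma at a nonsingular p-adic zero, bounded below along the powers of each prime.
   Taking N = m! and separating small primes from large ones bounds the limit away from 0.

   Singular integral. The square of the inner integral I(theta) is an integral over h of
   integrals with linear phase of slope (theta1 Q1 + theta2 Q2) h; the rank bound confines the h
   of small slope to a thin slab, whence I(theta) = O(1 / ((1 + theta1^2) (1 + theta2^2))).
   Integrated against the triangles (1 - |theta1| / L)^+ (1 - |theta2| / L)^+, I gives the integral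
   of w times a product of two nonnegative Fejer kernels evaluated at Q1 and Q2. This is real,
   and near a nonsingular real zero it is bounded below independently of L; let L tend to
   infinity. *)

(** * The pencil spanned by the two forms *)

(** The rank bound is needed modulo every [q], and with constants over the reals, where linear
    algebra over a field gives nothing. The trace of [\adj (Q1 + t Q2) * Q2] is the derivative in
    [t] of [\det (Q1 + t Q2)], so the bound is carried by a fact that can be written as an identity:
    this determinant has no multiple root. A multiple root would put a common zero of [Q1] and [Q2]
    into the kernel of [Q1 + t Q2], where the two gradients are dependent. The nonzero integer [D]
    of the resulting identity then controls the Smith invariants of pencil members modulo [q],
    bounds real adjugates from below, and excludes singular zeros over domains of characteristic 0.

    In the singular integral the order of integration cannot be exchanged directly, because the
    integrand does not decay in theta before z has been integrated. The triangles repair this, and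
    as their transforms are nonnegative, no density on the variety [Q1 = Q2 = 0] has to be
    constructed. Only approximate zeros are ever needed, so both Hensel's lemma and Newton's method
    run for finitely many steps. *)

Section AdjugateKernel.
Variables (A : comNzRingType) (n : nat).
Implicit Types (M B : 'M[A]_n) (x : 'cV[A]_n).

(** Cramer's rule without division. Prescribing coordinate [j] in place of equation [l] gives a
    matrix whose determinant is an entry of [\adj M], so adjugate entries measure how well that
    coordinate determines a solution. This is used for kernels over rings and, with inequalities,
    over the reals. *)
Definition set_row_delta M (l j : 'I_n) : 'M[A]_n :=
  \matrix_(a, b) if a == l then (b == j)%:R else M a b.

Lemma cofactor_set_row_delta M l j i :
  cofactor (set_row_delta M l j) l i = cofactor M l i.
Proof.
rewrite /cofactor; congr (_ * \det _); apply/matrixP => a b.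
by rewrite !mxE eq_sym (negbTE (neq_lift _ _)).
Qed.

Lemma det_set_row_delta M l j : \det (set_row_delta M l j) = \adj M j l.
Proof.
rewrite (expand_det_row _ l) (bigD1 j) //= big1 ?addr0 => [|b /negbTE bj].
  by rewrite !mxE !eqxx mul1r cofactor_set_row_delta.
by rewrite !mxE eqxx bj mul0r.
Qed.

Lemma adj_set_row_delta M l j i : \adj (set_row_delta M l j) i l = \adj M i l.
Proof. by rewrite !mxE cofactor_set_row_delta. Qed.

Lemma set_row_delta_mul M l j x a :
  (set_row_delta M l j *m x) a 0 = if a == l then x j 0 else (M *m x) a 0.
Proof.
rewrite !mxE; case: eqP => [->|/eqP/negbTE al].
  rewrite (bigD1 j) //= !mxE !eqxx mul1r big1 ?addr0 // => b /negbTE bj.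
  by rewrite !mxE eqxx bj mul0r.
by apply: eq_bigr => b _; rewrite !mxE al.
Qed.

(** Columns of the adjugate are proportional to any kernel vector [x]. With row [l] replaced, [x]
    solves [M' *m x = x j 0 *: delta_mx l 0], and multiplying by [\adj M'] compares coordinates. *)
Lemma adj_mul_kernel M x i j l :
  M *m x = 0 -> x i 0 * \adj M j l = x j 0 * \adj M i l.
Proof.
move=> Mx; set M' := set_row_delta M l j.
have M'x : M' *m x = x j 0 *: delta_mx l 0.
  apply/matrixP => a b; rewrite ord1 set_row_delta_mul Mx !mxE eqxx andbT.
  by case: eqP; rewrite ?mulr1 ?mulr0.
have /matrixP/(_ i 0) := congr1 (mulmx (\adj M')) M'x.
rewrite mulmxA mul_adj_mx mul_scalar_mx -scalemxAr -colE det_set_row_delta.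
rewrite [LHS]mxE => E; rewrite mulrC E [LHS]mxE; congr (_ * _).
by rewrite [LHS]mxE adj_set_row_delta.
Qed.

(** For symmetric [M] the rows of the adjugate are proportional to [x] as well, so up to scalars the
    adjugate is the rank one matrix [x *m x^T], and its trace against [B] is the value of the form
    [B] at [x]. *)
Lemma adj_trace_kernel M B x i : M^T = M -> M *m x = 0 ->
  x i 0 ^+ 2 * \tr (\adj M *m B) = \adj M i i * (x^T *m B *m x) 0 0.
Proof.
move=> Msym Mx.
have adjC a b : \adj M a b = \adj M b a.
  by rewrite -{1}Msym -trmx_adj [LHS]mxE.
have E j l : x i 0 ^+ 2 * \adj M j l = \adj M i i * (x j 0 * x l 0).
  rewrite expr2 -mulrA (adj_mul_kernel i j l Mx) mulrCA adjC.
  by rewrite (adj_mul_kernel i l i Mx); ring.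
rewrite /mxtrace [X in _ = _ * X]mxE !mulr_sumr; apply: eq_bigr => j _.
rewrite ![X in _ = _ * (X * _)]mxE [X in _ * X = _]mxE mulr_suml !mulr_sumr.
by apply: eq_bigr => l _; rewrite [LHS]mulrA E [x^T _ _]mxE; ring.
Qed.
End AdjugateKernel.

(** * Homogenization of integer polynomials in one variable *)

Section Homogenization.
Variables (A : comNzRingType) (l m : A).
Implicit Types p q : {poly int}.

(** This is [l ^+ d * p(m / l)] with denominators cleared. Letting [l] and [m] range over an
    arbitrary ring is what transports identities of integer polynomials to residue rings and to real
    polynomials. *)
Definition homog d p : A :=
  \sum_(s < d.+1) (p`_s)%:~R * (m ^+ s * l ^+ (d - s)).

Lemma homogD d p q : homog d (p + q) = homog d p + homog d q.
Proof.
by rewrite -big_split; apply: eq_bigr => s _; rewrite coefD intrD mulrDl.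
Qed.

Lemma homog0 d : homog d 0 = 0.
Proof. by apply: big1 => s _; rewrite coef0 mul0r. Qed.

Lemma homog_sum d (I : Type) (r : seq I) P (F : I -> {poly int}) :
  homog d (\sum_(i <- r | P i) F i) = \sum_(i <- r | P i) homog d (F i).
Proof.
by elim/big_rec2: _ => [|i x y _ <-]; rewrite ?homog0 // homogD.
Qed.

Lemma homogZ d (c : int) p : homog d (c *: p) = c%:~R * homog d p.
Proof.
by rewrite mulr_sumr; apply: eq_bigr => s _; rewrite coefZ intrM mulrA.
Qed.

Lemma homogXn d s : (s <= d)%N -> homog d 'X^s = m ^+ s * l ^+ (d - s).
Proof.
rewrite -ltnS => sd; rewrite /homog (bigD1 (Ordinal sd)) //= coefXn eqxx mul1r.
rewrite big1 ?addr0 // => i /negbTE; rewrite -val_eqE /= => is_.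
by rewrite coefXn is_ mul0r.
Qed.

Lemma homogC d (c : int) : homog d c%:P = c%:~R * l ^+ d.
Proof.
by rewrite -[c%:P]mulr1 mul_polyC homogZ -(expr0 'X) homogXn // mul1r subn0.
Qed.

Lemma poly_monomials d p : (size p <= d.+1)%N ->
  p = \sum_(s < d.+1) p`_s *: 'X^s.
Proof.
move=> sp; rewrite -(poly_def _ (fun s => p`_s)); apply/polyP => i.
by rewrite coef_poly; case: ltnP => // /(leq_trans sp)/(nth_default _).
Qed.

Lemma homogM d e p q : (size p <= d.+1)%N -> (size q <= e.+1)%N ->
  homog (d + e) (p * q) = homog d p * homog e q.
Proof.
move=> /poly_monomials-> /poly_monomials->.
rewrite mulr_suml !homog_sum mulr_suml; apply: eq_bigr => i _.
rewrite mulr_sumr homog_sum mulr_sumr; apply: eq_bigr => j _.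
have [id je] := (ltn_ord i, ltn_ord j); rewrite !ltnS in id je.
rewrite -scalerAl -scalerAr -exprD !homogZ !homogXn //; last exact: leq_add.
by rewrite exprD (_ : d + e - (i + j) = (d - i) + (e - j))%N ?exprD; [ring|lia].
Qed.

Lemma homog_prod (I : Type) (r : seq I) (F : I -> {poly int}) :
  (forall i, (size (F i) <= 2)%N) ->
  (size (\prod_(i <- r) F i)%R <= (size r).+1)%N /\
  homog (size r) (\prod_(i <- r) F i) = \prod_(i <- r) homog 1 (F i).
Proof.
move=> F2; elim: r => [|i r [IHs IHh]].
  by rewrite !big_nil size_poly1 homogC expr0 mulr1.
rewrite !big_cons /= -IHh -[in homog (size r).+1]add1n homogM //; split=> //.
apply: leq_trans (size_polyMleq _ _) _; move: (F2 i) IHs.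
by move: (size _) (size (\prod_(j <- r) F j)%R) (size _) => a b c; lia.
Qed.

Lemma homog_det n (P : 'M[{poly int}]_n) :
  (forall i j, (size (P i j) <= 2)%N) ->
  (size (\det P) <= n.+1)%N /\
  homog n (\det P) = \det (map_mx (homog 1) P).
Proof.
move=> P2; have sumn : size (index_enum 'I_n) = n.
  by rewrite [index_enum _]unlock -enumT size_enum_ord.
have H s := homog_prod (index_enum 'I_n) (fun i => P2 i ((s : 'S_n) i)).
rewrite sumn in H.
split.
  apply: (leq_trans (size_sum _ _ _)); apply/bigmax_leqP => s _.
  by rewrite -signr_odd mulr_sign; case: ifP; rewrite ?size_polyN (H s).1.
rewrite homog_sum; apply: eq_bigr => s _.
have -> : (-1) ^+ s * \prod_i P i (s i) = (-1) ^+ s *: \prod_i P i (s i) :> {poly int}.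
  by rewrite -mul_polyC rmorphXn rmorphN.
rewrite homogZ (H s).2 rmorphXn rmorphN rmorph1; congr (_ * _).
by apply: eq_bigr => i _; rewrite mxE.
Qed.

Lemma homog_adj n (P : 'M[{poly int}]_n) i j :
  (forall i j, (size (P i j) <= 2)%N) ->
  (size (\adj P i j) <= n.-1.+1)%N /\
  homog n.-1 (\adj P i j) = \adj (map_mx (homog 1) P) i j.
Proof.
move=> P2; have [|s h] := @homog_det _ (row' j (col' i P)).
  by move=> a b; rewrite !mxE.
rewrite !mxE /cofactor.
have -> : (-1) ^+ (j + i) * \det (row' j (col' i P)) =
    (-1) ^+ (j + i) *: \det (row' j (col' i P)) :> {poly int}.
  by rewrite -mul_polyC rmorphXn rmorphN.
split; first by rewrite (leq_trans (size_scale_leq _ _)).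
rewrite homogZ h rmorphXn rmorphN rmorph1; congr (_ * \det _).
by apply/matrixP => a b; rewrite !mxE.
Qed.

End Homogenization.

Lemma homog_horner (A : comNzRingType) (t : A) d (p : {poly int}) : (size p <= d.+1)%N ->
  (map_poly intr p).[t] = homog 1 t d p.
Proof.
move=> sp; rewrite (@horner_coef_wide _ d.+1) ?(leq_trans (size_poly _ _)) //.
by apply: eq_bigr => i _; rewrite coef_map expr1n mulr1.
Qed.

(** Without a common root in [algC] the polynomials are coprime over the rationals; the integers [a]
    and [b] clear the denominators of the two Bezout coefficients. *)
Lemma no_common_root_Bezout (F G : {poly int}) :
  (forall t : algC, ~ (root (map_poly intr F) t /\ root (map_poly intr G) t)) ->
  exists (U V : {poly int}) (D : int), D != 0 /\ U * F + V * G = D%:P.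
Proof.
move=> nr; set f := map_poly (intr : int -> rat) F.
set g := map_poly (intr : int -> rat) G.
have mapE (H : {poly int}) : map_poly (ratr : rat -> algC) (map_poly intr H) = map_poly intr H.
  by rewrite -map_poly_comp; apply: eq_map_poly => c /=; rewrite ratr_int.
have : coprimep f g.
  rewrite -(coprimep_map (@ratr algC)) !mapE.
  rewrite /coprimep; apply/negPn/negP => s1.
  have [t] := closed_rootP _ s1.
  by rewrite root_gcd => /andP[r1 r2]; exact: (nr t).
case/Bezout_eq1_coprimepP => -[u v] /= uv.
have [U [a a0 uE]] := rat_poly_scale u; have [V [b b0 vE]] := rat_poly_scale v.
exists (b *: U), (a *: V), (a * b); split; first by rewrite mulf_neq0.
have inj : injective (map_poly (intr : int -> rat)).
  by apply: map_inj_poly => // x y /eqP; rewrite eqr_int => /eqP.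
apply: inj; rewrite rmorphD !rmorphM /= !map_polyZ !map_polyC /= -polyCM.
move: uv; rewrite uE vE /f /g => uv.
have a0' : a%:~R != 0 :> rat by rewrite intr_eq0.
have b0' : b%:~R != 0 :> rat by rewrite intr_eq0.
rewrite -[RHS]mulr1 -uv mulrDr -!scalerAl mul_polyC -[X in _ = X + _]scalerA.
rewrite mul_polyC !scalerA; congr (_ *: _ + _ *: _); by field; rewrite ?a0' ?b0'.
Qed.

Section Pencil.
Variables (n : nat) (Q1 Q2 : 'M[int]_n).
Hypothesis Q1sym : integral_form Q1.
Hypothesis Q2sym : integral_form Q2.

Definition pencil (A : comNzRingType) (l m : A) : 'M[A]_n :=
  l *: map_mx intr Q1 + m *: map_mx intr Q2.

Lemma pencil_sym (A : comNzRingType) (l m : A) : (pencil l m)^T = pencil l m.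
Proof. by rewrite linearD !linearZ /= !map_trmx Q1sym Q2sym. Qed.

Lemma qform_pencil (A : comNzRingType) (l m : A) (z : 'cV[A]_n) :
  (z^T *m pencil l m *m z) 0 0 = l * qform Q1 z + m * qform Q2 z.
Proof.
rewrite /qform mulmxDr mulmxDl mxE -!scalemxAr -!scalemxAl.
by rewrite [X in X + _]mxE [X in _ + X]mxE.
Qed.

Hypothesis hC : condition1 Q1 Q2.

(** Pairing the kernel relation with [z] gives [Q1(z) = - t Q2(z) = 0], so [z] is a common zero, and
    the same relation makes the two gradients dependent. *)
Lemma condition1_pencil_kernel (t : algC) (z : 'cV[algC]_n) :
  z != 0 -> pencil 1 t *m z = 0 -> qform Q2 z = 0 -> False.
Proof.
move=> z0 Mz Q2z; have := qform_pencil 1 t z.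
rewrite -mulmxA Mz mulmx0 mxE Q2z mulr0 addr0 mul1r => /esym Q1z.
have := hC z0 Q1z Q2z; set C := col_mx _ _ => rC.
have : row_free C by rewrite /row_free rC.
move=> fC; have := mulmx_free_eq0 (row_mx 1%:M t%:M : 'rV_(1 + 1)) fC.
rewrite mul_row_col mul1mx mul_scalar_mx !qgradientE // (scalerA t) (mulrC t).
rewrite -scalerA -scalerDr.
rewrite -linearZ -linearD /= scalemxAl -mulmxDl.
rewrite (_ : _ + _ = pencil 1 t) ?Mz; last by rewrite /pencil scale1r.
rewrite trmx0 scaler0 eqxx => /esym/eqP/(congr1 lsubmx).
by rewrite row_mxKl linear0 => /matrixP/(_ 0 0)/eqP; rewrite !mxE oner_eq0.
Qed.

Lemma qformD (A : comNzRingType) (Q : 'M[int]_n) (x y : 'cV[A]_n) :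
  integral_form Q -> qform Q (x + y) =
  qform Q x + 2 * (x^T *m map_mx intr Q *m y) 0 0 + qform Q y.
Proof.
move=> Qs; rewrite /qform [(x + y)^T]linearD /= !mulmxDl !mulmxDr.
have -> : y^T *m map_mx intr Q *m x = (x^T *m map_mx intr Q *m y)^T :> 'M[A]_1.
  by rewrite !trmx_mul trmxK map_trmx Qs mulmxA.
have addE (X Y : 'M[A]_1) : (X + Y) 0 0 = X 0 0 + Y 0 0 by rewrite mxE.
by rewrite !addE [X in _ + (X + _)]mxE; ring.
Qed.

Lemma qformZ (A : comNzRingType) (Q : 'M[int]_n) (a : A) (x : 'cV[A]_n) :
  qform Q (a *: x) = a ^+ 2 * qform Q x.
Proof.
by rewrite /qform [(a *: x)^T]linearZ /= -!scalemxAr -!scalemxAl scalerA mxE expr2.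
Qed.

(** By the trace identity a kernel vector [x] satisfies [\adj M i i * Q2(x) = 0]. Either [Q2(x) = 0]
    at once, or [\adj M i i = 0] supplies a second kernel vector, and then some nonzero vector of
    the kernel plane is a zero of [Q2]. *)
Lemma condition1_no_common_root (t : algC) :
  \det (pencil 1 t) = 0 ->
  \tr (\adj (pencil 1 t) *m map_mx intr Q2) = 0 -> False.
Proof.
set M := pencil 1 t; have Ms : M^T = M := pencil_sym 1 t.
move=> /eqP/det0P[v v0 vM] tr0.
pose x := v^T; have Mx : M *m x = 0.
  by rewrite -[M]Ms -trmx_mul vM trmx0.
have x0 : x != 0 by rewrite -(inj_eq trmx_inj) trmxK trmx0.
have [i xi] : exists i, x i 0 != 0.
  by have /cV0Pn[i xi] := x0; exists i.
have := adj_trace_kernel (map_mx intr Q2) i Ms Mx.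
rewrite tr0 mulr0 => /esym/eqP; rewrite mulf_eq0 => /orP[/eqP adj0|/eqP Q2x];
  last exact: (condition1_pencil_kernel x0 Mx).
(* [\adj M i i] is the determinant of [M] with row [i] replaced by the [i]th coordinate form. Row
   [i] of [M *m y], lost in the replacement, vanishes because [x^T *m M = 0] and [x i 0 != 0]. *)
have [y y0 [yi My]] : exists2 y : 'cV[algC]_n, y != 0 & y i 0 = 0 /\ M *m y = 0.
  have : \det (set_row_delta M i i)^T == 0 by rewrite det_tr det_set_row_delta adj0.
  case/det0P => u u0 uM; exists u^T; first by rewrite -(inj_eq trmx_inj) trmxK trmx0.
  have Ny : set_row_delta M i i *m u^T = 0.
    by rewrite -[set_row_delta _ _ _]trmxK -trmx_mul uM trmx0.
  have Na a := set_row_delta_mul M i i (u^T) a.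
  have ui : (u^T) i 0 = 0 by have := Na i; rewrite Ny eqxx mxE.
  have Ma a : a != i -> (M *m u^T) a 0 = 0.
    by move=> /negbTE ai; have := Na a; rewrite Ny ai mxE => <-.
  split=> //; apply/matrixP => a b; rewrite ord1 [RHS]mxE.
  have [->|/Ma //] := eqVneq a i.
  have : (x^T *m (M *m u^T)) 0 0 = 0.
    by rewrite mulmxA -[M]Ms -trmx_mul Mx trmx0 mul0mx mxE.
  rewrite mxE (bigD1 i) //= big1 ?addr0 => [|c /Ma ->]; last by rewrite mulr0.
  by move/eqP; rewrite mulf_eq0 mxE (negbTE xi) => /eqP.
have [Q2y|Q2y] := eqVneq (qform Q2 y) 0; first exact: (condition1_pencil_kernel y0 My).
pose b := (x^T *m map_mx intr Q2 *m y) 0 0.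
(* A root of the quadratic polynomial [Q2(x + T y)] in [T]. The vector [x + be y] is nonzero because
   its [i]th coordinate is still [x i 0]. *)
pose be := (- b + sqrtC (b ^+ 2 - qform Q2 x * qform Q2 y)) / qform Q2 y.
apply: (@condition1_pencil_kernel t (x + be *: y)).
- by apply/cV0Pn; exists i; rewrite mxE [X in _ + X]mxE yi mulr0 addr0.
- by rewrite mulmxDr -scalemxAr Mx My scaler0 addr0.
- rewrite qformD // qformZ -scalemxAr [X in 2 * X]mxE -/b /be.
  set s := sqrtC _; have s2 : s ^+ 2 = b ^+ 2 - qform Q2 x * qform Q2 y by exact: sqrtCK.
  by apply: (mulIf Q2y); rewrite mul0r; field: s2.
Qed.

Lemma condition1_pencil_identity : (0 < n)%N ->
  exists (D : int) (e : nat), D != 0 /\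
    forall (A : comNzRingType) (l m : A), exists a b : A,
      D%:~R * l ^+ e = a * \det (pencil l m)
        + b * \tr (\adj (pencil l m) *m map_mx intr Q2).
Proof.
move=> n0; pose P : 'M[{poly int}]_n := map_mx polyC Q1 + 'X *: map_mx polyC Q2.
have P2 i j : (size (P i j) <= 2)%N.
  rewrite !mxE (leq_trans (size_polyD _ _)) // geq_max.
  rewrite (leq_trans (size_polyC_leq1 _)) //=.
  rewrite mulrC (leq_trans (size_polyMleq _ _)) // size_polyX.
  by have := size_polyC_leq1 (Q2 i j); lia.
have hP (A : comNzRingType) (l m : A) : map_mx (homog l m 1) P = pencil l m.
  apply/matrixP => i j; rewrite !mxE homogD homogC expr1 mulrC; congr (_ + _).
  by rewrite mulrC mul_polyC homogZ -['X]expr1 homogXn // subnn expr0 mulr1 expr1 mulrC.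
pose F := \det P; pose G := \tr (\adj P *m map_mx polyC Q2).
have GE : G = \sum_i \sum_j Q2 j i *: \adj P i j.
  apply: eq_bigr => i _; rewrite mxE; apply: eq_bigr => j _.
  by rewrite [map_mx _ _ _ _]mxE mulrC mul_polyC.
have sG : (size G <= n.-1.+1)%N.
  rewrite GE (leq_trans (size_sum _ _ _)) //; apply/bigmax_leqP => i _.
  rewrite (leq_trans (size_sum _ _ _)) //; apply/bigmax_leqP => j _.
  by rewrite (leq_trans (size_scale_leq _ _)) // (homog_adj 0 (0 : int) i j P2).1.
have hG (A : comNzRingType) (l m : A) :
    homog l m n.-1 G = \tr (\adj (pencil l m) *m map_mx intr Q2).
  rewrite GE homog_sum; apply: eq_bigr => i _; rewrite homog_sum mxE.
  apply: eq_bigr => j _; rewrite homogZ (homog_adj l m i j P2).2 hP.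
  by rewrite [map_mx _ _ _ _]mxE mulrC.
have sF : (size F <= n.+1)%N := (homog_det 0 (0 : int) P2).1.
have hF (A : comNzRingType) (l m : A) : homog l m n F = \det (pencil l m).
  by rewrite (homog_det l m P2).2 hP.
have [|U [V [D [D0 UV]]]] := @no_common_root_Bezout F G.
  move=> t [/rootP]; rewrite (homog_horner _ sF) hF => dt0 /rootP.
  by rewrite (homog_horner _ sG) hG; exact: condition1_no_common_root.
(* [F] has degree at most [n] and [G] at most [n - 1], so [V] is homogenized in degree [d.+1] to
   give both products degree [d + n]. *)
pose d := maxn (size U) (size V).
have sU : (size U <= d.+1)%N by rewrite leqW // leq_maxl.
have sV : (size V <= d.+1.+1)%N by rewrite !leqW // leq_maxr.
exists D, (d + n)%N; split=> // A l m; exists (homog l m d U), (homog l m d.+1 V).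
rewrite -hF -hG -!homogM // -(homogC l m) -UV homogD.
by congr (_ + homog _ _ _ _); lia.
Qed.

End Pencil.

Lemma condition1C n (Q1 Q2 : 'M[int]_n) : condition1 Q1 Q2 -> condition1 Q2 Q1.
Proof.
move=> h z z0 q2 q1; rewrite -[RHS](h z z0 q1 q2) -!addsmxE.
by rewrite addsmxC.
Qed.

(* Condition 1 forbids a common root of [det(Q1 + t Q2)] and [tr(adj(Q1 + t Q2) Q2)], so they
   satisfy a Bezout identity over Z; homogenized, it holds in every commutative ring. *)
Lemma condition1_ideal n (Q1 Q2 : 'M[int]_n) :
  integral_form Q1 -> integral_form Q2 -> condition1 Q1 Q2 -> (0 < n)%N ->
  exists (D : int) (e : nat), D != 0 /\
    forall (A : comNzRingType) (l m : A),
      (exists a b : A, D%:~R * l ^+ e = a * \det (pencil Q1 Q2 l m)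
        + b * \tr (\adj (pencil Q1 Q2 l m) *m map_mx intr Q2)) /\
      (exists a b : A, D%:~R * m ^+ e = a * \det (pencil Q1 Q2 l m)
        + b * \tr (\adj (pencil Q1 Q2 l m) *m map_mx intr Q1)).
Proof.
move=> s1 s2 hC n0.
have [D1 [e1 [D10 H1]]] := condition1_pencil_identity s1 s2 hC n0.
have [D2 [e2 [D20 H2]]] := condition1_pencil_identity s2 s1 (condition1C hC) n0.
exists (D1 * D2), (e1 + e2)%N; split; first by rewrite mulf_neq0.
move=> A l m; split.
  have [a [b E]] := H1 A l m; pose c := D2%:~R * l ^+ e2.
  exists (c * a), (c * b); transitivity (c * (D1%:~R * l ^+ e1)).
    by rewrite /c intrM exprD; ring.
  by rewrite E mulrDr !mulrA.
have [a [b E]] := H2 A m l; pose c := D1%:~R * m ^+ e1.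
have -> : pencil Q1 Q2 l m = pencil Q2 Q1 m l by exact: addrC.
exists (c * a), (c * b); transitivity (c * (D2%:~R * m ^+ e2)).
    by rewrite /c intrM exprD; ring.
  by rewrite E mulrDr !mulrA.
Qed.

Lemma mulmx_col_eq0_det (A : comNzRingType) n (M : 'M[A]_n) (x : 'cV[A]_n) i :
  M *m x = 0 -> \det M * x i 0 = 0.
Proof.
move=> Mx; have /matrixP/(_ i 0) := congr1 (mulmx (\adj M)) Mx.
by rewrite mulmxA mul_adj_mx mul_scalar_mx mulmx0 !mxE.
Qed.

(** A division-free form of the nonsingularity of the variety. At a common zero in the kernel of a
    pencil member, [\det M * x i 0] and both traces times [x i 0 ^+ 2] vanish, so the ideal identity
    times [x i 0 ^+ 2] has right side 0. *)
Lemma condition1_singular_zero n (Q1 Q2 : 'M[int]_n) :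
  integral_form Q1 -> integral_form Q2 -> condition1 Q1 Q2 -> (0 < n)%N ->
  exists (D : int) (e : nat), D != 0 /\
    forall (A : comNzRingType) (l m : A) (x : 'cV[A]_n),
      pencil Q1 Q2 l m *m x = 0 -> qform Q1 x = 0 -> qform Q2 x = 0 ->
      forall i, D%:~R * l ^+ e * x i 0 ^+ 2 = 0 /\ D%:~R * m ^+ e * x i 0 ^+ 2 = 0.
Proof.
move=> s1 s2 hC n0; have [D [e [D0 H]]] := condition1_ideal s1 s2 hC n0.
exists D, e; split=> // A l m x Mx q1 q2 i.
have Ms := pencil_sym s1 s2 l m.
have dx := mulmx_col_eq0_det i Mx.
have [[a [b ->]] [a' [b' ->]]] := H A l m.
have T1 := adj_trace_kernel (map_mx intr Q1) i Ms Mx.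
have T2 := adj_trace_kernel (map_mx intr Q2) i Ms Mx.
rewrite -/(qform Q1 x) q1 mulr0 in T1; rewrite -/(qform Q2 x) q2 mulr0 in T2.
split; rewrite mulrDl -[X in _ + X]mulrA [X in _ + _ * X]mulrC ?T1 ?T2 mulr0 addr0.
  by rewrite expr2 mulrA -[a * _ * _]mulrA dx mulr0 mul0r.
by rewrite expr2 mulrA -[a' * _ * _]mulrA dx mulr0 mul0r.
Qed.

(** * Nonsingular zeros and Newton's method *)

Section NonsingularZero.
Variables (n : nat) (Q1 Q2 : 'M[int]_n).
Hypotheses (s1 : integral_form Q1) (s2 : integral_form Q2).
Hypotheses (hC : condition1 Q1 Q2) (n0 : (0 < n)%N).

(** Since the gradient is [2 Q x], four times this is the minor of the gradients in columns [i] and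
    [j]. *)
Definition grad_minor (A : comNzRingType) (x : 'cV[A]_n) (i j : 'I_n) : A :=
  (map_mx intr Q1 *m x) i 0 * (map_mx intr Q2 *m x) j 0
  - (map_mx intr Q1 *m x) j 0 * (map_mx intr Q2 *m x) i 0.

(** Stated for any domain of characteristic 0, to be applied to the p-adic integers and to the
    reals. If all minors vanish, [(v j 0, - u j 0)] is a relation between [u = Q1 x] and [v = Q2 x]
    for every [j]. Relations are trivial by [condition1_singular_zero], so [u = v = 0], and then
    [(1, 0)] is a nontrivial relation. *)
Lemma nonsingular_zero (A : comNzRingType) (x : 'cV[A]_n) :
  (forall a b : A, a * b = 0 -> a = 0 \/ b = 0) ->
  (forall D : int, D != 0 -> D%:~R != 0 :> A) ->
  x != 0 -> qform Q1 x = 0 -> qform Q2 x = 0 ->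
  exists i j, grad_minor x i j != 0.
Proof.
move=> dom ch x0 q1 q2; apply: contrapT => /forallNP nm.
have {}nm i j : grad_minor x i j = 0.
  by have /forallNP/(_ j)/negP/negPn/eqP := nm i.
have [D [e [D0 H]]] := condition1_singular_zero s1 s2 hC n0.
have [i xi] : exists i, x i 0 != 0 by have /cV0Pn[i xi] := x0; exists i.
have x20 : x i 0 ^+ 2 != 0.
  by apply: contra_neqN xi; rewrite expr2 => /eqP/dom[].
have pow0 (a : A) k : a ^+ k = 0 -> a = 0.
  elim: k => [|k IH]; first by move/eqP; rewrite expr0 oner_eq0.
  by rewrite exprS => /dom[//|/IH].
have kill l m : pencil Q1 Q2 l m *m x = 0 -> l = 0 /\ m = 0.
  move=> Mx; have [h1 h2] := H A l m x Mx q1 q2 i.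
  by split; [move: h1|move: h2] => /dom[/dom[/eqP|/pow0]|/eqP] //;
    rewrite ?(negbTE x20) ?(negbTE (ch _ D0)).
pose u := map_mx intr Q1 *m x; pose v := map_mx intr Q2 *m x.
have pE l m a : (pencil Q1 Q2 l m *m x) a 0 = l * u a 0 + m * v a 0.
  by rewrite mulmxDl -!scalemxAl mxE [X in X + _]mxE [X in _ + X]mxE.
have uv j : v j 0 = 0 /\ u j 0 = 0.
  have [|-> /eqP] := kill (v j 0) (- u j 0).
    apply/matrixP => a b; rewrite ord1 pE [RHS]mxE -(nm a j) /grad_minor -/u -/v.
    by ring.
  by rewrite oppr_eq0 => /eqP.
have [|/eqP] := kill 1 0; last by rewrite oner_eq0.
by apply/matrixP => a b; rewrite ord1 pE [RHS]mxE (uv a).1 (uv a).2 !mulr0 addr0.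
Qed.

End NonsingularZero.

(** * The p-adic integers as a domain of characteristic 0 *)

Section Padic.
Variables (p : nat) (p_pr : prime p).

Lemma prime_exp_gt1 m : (1 < p ^ m.+1)%N.
Proof. by rewrite -(exp1n m.+1) ltn_exp2r // prime_gt1. Qed.

Lemma Zp_trunc_exp m : (Zp_trunc (p ^ m.+1)).+2 = (p ^ m.+1)%N.
Proof. by rewrite Zp_cast // prime_exp_gt1. Qed.

Lemma padic_modn (x : padic_int p) m d : (x m = x (m + d) %% p ^ m.+1 :> nat)%N.
Proof.
elim: d => [|d IH].
  by rewrite addn0 modn_small // -[X in (_ < X)%N]Zp_trunc_exp ltn_ord.
rewrite IH -(padic_coherent x (m + d)) addnS /=.
rewrite [X in (_ %% X %% _)%N]Zp_trunc_exp modn_dvdm //.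
by rewrite dvdn_exp2l // ltnS leq_addr.
Qed.

Definition padic_level m (x : padic_int p) : 'Z_(p ^ m.+1) := x m.

Fact padic_level_is_zmod m : zmod_morphism (@padic_level m).
Proof. by []. Qed.
HB.instance Definition _ m :=
  GRing.isZmodMorphism.Build _ _ (@padic_level m) (padic_level_is_zmod m).
Fact padic_level_is_monoid m : monoid_morphism (@padic_level m).
Proof. by []. Qed.
HB.instance Definition _ m :=
  GRing.isMonoidMorphism.Build _ _ (@padic_level m) (padic_level_is_monoid m).

Lemma intr_Zp_eq0 m (c : int) : (c%:~R == 0 :> 'Z_(p ^ m.+1)) = ((p ^ m.+1)%:Z %| c)%Z.
Proof.
have gt1 := prime_exp_gt1 m.
have nE (k : nat) : (k%:R == 0 :> 'Z_(p ^ m.+1)) = (p ^ m.+1 %| k)%N.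
  by rewrite -val_eqE /= val_Zp_nat.
by case: c => k; rewrite ?NegzE ?rmorphN ?oppr_eq0 dvdzE /= ?abszN nE.
Qed.

Lemma padic_neq0 (x : padic_int p) : x != 0 -> exists m, x m != 0.
Proof.
move=> x0; apply: contrapT => /forallNP h; move/eqP: x0; apply.
by apply: padic_intP => m; have /negP/negPn/eqP := h m.
Qed.

Lemma padic_dom (x y : padic_int p) : x * y = 0 -> x = 0 \/ y = 0.
Proof.
move=> xy; have [->|/padic_neq0[a xa]] := eqVneq x 0; first by left.
have [->|/padic_neq0[b yb]] := eqVneq y 0; first by right.
(* The residues of [x] and [y] at level [N] have valuation at most [a] and [b], while [x * y = 0]
   forces these valuations to add up to more than [a + b]. *)
exfalso; pose N := (a + b).+1.
have dvd_of (z : padic_int p) m : (m <= N)%N -> z m != 0 -> ~~ (p ^ m.+1 %| z N)%N.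
  by move=> mN; rewrite -val_eqE /= (padic_modn z m (N - m)) subnKC.
have /dvd_of - /(_ (leq_trans (leq_addr b a) (leqnSn _))) xN := xa.
have /dvd_of - /(_ (leq_trans (leq_addl a b) (leqnSn _))) yN := yb.
have : (p ^ N.+1 %| x N * y N)%N.
  have := congr1 (fun z : padic_int p => val (z N)) xy.
  by rewrite /= [X in (_ %% X)%N]Zp_trunc_exp => /eqP.
have xN0 : (0 < x N)%N by rewrite lt0n; apply: contraNneq xN => ->.
have yN0 : (0 < y N)%N by rewrite lt0n; apply: contraNneq yN => ->.
rewrite !pfactor_dvdn ?muln_gt0 ?xN0 // lognM // in xN yN *.
by rewrite /N in xN yN *; lia.
Qed.

Lemma padic_char0 (D : int) : D != 0 -> D%:~R != 0 :> padic_int p.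
Proof.
move=> D0; apply/eqP => /(congr1 (@padic_level `|D|)); rewrite rmorph_int rmorph0.
move/eqP; rewrite intr_Zp_eq0 dvdzE /= => /dvdn_leq; rewrite absz_gt0 => /(_ D0).
by rewrite leqNgt ltnW // ltn_expl // prime_gt1.
Qed.

(** Truncations of a single p-adic zero. The indices and [s] do not depend on [N], so the precision
    can be chosen afterwards, beyond twice the valuation of the minor. *)
Lemma padic_zero_approx n (Q1 Q2 : 'M[int]_n) :
  integral_form Q1 -> integral_form Q2 -> condition1 Q1 Q2 -> (0 < n)%N ->
  nonzero_solution (padic_int p) Q1 Q2 ->
  exists i j s, forall N, exists X : 'cV[int]_n,
    [/\ ((p ^ N)%:Z %| qform Q1 X)%Z, ((p ^ N)%:Z %| qform Q2 X)%Z &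
        ~~ ((p ^ s.+1)%:Z %| grad_minor Q1 Q2 X i j)%Z].
Proof.
move=> s1 s2 hC n0 [x [x0 q1 q2]].
have [i [j /padic_neq0[s Dij]]] :=
  nonsingular_zero s1 s2 hC n0 padic_dom padic_char0 x0 q1 q2.
exists i, j, s => N; pose X : 'cV[int]_n := \col_a (x a 0 (maxn s N) : nat)%:Z.
have XE m : (m <= maxn s N)%N -> map_mx intr X = map_mx (@padic_level m) x.
  move=> mN; apply/matrixP => a b; rewrite !mxE ord1.
  apply: val_inj; rewrite [LHS]val_Zp_nat ?prime_exp_gt1 // [RHS](padic_modn _ m (maxn s N - m)).
  by rewrite subnKC.
have mapQ m (Q : 'M[int]_n) : map_mx (@padic_level m) (map_mx intr Q) = map_mx intr Q.
  by apply/matrixP => a b; rewrite !mxE rmorph_int.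
have mapQZ m (Q : 'M[int]_n) : map_mx (intr : int -> 'Z_(p ^ m.+1)) (map_mx intr Q) = map_mx intr Q.
  by apply/matrixP => a b; rewrite !mxE intz.
have qE m (Q : 'M[int]_n) : (m <= maxn s N)%N -> qform Q x = 0 ->
    ((p ^ m.+1)%:Z %| qform Q X)%Z.
  move=> mN qx; rewrite -intr_Zp_eq0 /qform.
  have -> (Y : 'M[int]_1) : (Y 0 0)%:~R = (map_mx intr Y) 0 0 :> 'Z_(p ^ m.+1).
    by rewrite mxE.
  rewrite !map_mxM /= mapQZ -map_trmx (XE _ mN) map_trmx -(mapQ m Q) -!map_mxM.
  by rewrite mxE -/(qform Q x) qx.
have dvdN (c : int) : ((p ^ N.+1)%:Z %| c)%Z -> ((p ^ N)%:Z %| c)%Z.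
  by apply: dvdz_trans; rewrite dvdzE /= dvdn_exp2l.
have QN (Q : 'M[int]_n) : qform Q x = 0 -> ((p ^ N)%:Z %| qform Q X)%Z.
  by move=> qx; apply/dvdN/qE; [exact: leq_maxr | exact: qx].
exists X; split; [exact: QN | exact: QN |].
rewrite -intr_Zp_eq0; apply: contra Dij => /eqP Dij.
have uE (Q : 'M[int]_n) a : ((map_mx intr Q *m X) a 0)%:~R =
    padic_level s ((map_mx intr Q *m x) a 0).
  transitivity ((map_mx intr (map_mx intr Q *m X)) a 0 : 'Z_(p ^ s.+1)).
    by rewrite [RHS]mxE.
  rewrite map_mxM mapQZ XE; last exact: leq_maxl.
  by rewrite -(mapQ s Q) -map_mxM [LHS]mxE.
apply/eqP; rewrite -[LHS]/(padic_level s _) rmorphB !rmorphM /= -!uE.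
by rewrite -!intrM -intrB.
Qed.

End Padic.

Lemma scalemx_entry (A : pzRingType) m n (a : A) (M : 'M[A]_(m, n)) i j :
  (a *: M) i j = a * M i j.
Proof. by rewrite mxE. Qed.

Section NewtonDirection.
Variables (n : nat) (Q1 Q2 : 'M[int]_n).
Hypotheses (s1 : integral_form Q1) (s2 : integral_form Q2).
Variables (A : comNzRingType) (i j : 'I_n).
Implicit Types z : 'cV[A]_n.

(* To first order, moving along this vector changes [Q1] by
   [2 w1 (grad_minor z i j)] and [Q2] by [2 w2 (grad_minor z i j)]. *)
Definition newton_dir z (w1 w2 : A) : 'cV[A]_n :=
  let u := map_mx intr Q1 *m z in let v := map_mx intr Q2 *m z in
  (w1 * v j 0 - w2 * u j 0) *: delta_mx i 0
  + (w2 * u i 0 - w1 * v i 0) *: delta_mx j 0.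

Lemma newton_dir_out z w1 w2 l : l != i -> l != j -> newton_dir z w1 w2 l 0 = 0.
Proof. by move=> /negbTE li /negbTE lj; rewrite !mxE li lj !mulr0 addr0. Qed.

Lemma polar_delta (Q : 'M[int]_n) z (c d : A) : integral_form Q ->
  (z^T *m map_mx intr Q *m (c *: delta_mx i 0 + d *: delta_mx j 0 : 'cV[A]_n)) 0 0 =
  c * (map_mx intr Q *m z) i 0 + d * (map_mx intr Q *m z) j 0.
Proof.
move=> Qs; rewrite mulmxDr -!scalemxAr -!colE mxE [X in X + _]mxE [X in _ + X]mxE.
have -> : z^T *m map_mx intr Q = (map_mx intr Q *m z)^T.
  by rewrite trmx_mul map_trmx Qs.
have E l : col l (map_mx intr Q *m z)^T 0 0 = (map_mx intr Q *m z) l 0.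
  by rewrite [LHS]mxE [LHS]mxE.
by rewrite !E.
Qed.

Lemma polar_newton z w1 w2 :
  (z^T *m map_mx intr Q1 *m newton_dir z w1 w2) 0 0
    = w1 * grad_minor Q1 Q2 z i j /\
  (z^T *m map_mx intr Q2 *m newton_dir z w1 w2) 0 0
    = w2 * grad_minor Q1 Q2 z i j.
Proof.
by rewrite /newton_dir !polar_delta // /grad_minor; split; ring.
Qed.

Lemma qform_newton z t w1 w2 :
  qform Q1 (z + t *: newton_dir z w1 w2) =
    qform Q1 z + 2 * t * w1 * grad_minor Q1 Q2 z i j
    + t ^+ 2 * qform Q1 (newton_dir z w1 w2) /\
  qform Q2 (z + t *: newton_dir z w1 w2) =
    qform Q2 z + 2 * t * w2 * grad_minor Q1 Q2 z i j
    + t ^+ 2 * qform Q2 (newton_dir z w1 w2).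
Proof.
move: (polar_newton z w1 w2); move: (newton_dir z w1 w2) => d [p1 p2].
rewrite !qformD // !qformZ -!scalemxAr !scalemx_entry p1 p2.
by split; congr (_ + _ + _); ring.
Qed.

End NewtonDirection.

Section Congruences.
Variables (n : nat) (Q1 Q2 : 'M[int]_n).
Hypotheses (s1 : integral_form Q1) (s2 : integral_form Q2).
Implicit Types (x y z : 'cV[int]_n).

Definition cong (m : int) x y := forall l, (m %| (x l 0 - y l 0)%R)%Z.

Lemma congP m x y : cong m x y -> exists t, x = y + m *: t.
Proof.
move=> h; exists (\col_l ((x l 0 - y l 0)%R %/ m)%Z).
apply/matrixP => l b; rewrite ord1 !mxE mulrC divzK //; ring.
Qed.

Lemma qform_cong m (Q : 'M[int]_n) x y : integral_form Q -> cong m x y ->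
  (m %| qform Q x - qform Q y)%Z.
Proof.
move=> Qs /congP[t ->]; rewrite qformD // qformZ -scalemxAr scalemx_entry.
set c := (_ *m t) 0 0; set d := qform Q t; set e := qform Q y.
by apply/dvdzP; exists (2 * c + m * d); ring.
Qed.

Lemma grad_minor_cong m x y i j : cong m x y ->
  (m %| grad_minor Q1 Q2 x i j - grad_minor Q1 Q2 y i j)%Z.
Proof.
move=> /congP[t ->]; rewrite /grad_minor !mulmxDr -!scalemxAr.
have E (P t' : 'cV[int]_n) l : (P + m *: t') l 0 = P l 0 + m * t' l 0.
  by rewrite mxE [X in _ + X]mxE.
rewrite !E; move: (map_mx intr Q1 *m y) (map_mx intr Q1 *m t) => a a'.
move: (map_mx intr Q2 *m y) (map_mx intr Q2 *m t) => b b'; apply/dvdzP.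
exists (a i 0 * b' j 0 + a' i 0 * b j 0 + m * a' i 0 * b' j 0
  - (a j 0 * b' i 0 + a' j 0 * b i 0 + m * a' j 0 * b' i 0)); ring.
Qed.

End Congruences.

Lemma dvdz_congr (m a b : int) : (m %| (a - b)%R)%Z -> (m %| b)%Z -> (m %| a)%Z.
Proof. by move=> ab mb; rewrite -[a](subrK b) rpredD. Qed.

Section HenselLift.
Variables (n : nat) (Q1 Q2 : 'M[int]_n).
Hypotheses (s1 : integral_form Q1) (s2 : integral_form Q2).
Variables (p : nat) (p_pr : prime p) (i j : 'I_n).

Lemma prime_solve (r c : int) : ~~ (p%:Z %| c)%Z -> exists w : int, (p%:Z %| r + w * c)%Z.
Proof.
move=> pc; have : coprimez p%:Z c by rewrite coprimezE prime_coprime // -dvdzE.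
case/coprimezP => -[u v] /= uv; exists (- r * v); apply/dvdzP; exists (r * u).
have -> : r + - r * v * c = r * (u * p%:Z + v * c) - r * v * c by rewrite uv; ring.
by ring.
Qed.

Lemma val_exact (c : int) : c != 0 -> exists s c', c = (p ^ s)%:Z * c' /\ ~~ (p%:Z %| c')%Z.
Proof.
move=> c0; have c0' : (0 < `|c|)%N by rewrite absz_gt0.
have [m pm E] := pfactor_coprime p_pr c0'.
exists (logn p `|c|), (sgz c * m%:Z); split.
  by rewrite {1}[c]intEsg {1}E PoszM; ring.
have s1' : `|sgz c|%N = 1%N by case: sgzP c0.
by rewrite dvdzE /= abszM s1' mul1n -prime_coprime.
Qed.

(** Only the coordinates [i] and [j] are solved for: the others are prescribed by [u] and remain
    free parameters, as counting solutions requires. The factor 2 of the Newton correction is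
    included in the valuation [s], so [p = 2] needs no separate argument. *)
Lemma hensel_lift (X : 'cV[int]_n) (s N : nat) (c : int) :
  2 * grad_minor Q1 Q2 X i j = (p ^ s)%:Z * c -> ~~ (p%:Z %| c)%Z ->
  (2 * s < N)%N ->
  ((p ^ N)%:Z %| qform Q1 X)%Z -> ((p ^ N)%:Z %| qform Q2 X)%Z ->
  forall (u : 'cV[int]_n) d, cong (p ^ N)%:Z u X ->
    exists z : 'cV[int]_n, [/\ forall l, l != i -> l != j -> z l 0 = u l 0,
      cong (p ^ (N - s))%:Z z X,
      ((p ^ (N + d))%:Z %| qform Q1 z)%Z & ((p ^ (N + d))%:Z %| qform Q2 z)%Z].
Proof.
move=> cE pc sN q1 q2 u d uX.
have dvdpX a b : (a <= b)%N -> ((p ^ a)%:Z %| (p ^ b)%:Z)%Z.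
  by move=> ab; rewrite dvdzE /= dvdn_exp2l.
elim: d => [|d [z [zu zX z1 z2]]].
  exists u; rewrite addn0; split=> //.
  - by move=> l; apply: dvdz_trans (uX l); apply: dvdpX; exact: leq_subr.
  - exact: dvdz_congr (qform_cong s1 uX) q1.
  - exact: dvdz_congr (qform_cong s2 uX) q2.
pose D := grad_minor Q1 Q2 z i j.
(* As [z] agrees with [X] modulo [p^(N - s)] and [s < N - s], twice the minor has the same valuation
   at [z] as at [X]. *)
have [c' [DE pc']] : exists c', 2 * D = (p ^ s)%:Z * c' /\ ~~ (p%:Z %| c')%Z.
  have /dvdzP[t tE] := grad_minor_cong Q1 Q2 i j zX.
  exists (c + 2 * t * (p ^ (N - s - s))%:Z); split.
    have NE : (p ^ (N - s))%:Z = (p ^ s)%:Z * (p ^ (N - s - s))%:Z :> int.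
      by rewrite -PoszM -expnD subnKC //; clear -sN; lia.
    have -> : D = grad_minor Q1 Q2 X i j + t * (p ^ (N - s))%:Z by rewrite -tE /D addrC subrK.
    by rewrite mulrDr cE NE; move: (Posz _) (Posz (p ^ (N - s - s))) => a b; ring.
  apply: contra pc => pc.
  have pN : (p%:Z %| 2 * t * (p ^ (N - s - s))%:Z)%Z.
    by rewrite dvdz_mull // dvdzE /= dvdn_exp //; clear -sN; lia.
  by have := rpredB pc pN; rewrite addrK.
have [/dvdzP[r1 z1E] /dvdzP[r2 z2E]] := (z1, z2).
have [w1 /dvdzP[t1 w1E]] := prime_solve r1 pc'.
have [w2 /dvdzP[t2 w2E]] := prime_solve r2 pc'.
(* A correction of size [p^(e - s)] changes the forms by [p^e w c'] to first order, and [w] cancels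
   the error [r p^e] modulo [p^(e + 1)]. The quadratic term is divisible by [p^(2 (e - s))], hence
   by [p^(e + 1)] because [2 s < N]. *)
pose e := (N + d)%N; pose dl := newton_dir Q1 Q2 i j z w1 w2.
have [n1 n2] := qform_newton s1 s2 i j z (p ^ (e - s))%:Z w1 w2.
have lift (r w t0 q : int) : r + w * c' = t0 * p%:Z ->
    ((p ^ (N + d.+1))%:Z %| r * (p ^ e)%:Z + 2 * (p ^ (e - s))%:Z * w * D
      + (p ^ (e - s))%:Z ^+ 2 * q)%Z.
  move=> rE.
  have -> : r * (p ^ e)%:Z + 2 * (p ^ (e - s))%:Z * w * D = (p ^ e)%:Z * (t0 * p%:Z).
    have -> : (p ^ e)%:Z = (p ^ (e - s))%:Z * (p ^ s)%:Z :> int.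
      by rewrite -PoszM -expnD subnK // /e; clear -sN; lia.
    rewrite -rE; move: DE; move: (Posz (p ^ s)) (Posz (p ^ (e - s))) => a b DE.
    by transitivity (r * (b * a) + b * w * (2 * D)); [ring | rewrite DE; ring].
  rewrite rpredD //.
    rewrite addnS -/e expnS PoszM mulrCA [p%:Z * _]mulrC; exact: dvdz_mull.
  by rewrite dvdz_mulr // expr2 -PoszM -expnD; apply: dvdpX; rewrite /e; clear -sN; lia.
exists (z + (p ^ (e - s))%:Z *: dl); split.
- move=> l li lj; rewrite mxE scalemx_entry newton_dir_out // mulr0 addr0.
  exact: zu.
- move=> l; rewrite mxE scalemx_entry addrAC rpredD ?zX //.
  by rewrite dvdz_mulr //; apply: dvdpX; rewrite /e; clear -sN; lia.
- by rewrite n1 z1E; exact: lift w1E.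
- by rewrite n2 z2E; exact: lift w2E.
Qed.

End HenselLift.

Lemma ex_choice (X Y : Type) (P : X -> Y -> Prop) :
  (forall x, exists y, P x y) -> exists f : X -> Y, forall x, P x (f x).
Proof. by move=> /choice[f fP]; exists f. Qed.

(** * The singular series *)

Section SolutionCount.
Variables (n : nat) (Q1 Q2 : 'M[int]_n).
Hypotheses (s1 : integral_form Q1) (s2 : integral_form Q2).

Definition int_lift q (z : 'cV['I_q]_n) : 'cV[int]_n :=
  map_mx (fun i : 'I_q => (i : nat)%:Z) z.

Definition zero_mod q : {set 'cV['I_q]_n} :=
  [set z | (q%:Z %| qform Q1 (int_lift z))%Z && (q%:Z %| qform Q2 (int_lift z))%Z].

Lemma residue_exists q (x : 'cV[int]_n) : (0 < q)%N ->
  exists z : 'cV['I_q]_n, cong q%:Z (int_lift z) x.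
Proof.
case: q => // q _; exists (\col_l inord `|(x l 0%R %% q.+1%:Z)%Z|) => l.
rewrite !mxE inordK; last first.
  by rewrite -ltz_nat gez0_abs ?ltz_pmod // modz_ge0.
rewrite gez0_abs ?modz_ge0 // {2}(divz_eq (x l 0) q.+1%:Z) opprD addrC subrK.
by rewrite rpredN dvdz_mull.
Qed.

Lemma cong_sym m (x y : 'cV[int]_n) : cong m x y -> cong m y x.
Proof. by move=> h l; rewrite -opprB rpredN. Qed.

Lemma ord_cong_inj q (a b : 'I_q) : (q%:Z %| ((a : nat)%:Z - (b : nat)%:Z)%R)%Z -> a = b.
Proof.
move=> h; apply: val_inj => /=; move: (ltn_ord a) (ltn_ord b) => aq bq.
have := h; rewrite -eqz_mod_dvd => /eqP; rewrite !modz_small ?ltz_nat //.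
by case.
Qed.

Lemma zero_mod_cong q (z : 'cV['I_q]_n) (x : 'cV[int]_n) : cong q%:Z (int_lift z) x ->
  (q%:Z %| qform Q1 x)%Z -> (q%:Z %| qform Q2 x)%Z -> z \in zero_mod q.
Proof.
move=> zx q1 q2; rewrite inE.
by rewrite (dvdz_congr (qform_cong s1 zx) q1) (dvdz_congr (qform_cong s2 zx) q2).
Qed.

Lemma card_zero_mod_gt0 q : (0 < q)%N -> (0 < #|zero_mod q|)%N.
Proof.
move=> q0; have [z zx] := residue_exists 0 q0.
apply/card_gt0P; exists z; apply: zero_mod_cong zx _ _;
by rewrite /qform trmx0 !mul0mx mxE dvdz0.
Qed.

(** Chinese remainders combine solutions injectively. An inequality is enough, as densities are to
    be bounded below. *)
Lemma card_zero_mod_mul a b : coprime a b -> (0 < a)%N -> (0 < b)%N ->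
  (#|zero_mod a| * #|zero_mod b| <= #|zero_mod (a * b)|)%N.
Proof.
move=> cab a0 b0; have ab0 : (0 < a * b)%N by rewrite muln_gt0 a0.
pose S := finset.setX (zero_mod a) (zero_mod b).
have [f fP] : exists f : 'cV['I_a]_n * 'cV['I_b]_n -> 'cV['I_(a * b)]_n,
    forall u, cong a%:Z (int_lift (f u)) (int_lift u.1) /\
              cong b%:Z (int_lift (f u)) (int_lift u.2).
  apply: (ex_choice (P := fun u (w : 'cV['I_(a * b)]_n) =>
    cong a%:Z (int_lift w) (int_lift u.1) /\ cong b%:Z (int_lift w) (int_lift u.2))).
  move=> [x y] /=; have [z zc] := residue_exists (\col_l (chinese a b (x l 0) (y l 0))%:Z) ab0.
  exists z; split=> l; have := zc l; rewrite ![(\col_l _) l 0]mxE => zl.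
    apply: (dvdz_congr (b := int_lift z l 0 - (chinese a b (x l 0) (y l 0))%:Z));
      last by apply: dvdz_trans zl; rewrite dvdzE /= dvdn_mulr.
    rewrite opprB addrC addrA subrK [int_lift x l 0]mxE -eqz_mod_dvd !modz_nat.
    by rewrite chinese_modl.
  apply: (dvdz_congr (b := int_lift z l 0 - (chinese a b (x l 0) (y l 0))%:Z));
    last by apply: dvdz_trans zl; rewrite dvdzE /= dvdn_mull.
  rewrite opprB addrC addrA subrK [int_lift y l 0]mxE -eqz_mod_dvd !modz_nat.
  by rewrite chinese_modr.
rewrite -cardsX -(@card_in_imset _ _ f) -/S.
  apply/subset_leq_card/fintype.subsetP => w /imsetP[u]; rewrite !inE => /andP[/andP[x1 x2] /andP[y1 y2]] ->.
  have [fa fb] := fP u.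
  have D c : coprime a b -> (a%:Z %| c)%Z -> (b%:Z %| c)%Z -> ((a * b)%:Z %| c)%Z.
    by move=> cop ac bc; rewrite dvdzE /= Gauss_dvd //; exact/andP.
  apply/andP; split; apply: D => //.
  - exact: dvdz_congr (qform_cong s1 fa) x1.
  - exact: dvdz_congr (qform_cong s1 fb) y1.
  - exact: dvdz_congr (qform_cong s2 fa) x2.
  - exact: dvdz_congr (qform_cong s2 fb) y2.
move=> [x y] [x' y'] _ _ fE; have [/= fa fb] := fP (x, y); have [/= fa' fb'] := fP (x', y').
congr pair; apply/matrixP => l c; rewrite ord1; apply: ord_cong_inj.
  have := rpredB (fa' l) (fa l); rewrite fE !mxE opprB addrC subrKA; exact.
by have := rpredB (fb' l) (fb l); rewrite fE !mxE opprB addrC subrKA; exact.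
Qed.

(** Inside the class of an approximate zero [X] modulo [p^N], choose the [n - 2] coordinates other
    than [i] and [j] freely modulo [p^e] and let Hensel's lemma determine the two others. Distinct
    choices give distinct solutions, [p^((e - N) (n - 2))] in all. *)
Lemma card_zero_mod_prime_power p : prime p -> condition1 Q1 Q2 -> (0 < n)%N ->
  nonzero_solution (padic_int p) Q1 Q2 ->
  exists N, forall e, (p ^ (e * (n - 2)) <= p ^ (N * (n - 2)) * #|zero_mod (p ^ e)|)%N.
Proof.
move=> p_pr hC n0 hs; have p0 := prime_gt0 p_pr.
have [i [j [s H]]] := padic_zero_approx p_pr s1 s2 hC n0 hs.
have [X0 [_ _ D0]] := H 0%N.
have ij : i != j.
  by apply: contraNneq D0 => ->; rewrite /grad_minor subrr dvdz0.
(* The valuation of twice the minor is at most [s.+1], the extra 1 being that of the factor 2 when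
   [p = 2]; Hensel's lemma asks for a precision above its double. *)
pose N := (2 * s.+1).+1; exists N => e.
(* For [e < N] the single solution 0 is enough. *)
have [eN|Ne] := ltnP e N.
  by rewrite -[X in (X <= _)%N]muln1 leq_mul ?card_zero_mod_gt0 ?expn_gt0 ?p0 //
    leq_exp2l ?prime_gt1 // leq_mul2r ltnW ?orbT.
have [X [q1 q2 Ds]] := H N; set D := grad_minor _ _ _ _ _ in Ds.
have D_neq0 : D != 0 by apply: contraNneq Ds => ->; rewrite dvdz0.
have [v [c [vE pc]]] := val_exact p_pr (mulf_neq0 (isT : (2 : int) != 0) D_neq0).
have vs : (v <= s.+1)%N.
  have : (p ^ v %| 2 * `|D|)%N.
    have -> : (2 * `|D|)%N = `|(2 * D)%R|%N by rewrite abszM.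
    by rewrite vE abszM dvdn_mulr.
  have D0' : (0 < `|D|)%N by rewrite absz_gt0.
  move: Ds; rewrite dvdzE /= !pfactor_dvdn ?muln_gt0 ?D0' // -ltnNge lognM //.
  have l2 : (logn p 2 <= 1)%N by rewrite logn_prime //; case: eqP.
  by clear -l2; lia.
have vN : (2 * v < N)%N by rewrite /N ltnS leq_mul2l vs orbT.
pose T := {l : 'I_n | (l != i) && (l != j)}.
(* At [i] and [j] the default is 0, so there [u y] keeps the coordinates of [X]. *)
pose ext (y : {ffun T -> 'I_(p ^ (e - N))}) l : int := oapp (fun t => (y t : nat)%:Z) 0 (insub l).
pose u y : 'cV[int]_n := \col_l (X l 0 + (p ^ N)%:Z * ext y l).
have uX y : cong (p ^ N)%:Z (u y) X.
  by move=> l; rewrite mxE addrC addKr dvdz_mulr.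
have [f fP] : exists f : {ffun T -> 'I_(p ^ (e - N))} -> 'cV['I_(p ^ e)]_n,
    forall y, f y \in zero_mod (p ^ e) /\
      forall t : T, ((p ^ e)%:Z %| (int_lift (f y) (val t) 0 - u y (val t) 0)%R)%Z.
  apply: (ex_choice (P := fun y (w : 'cV['I_(p ^ e)]_n) => w \in zero_mod (p ^ e) /\
      forall t : T, ((p ^ e)%:Z %| (int_lift w (val t) 0 - u y (val t) 0)%R)%Z)).
  move=> y; have [z [zu _ z1 z2]] := hensel_lift s1 s2 p_pr vE pc vN q1 q2 (e - N) (uX y).
  rewrite subnKC // in z1 z2.
  have pe0 : (0 < p ^ e)%N by rewrite expn_gt0 p0.
  have [w wz] := residue_exists z pe0; exists w.
  split; first exact: zero_mod_cong wz z1 z2.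
  by move=> t; have /andP[ti tj] := valP t; rewrite -zu.
have card_T : #|{: T}| = (n - 2)%N.
  rewrite card_sig -[n in RHS]card_ord -(cardC (pred2 i j)) card2 ij addKn.
  by apply: eq_card => l; rewrite !inE negb_or.
have fI : injective f.
  move=> y y' fE; apply/ffunP => t; apply: ord_cong_inj.
  have [_ /(_ t) h] := fP y; have [_ /(_ t) h'] := fP y'.
  have := rpredB h' h; rewrite fE !mxE /ext !valK /= opprB addrC subrKA.
  rewrite opprD addrACA subrr add0r -mulrBr.
  have -> : (p ^ e)%:Z = (p ^ N)%:Z * (p ^ (e - N))%:Z :> int.
    by rewrite -PoszM -expnD subnKC.
  by rewrite dvdz_mul2l // -lt0n expn_gt0 p0.
have := subset_leq_card (_ : f @: predT \subset zero_mod (p ^ e)).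
rewrite card_imset // card_ffun card_ord card_T => cardle.
rewrite -{1}(subnKC Ne) mulnDl expnD leq_mul // expnM cardle //.
by apply/fintype.subsetP => w /imsetP[y _ ->]; have [] := fP y.
Qed.

End SolutionCount.

(** The independence of two kernel vectors is witnessed by the linear forms [r] and [s], since over
    a ring there is no dimension count. A column of the adjugate is [c x], with [c] its value under
    [r]; comparison with [y], on which [r] vanishes, gives [c y = 0], and [s] then gives [c = 0]. *)
Lemma adj_eq0_two_kernel (A : comNzRingType) n (M : 'M[A]_n) (x y : 'cV[A]_n)
    (r s : 'rV[A]_n) :
  M *m x = 0 -> M *m y = 0 -> (r *m x) 0 0 = 1 -> (r *m y) 0 0 = 0 ->
  (s *m y) 0 0 = 1 -> \adj M = 0.
Proof.
move=> Mx My rx ry sy; apply/matrixP => j l; rewrite [RHS]mxE.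
pose c := \sum_i r 0 i * \adj M i l.
have contract (t : 'rV[A]_n) (z : 'cV[A]_n) a : M *m z = 0 ->
    (t *m z) 0 0 * \adj M a l = z a 0 * \sum_i t 0 i * \adj M i l.
  move=> Mz; rewrite mxE mulr_suml mulr_sumr; apply: eq_bigr => i _.
  by rewrite -mulrA (adj_mul_kernel i a l Mz); ring.
have := contract r x j Mx; rewrite rx mul1r => ->; rewrite -/c.
suff -> : c = 0 by rewrite mulr0.
have yc i : y i 0 * c = 0 by rewrite -contract // ry mul0r.
rewrite -[c]mul1r -sy mxE mulr_suml; apply: big1 => i _.
by rewrite -mulrA yc mulr0.
Qed.

(** * Kernels of pencil members modulo q *)

Section KernelCount.
Variables (n : nat) (Q1 Q2 : 'M[int]_n).
Hypotheses (s1 : integral_form Q1) (s2 : integral_form Q2).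
Hypotheses (hC : condition1 Q1 Q2) (n1 : (1 < n)%N).

Definition pencilZ (a1 a2 : nat) : 'M[int]_n := a1%:Z *: Q1 + a2%:Z *: Q2.

Definition kernel_mod (M : 'M[int]_n) q : {set 'cV['I_q]_n} :=
  [set h | [forall l, (q%:Z %| 2 * (M *m int_lift h) l 0%R)%Z]].

Lemma coprime_pow_dvd (g D a1 a2 q e : nat) : coprime (gcdn a1 a2) q -> (g %| q)%N ->
  (g %| D * a1 ^ e)%N -> (g %| D * a2 ^ e)%N -> (g %| D)%N.
Proof.
move=> cop gq g1 g2.
have [G0|G0] := posnP (gcdn a1 a2).
  move: cop gq; rewrite G0 /coprime gcd0n => /eqP ->; rewrite dvdn1 => /eqP ->.
  exact: dvd1n.
set G := gcdn a1 a2 in cop G0 *.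
have gG : (g %| D * G ^ e)%N.
  have E1 : a1 = (a1 %/ G * G)%N by rewrite divnK // dvdn_gcdl.
  have E2 : a2 = (a2 %/ G * G)%N by rewrite divnK // dvdn_gcdr.
  have cb : coprime ((a1 %/ G) ^ e) ((a2 %/ G) ^ e).
    apply/coprimeXl/coprimeXr; rewrite /coprime -(eqn_pmul2r G0) mul1n muln_gcdl.
    by rewrite -E1 -E2.
  have := dvdn_gcd g (D * a1 ^ e) (D * a2 ^ e); rewrite g1 g2 E1 E2 !expnMn.
  rewrite -muln_gcdr -muln_gcdl (eqP cb) mul1n; exact.
move: gG; rewrite Gauss_dvdl //; apply/coprimeXr; rewrite coprime_sym.
by apply: coprime_dvdr gq _.
Qed.

(** Modulo [g], the gcd of [d_i] and [q], all Smith invariants from index [i] on vanish. If [i] is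
    not the last index, two columns of the inverse of [Rm] lie in the kernel, so adjugate and
    determinant are 0 modulo [g], and the ideal identity leaves [g] dividing [D a1^e] and [D a2^e];
    coprimality removes the powers. *)
Lemma smith_divisor_dvd (D : int) (e : nat) (a1 a2 q : nat) (L Rm : 'M[int]_n) (d : seq int) :
  (forall (A : comNzRingType) (l m : A),
      (exists a b : A, D%:~R * l ^+ e = a * \det (pencil Q1 Q2 l m)
        + b * \tr (\adj (pencil Q1 Q2 l m) *m map_mx intr Q2)) /\
      (exists a b : A, D%:~R * m ^+ e = a * \det (pencil Q1 Q2 l m)
        + b * \tr (\adj (pencil Q1 Q2 l m) *m map_mx intr Q1))) ->
  (0 < q)%N -> coprime (gcdn a1 a2) q ->
  Rm \in unitmx -> sorted dvdz d ->
  pencilZ a1 a2 = L *m (\matrix_(i, j) (d`_i *+ (i == j :> nat))) *m Rm ->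
  forall i : 'I_n, (i.+1 < n)%N -> (gcdz d`_i q%:Z %| D)%Z.
Proof.
move=> H q0 cop Ru sd ME i iN.
set g := gcdn `|d`_i| q; rewrite /gcdz -/g dvdzE /=.
have g0 : (0 < g)%N by rewrite gcdn_gt0 q0 orbT.
(* ['Z_g] is the ring of integers modulo [g] only for [g > 1]. *)
have [g1|g1] := leqP g 1.
  by rewrite (_ : g = 1%N) ?dvd1n //; apply/eqP; rewrite eqn_leq g1.
pose A := 'Z_g.
have intr0 (c : int) : (c%:~R == 0 :> A) = (g%:Z %| c)%Z.
  have nE (k : nat) : (k%:R == 0 :> A) = (g %| k)%N.
    by rewrite -val_eqE /= val_Zp_nat.
  by case: c => k; rewrite ?NegzE ?rmorphN ?oppr_eq0 dvdzE /= ?abszN nE.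
pose j : 'I_n := Ordinal iN.
have dj (k : 'I_n) : (i <= k)%N -> (d`_k)%:~R = 0 :> A.
  move=> ik; apply/eqP; rewrite intr0.
  have di : (g%:Z %| d`_i)%Z by rewrite dvdzE /= dvdn_gcdl.
  have [kd|dk] := ltnP k (size d); last by rewrite [d`_k]nth_default.
  apply: dvdz_trans di _.
  have dvdz_tr : transitive dvdz by move=> b a c; exact: dvdz_trans.
  by have := sorted_leq_nth dvdz_tr (fun a => dvdzz a) 0 sd;
    apply; rewrite ?inE // (leq_ltn_trans ik kd).
pose M : 'M[A]_n := pencil Q1 Q2 a1%:R a2%:R.
have MZ : M = map_mx intr (pencilZ a1 a2).
  by apply/matrixP => a b; rewrite !mxE rmorphD !rmorphM /=.
pose RA : 'M[A]_n := map_mx intr Rm.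
pose RI : 'M[A]_n := map_mx intr (invmx Rm).
have RRI : RA *m RI = 1%:M by rewrite -map_mxM mulmxV // map_mx1.
pose Dg : 'M[int]_n := \matrix_(i, j) (d`_i *+ (i == j :> nat)).
have MD : M = map_mx intr L *m map_mx intr Dg *m RA.
  by rewrite MZ ME !map_mxM.
have ker (k : 'I_n) : (i <= k)%N -> M *m col k RI = 0.
  move=> ik; rewrite MD -!mulmxA colE (mulmxA RA) RRI mul1mx.
  rewrite -colE; set c := col k _.
  suff -> : c = 0 by rewrite mulmx0.
  apply/matrixP => a b; rewrite !mxE rmorphMn /=.
  by case: eqP => [->|_]; rewrite ?mulr0n // dj.
have rr (a b : 'I_n) : (row a RA *m col b RI) 0 0 = (a == b)%:R.
  rewrite rowE colE -mulmxA (mulmxA RA) RRI mul1mx -rowE [LHS]mxE [LHS]mxE.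
  by rewrite eqxx andbT.
have ij : (i == j) = false by rewrite -val_eqE /= ltn_eqF.
have adj0 : \adj M = 0.
  have kj := ker j (leqnSn i); have ki := ker i (leqnn i).
  by apply: (adj_eq0_two_kernel ki kj (r := row i RA) (s := row j RA));
    rewrite rr ?eqxx ?ij.
have det0 : \det M = 0.
  have := congr1 (fun N : 'M[A]_n => N i i) (mul_mx_adj M).
  by rewrite adj0 mulmx0 !mxE eqxx mulr1n => <-.
have [[a [b E1]] [a' [b' E2]]] := H A a1%:R a2%:R.
rewrite -/M adj0 det0 !mul0mx !mxtrace0 !mulr0 addr0 in E1 E2.
have dvdD (c : nat) : D%:~R * c%:R ^+ e = 0 :> A -> (g %| `|D| * c ^ e)%N.
  move=> E; have : (D * (c ^ e)%:Z)%:~R == 0 :> A.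
    by rewrite intrM -[(c ^ e)%:Z%:~R]/((c ^ e)%:R) natrX E.
  by rewrite intr0 dvdzE abszM.
exact: coprime_pow_dvd cop (dvdn_gcdr _ _) (dvdD _ E1) (dvdD _ E2).
Qed.

Lemma dvdz_mulmx m k (M : 'M[int]_(m, k)) (x : 'cV[int]_k) (q : int) :
  (forall l, (q %| x l 0%R)%Z) -> forall l, (q %| (M *m x) l 0%R)%Z.
Proof. by move=> h l; rewrite mxE rpred_sum // => i _; rewrite dvdz_mull. Qed.

Lemma card_kernel_mod : exists C : nat, (0 < C)%N /\ forall a1 a2 q,
  (0 < q)%N -> coprime (gcdn a1 a2) q ->
  (#|kernel_mod (pencilZ a1 a2) q| <= C * q)%N.
Proof.
have [D [e [D0 H]]] := condition1_ideal s1 s2 hC (ltnW n1).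
pose E := `|(2 * D)%R|%N; have E0 : (0 < E)%N by rewrite absz_gt0 mulf_neq0.
exists (E ^ n)%N; rewrite expn_gt0 E0; split=> // a1 a2 q q0 cop.
have [L Lu [Rm Ru [d sd ME]]] := int_Smith_normal_form (pencilZ a1 a2).
have gD := smith_divisor_dvd H q0 cop Ru sd ME.
pose y (h : 'cV['I_q]_n) := Rm *m int_lift h.
have q_neq0 : q%:Z != 0 by rewrite -lt0n.
have dvd_dy h : h \in kernel_mod (pencilZ a1 a2) q ->
    forall i : 'I_n, (q%:Z %| 2 * (d`_i * y h i 0%R))%Z.
  rewrite inE => /forallP hk i.
  have := dvdz_mulmx (invmx L) (x := 2 *: (pencilZ a1 a2 *m int_lift h)).
  move=> /(_ q%:Z) => /(_ _ i); rewrite -scalemxAr ME -!mulmxA mulKmx //.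
  rewrite scalemx_entry [(\matrix_(_, _) _ *m _) i 0]mxE (bigD1 i) //= big1 => [|j /negbTE ji].
    rewrite !mxE eqxx mulr1n addr0; apply => l.
    by rewrite !mulmxA -ME scalemx_entry.
  by rewrite !mxE eq_sym val_eqE ji mulr0n mul0r.
have dvd_Dy h : h \in kernel_mod (pencilZ a1 a2) q ->
    forall i : 'I_n, (i.+1 < n)%N -> (q%:Z %| 2 * D * y h i 0%R)%Z.
  move=> hk i iN; have /dvdzP[t Dt] := gD i iN.
  have [u [v uv]] := Bezoutz d`_i q%:Z.
  have -> : 2 * D * y h i 0 = t * u * (2 * (d`_i * y h i 0)) + 2 * t * v * y h i 0 * q%:Z.
    by rewrite Dt -uv; ring.
  by rewrite rpredD // dvdz_mull // dvd_dy.
have nn : (n.-1 < n)%N by rewrite ltn_predL ltnW.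
pose last := Ordinal nn.
pose t h : 'cV[int]_n := \col_i (2 * D * y h i 0%R %/ q%:Z)%Z.
have [f fP] : exists f : 'cV['I_q]_n -> 'cV['I_E]_n * 'cV['I_q]_n, forall h,
    cong E%:Z (int_lift (f h).1) (t h) /\ cong q%:Z (int_lift (f h).2) (y h).
  apply: (ex_choice (P := fun h (w : 'cV['I_E]_n * 'cV['I_q]_n) =>
    cong E%:Z (int_lift w.1) (t h) /\ cong q%:Z (int_lift w.2) (y h))) => h.
  have [w1 w1P] := residue_exists (t h) E0.
  by have [w2 w2P] := residue_exists (y h) q0; exists (w1, w2).
pose F h := ((f h).1, (f h).2 last 0).
have FI : {in kernel_mod (pencilZ a1 a2) q &, injective F}.
  move=> h h' hk hk' [f1 f2]; have [a1P b1P] := fP h; have [a2P b2P] := fP h'.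
  suff yy : cong q%:Z (y h) (y h').
    apply/matrixP => l c; rewrite ord1; apply: ord_cong_inj.
    have := dvdz_mulmx (invmx Rm) (x := y h - y h') (q := q%:Z).
    move=> /(_ _ l); rewrite mulmxBr /y !mulKmx // !mxE; apply.
    by move=> a; have := yy a; rewrite /y !mxE.
  move=> i; have [iN|iN] := ltnP i.+1 n; last first.
    have -> : i = last by apply: val_inj => /=; have := ltn_ord i; clear -iN; lia.
    have := rpredB (b2P last) (b1P last).
    by rewrite [int_lift _ _ _]mxE [X in _ - (X - _)]mxE f2 opprB addrC subrKA.
  have := rpredB (a2P i) (a1P i); rewrite f1 opprB addrC subrKA => tt.
  have E_eq : (E%:Z %| 2 * D)%Z by rewrite dvdzE.
  have DE : (2 * D %| E%:Z)%Z by rewrite dvdzE.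
  have D2 : 2 * D != 0 :> int by rewrite mulf_neq0.
  rewrite -(dvdz_mul2l D2) mulrBr.
  rewrite -(divzK (dvd_Dy h hk i iN)) -(divzK (dvd_Dy h' hk' i iN)) -mulrBl.
  rewrite dvdz_mul2r //; apply: dvdz_trans DE _.
  by move: tt; rewrite !mxE.
rewrite -(card_in_imset FI); apply: leq_trans (max_card _) _.
by rewrite card_prod card_mx !card_ord muln1.
Qed.

End KernelCount.

(** * Additive characters and complete exponential sums *)

Section ExponentialSums.
Variable R : realType.
Implicit Types (s t : R).

Lemma e2piiD s t : e2pii (s + t) = e2pii s * e2pii t.
Proof.
by rewrite /e2pii mulrDr cosD sinD; simpc; congr Complex; rewrite addrC.
Qed.

Lemma e2pii0 : e2pii (0 : R) = 1.
Proof. by rewrite /e2pii mulr0 cos0 sin0. Qed.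

Lemma e2piiN t : e2pii (- t) = conjc (e2pii t).
Proof. by rewrite /e2pii mulrN cosN sinN. Qed.

Lemma e2pii_conj_mul t : e2pii t * conjc (e2pii t) = 1.
Proof. by rewrite -e2piiN -e2piiD subrr e2pii0. Qed.

Lemma e2pii_norm t : `|e2pii t| = 1.
Proof.
by apply/eqP; rewrite -sqrp_eq1 ?normr_ge0 // sqr_normc e2pii_conj_mul.
Qed.

Lemma e2pii1 : e2pii (1 : R) = 1.
Proof. by rewrite /e2pii mulr1 mulr_natl cos2pi sin2pi. Qed.

Lemma e2pii_int (m : int) : e2pii (m%:~R : R) = 1.
Proof.
have natE (k : nat) : e2pii (k%:R : R) = 1.
  elim: k => [|k IH]; first by rewrite e2pii0.
  by rewrite -addn1 natrD e2piiD IH e2pii1 mulr1.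
case: m => k; first exact: natE.
by rewrite NegzE mulrNz e2piiN [(k.+1)%:~R]/(k.+1%:R) natE conjc1.
Qed.

Lemma e2pii_neq1 t : 0 < t < 1 -> e2pii t != 1.
Proof.
move=> /andP[t0 t1]; apply/eqP => -[c1 _].
have s0 : 0 < sin (pi * t).
  by rewrite sin_gt0_pi // mulr_gt0 ?pi_gt0 //= -[X in _ < X]mulr1 ltr_pM2l ?pi_gt0.
move: c1; rewrite -mulrA mulr_natl cos_mulr2n => c1.
have := cos2Dsin2 (pi * t); move: s0 c1; move: (sin _) (cos _) => a b a0; nra.
Qed.

Definition eq_char (q : nat) (c : int) : R[i] := e2pii (c%:~R / q%:R).

Lemma eq_charD q c d : eq_char q (c + d) = eq_char q c * eq_char q d.
Proof. by rewrite /eq_char intrD mulrDl e2piiD. Qed.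

Lemma eq_charN q c : eq_char q (- c) = conjc (eq_char q c).
Proof. by rewrite /eq_char intrN mulNr e2piiN. Qed.

Lemma eq_char_norm q c : `|eq_char q c| = 1.
Proof. exact: e2pii_norm. Qed.

Lemma eq_char_dvd q c : (0 < q)%N -> (q%:Z %| c)%Z -> eq_char q c = 1.
Proof.
move=> q0 /dvdzP[m ->]; rewrite /eq_char intrM mulfK ?e2pii_int //.
by rewrite pnatr_eq0 -lt0n.
Qed.

Lemma eq_char_cong q c d : (0 < q)%N -> (q%:Z %| (c - d)%R)%Z -> eq_char q c = eq_char q d.
Proof.
by move=> q0 h; rewrite -[c](subrK d) eq_charD eq_char_dvd // mul1r.
Qed.

Lemma eq_char_neq1 q c : (0 < q)%N -> ~~ (q%:Z %| c)%Z -> eq_char q c != 1.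
Proof.
move=> q0 qc; have qn0 : q%:Z != 0 by rewrite -lt0n.
have -> : eq_char q c = eq_char q (c %% q%:Z)%Z.
  by apply: eq_char_cong => //; rewrite {1}(divz_eq c q%:Z) addrK dvdz_mull.
apply: e2pii_neq1; have q0' : 0 < q%:R :> R by rewrite ltr0n.
have m0 : (0 <= (c %% q)%Z) := modz_ge0 _ qn0.
rewrite divr_gt0 ?ltr0z //=; last first.
  by rewrite lt_def m0 andbT; apply: contraNneq qc => /dvdz_mod0P.
rewrite ltr_pdivrMr // mul1r -[q%:R]/(q%:~R) ltr_int.
by rewrite ltz_pmod.
Qed.

Section ResidueSums.
Variables (n q : nat).
Hypothesis q0 : (0 < q)%N.

Lemma residue_translate (F : 'cV[int]_n -> R[i]) (w : 'cV[int]_n) :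
  (forall x y, cong q%:Z x y -> F x = F y) ->
  \sum_(z : 'cV['I_q]_n) F (int_lift z + w) = \sum_(z : 'cV['I_q]_n) F (int_lift z).
Proof.
move=> FP; have [f fP] : exists f : 'cV['I_q]_n -> 'cV['I_q]_n,
    forall z, cong q%:Z (int_lift (f z)) (int_lift z + w).
  by apply: (ex_choice (P := fun z (u : 'cV['I_q]_n) =>
    cong q%:Z (int_lift u) (int_lift z + w))) => z; exact: residue_exists.
have fI : injective f.
  move=> z z' fE; apply/matrixP => l c; rewrite ord1; apply: ord_cong_inj.
  have := rpredB (fP z' l) (fP z l); rewrite fE opprB addrC subrKA !mxE.
  by rewrite opprD addrACA subrr addr0.
rewrite [RHS](reindex_inj fI) /=; apply: eq_bigr => z _.
by apply: FP; exact: cong_sym.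
Qed.

Lemma character_sum (c : 'cV[int]_n) :
  \sum_(z : 'cV['I_q]_n) eq_char q ((c^T *m int_lift z) 0 0) =
  if [forall l, (q%:Z %| c l 0%R)%Z] then q%:R ^+ n else 0.
Proof.
pose F (x : 'cV[int]_n) := eq_char q ((c^T *m x) 0 0).
have FP x y : cong q%:Z x y -> F x = F y.
  move=> /congP[t ->]; apply: eq_char_cong => //.
  rewrite mulmxDr [X in (_ %| (X - _)%R)%Z]mxE [X in (_ %| X)%Z]addrC addKr.
  by rewrite -scalemxAr scalemx_entry dvdz_mulr.
case: ifPn => [/forallP qc|].
  rewrite (eq_bigr (fun=> 1)) => [|z _].
    by rewrite sumr_const card_mx card_ord muln1 natrX.
  apply: eq_char_dvd => //; rewrite mxE rpred_sum // => i _.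
  by rewrite mxE dvdz_mulr.
rewrite negb_forall => /existsP[l ql].
have := residue_translate (delta_mx l 0) FP.
have -> : \sum_(z : 'cV['I_q]_n) F (int_lift z + delta_mx l 0) =
    eq_char q (c l 0) * \sum_(z : 'cV['I_q]_n) F (int_lift z).
  rewrite mulr_sumr; apply: eq_bigr => z _; rewrite /F mulmxDr mxE eq_charD mulrC.
  by congr (eq_char q _ * _); rewrite -colE [LHS]mxE [LHS]mxE.
move/eqP; rewrite -subr_eq0 -[X in _ - X]mul1r -mulrBl mulf_eq0 subr_eq0.
by rewrite (negbTE (eq_char_neq1 q0 ql)) => /eqP.
Qed.

Variable M : 'M[int]_n.
Hypothesis Ms : integral_form M.

Definition gauss_sum : R[i] := \sum_(z : 'cV['I_q]_n) eq_char q (qform M (int_lift z)).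

(* Squaring and shifting, the inner sum over residues vanishes off the kernel of [2 M]. *)
Lemma weyl_bound : `|gauss_sum| ^+ 2 <= (q ^ n * #|kernel_mod M q|)%:R.
Proof.
have fP (x y : 'cV[int]_n) : cong q%:Z x y ->
    eq_char q (qform M x) = eq_char q (qform M y).
  by move=> /(qform_cong Ms)/(eq_char_cong q0).
rewrite -[leLHS]ger0_norm ?exprn_ge0 //.
have -> : `|gauss_sum| ^+ 2 = \sum_(h : 'cV['I_q]_n) eq_char q (qform M (int_lift h))
    * \sum_(w : 'cV['I_q]_n) eq_char q (((2 *: (M *m int_lift h))^T *m int_lift w) 0 0).
  have conjS : conjc gauss_sum =
      \sum_(w : 'cV['I_q]_n) eq_char q (- qform M (int_lift w)).
    rewrite /gauss_sum rmorph_sum; apply: eq_bigr => w _; rewrite eq_charN.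
    exact: erefl.
  rewrite sqr_normc conjS mulr_sumr.
  under [RHS]eq_bigr => h _ do rewrite mulr_sumr.
  rewrite exchange_big; apply: eq_bigr => w _ /=.
  rewrite mulrC /gauss_sum -(residue_translate (int_lift w) fP) mulr_sumr.
  apply: eq_bigr => h _; rewrite -!eq_charD; congr eq_char.
  rewrite qformD // addrC addrK; congr (_ + _).
  have MZ : map_mx intr M = M by apply/matrixP => a b; rewrite mxE intz.
  by rewrite MZ [(2 *: _)^T]linearZ /= -scalemxAl scalemx_entry trmx_mul Ms.
apply: le_trans (ler_norm_sum _ _ _) _.
apply: (@le_trans _ _ (\sum_(h in kernel_mod M q) (q ^ n)%:R)); last first.
  by rewrite sumr_const natrM mulr_natr.
rewrite [leRHS]big_mkcond /=; apply: ler_sum => h _.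
rewrite normrM eq_char_norm mul1r character_sum inE.
have -> : [forall l, (q%:Z %| (2 *: (M *m int_lift h)) l 0%R)%Z] =
    [forall l, (q%:Z %| 2 * (M *m int_lift h) l 0%R)%Z].
  by apply: eq_forallb => l; rewrite scalemx_entry.
by case: ifP => _; rewrite ?normr0 // normrX normr_nat natrX.
Qed.

End ResidueSums.
End ExponentialSums.

Lemma addmx_entry (V : nmodType) m n (M N : 'M[V]_(m, n)) i j :
  (M + N) i j = M i j + N i j.
Proof. by rewrite mxE. Qed.

(** * Sorting pairs of residues by their common divisor *)

Section DivisorSums.

Lemma sum_multiples (V : nmodType) (F : nat -> V) (q d : nat) : (0 < d)%N ->
  (forall a, ~~ (d %| a)%N -> F a = 0) ->
  \sum_(1 <= a < (q * d).+1) F a = \sum_(1 <= b < q.+1) F (b * d)%N.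
Proof.
move=> d0 F0; elim: q => [|q IH]; first by rewrite mul0n !big_geq.
rewrite [RHS]big_nat_recr //= -IH.
rewrite (big_cat_nat (n := (q * d).+1)) //=; last by rewrite ltnS leq_mul2r leqnSn orbT.
congr (_ + _); have -> : (q.+1 * d).+1 = ((q * d).+1 + d)%N by rewrite mulSn addnC addSn.
rewrite -{1}[(q * d).+1]add0n big_addn addKn.
case: d d0 F0 {IH} => // d _ F0; rewrite big_nat_recr //= big_nat big1 => [|i /andP[_ id]].
  by rewrite add0r addnS -addSn mulSn.
apply: F0; by rewrite addnS -addSn dvdn_addl ?dvdn_mull // gtnNdvd.
Qed.

(** The fractions [a1 / Q] and [a2 / Q] are reduced to their least common denominator [q]: the gcd
    of [a1], [a2] and [Q] is [Q %/ q], and dividing by it is a bijection onto the primitive pairs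
    modulo [q]. *)
Lemma sum_by_gcd (V : zmodType) (H : nat -> nat -> V) (Q : nat) : (0 < Q)%N ->
  \sum_(1 <= a1 < Q.+1) \sum_(1 <= a2 < Q.+1) H a1 a2 =
  \sum_(q <- divisors Q) \sum_(1 <= b1 < q.+1)
    \sum_(1 <= b2 < q.+1 | gcdn (gcdn b1 b2) q == 1%N)
      H (b1 * (Q %/ q))%N (b2 * (Q %/ q))%N.
Proof.
move=> Q0; pose P a1 a2 q := gcdn (gcdn a1 a2) Q == (Q %/ q)%N.
transitivity (\sum_(1 <= a1 < Q.+1) \sum_(1 <= a2 < Q.+1)
    \sum_(q <- divisors Q) if P a1 a2 q then H a1 a2 else 0).
  apply: eq_bigr => a1 _; apply: eq_bigr => a2 _; set g := gcdn (gcdn a1 a2) Q.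
  have gQ : (g %| Q)%N by exact: dvdn_gcdr.
  have g0 : (0 < g)%N by rewrite gcdn_gt0 Q0 orbT.
  have hQ : (Q %/ g)%N \in divisors Q by rewrite -dvdn_divisors // dvdn_div.
  rewrite (bigD1_seq (Q %/ g)%N) ?divisors_uniq //= /P -/g divnA // mulnC mulnK //.
  rewrite eqxx big_seq_cond big1 ?addr0 // => q /andP[].
  rewrite -dvdn_divisors // => qQ qg; case: eqP => // gE.
  by case/eqP: qg; rewrite gE divnA // mulnC mulnK.
transitivity (\sum_(q <- divisors Q) \sum_(1 <= a1 < Q.+1) \sum_(1 <= a2 < Q.+1)
    if P a1 a2 q then H a1 a2 else 0).
  rewrite [RHS]exchange_big; apply: eq_bigr => a1 _.
  by rewrite [RHS]exchange_big.
rewrite big_seq [RHS]big_seq; apply: eq_bigr => q; rewrite -dvdn_divisors // => qQ.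
set d := (Q %/ q)%N; have QE : Q = (q * d)%N by rewrite mulnC divnK.
have q0 : (0 < q)%N := dvdn_gt0 Q0 qQ.
have d0 : (0 < d)%N by rewrite divn_gt0 // dvdn_leq.
have Pd a1 a2 : P a1 a2 q -> (d %| a1)%N /\ (d %| a2)%N.
  move=> /eqP; rewrite -/d => <-; split; apply: dvdn_trans (dvdn_gcdl _ _) _.
    exact: dvdn_gcdl.
  exact: dvdn_gcdr.
have zero a1 a2 : ~~ (d %| a1)%N || ~~ (d %| a2)%N ->
    (if P a1 a2 q then H a1 a2 else 0) = 0.
  by case: ifP => // /Pd[-> ->].
rewrite [in X in \sum_(1 <= a1 < X) _]QE (sum_multiples _ d0); last first.
  by move=> a1 a1d; apply: big1 => a2 _; rewrite zero ?a1d.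
apply: eq_bigr => b1 _; rewrite [in X in \sum_(1 <= a2 < X) _]QE (sum_multiples _ d0); last first.
  by move=> a2 a2d; rewrite zero ?a2d ?orbT.
rewrite [RHS]big_mkcond; apply: eq_bigr => b2 _; congr (if _ then _ else _).
by rewrite /P -/d {1}QE -!muln_gcdl -{2}[d]mul1n eqn_pmul2r.
Qed.

End DivisorSums.

Section SeriesTerms.
Variables (R : realType) (n : nat) (Q1 Q2 : 'M[int]_n).
Hypotheses (s1 : integral_form Q1) (s2 : integral_form Q2).

Lemma pencilZ_sym a1 a2 : integral_form (pencilZ Q1 Q2 a1 a2).
Proof. by rewrite /integral_form linearD !linearZ /= s1 s2. Qed.

Lemma qform_pencilZ a1 a2 (x : 'cV[int]_n) :
  qform (pencilZ Q1 Q2 a1 a2) x = a1%:Z * qform Q1 x + a2%:Z * qform Q2 x.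
Proof.
rewrite -qform_pencil /qform; congr ((_ *m _ *m _) 0 0).
by apply/matrixP => i j; rewrite !mxE !intz.
Qed.

Lemma complete_sumE a1 a2 q :
  complete_sum R Q1 Q2 a1 a2 q = gauss_sum R q (pencilZ Q1 Q2 a1 a2).
Proof. by apply: eq_bigr => z _; rewrite /= /eq_char qform_pencilZ. Qed.

Lemma residue_sum_mul (F : 'cV[int]_n -> R[i]) (q d : nat) : (0 < q)%N -> (0 < d)%N ->
  (forall x y, cong q%:Z x y -> F x = F y) ->
  \sum_(z : 'cV['I_(q * d)]_n) F (int_lift z) =
  (d ^ n)%:R * \sum_(z : 'cV['I_q]_n) F (int_lift z).
Proof.
move=> q0 d0 FP; have qd0 : (0 < q * d)%N by rewrite muln_gt0 q0.
pose T := ('cV['I_q]_n * 'cV['I_d]_n)%type.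
have [f fP] : exists f : T -> 'cV['I_(q * d)]_n, forall u,
    cong (q * d)%:Z (int_lift (f u)) (int_lift u.1 + q%:Z *: int_lift u.2).
  by apply: (ex_choice (P := fun (u : T) (w : 'cV['I_(q * d)]_n) =>
    cong (q * d)%:Z (int_lift w) (int_lift u.1 + q%:Z *: int_lift u.2))) => u;
    exact: residue_exists.
have fq u : cong q%:Z (int_lift (f u)) (int_lift u.1).
  move=> l; have := fP u l; rewrite [X in (_ - X)%R]mxE opprD addrA scalemx_entry => h.
  have qqd : (q%:Z %| (q * d)%:Z)%Z by rewrite dvdzE /= dvdn_mulr.
  have := rpredD (dvdz_trans qqd h) (dvdz_mulr (int_lift u.2 l 0) (dvdzz q%:Z)).
  by rewrite subrK.
have fI : injective f.
  move=> [x y] [x' y'] fE; have fu := fP (x, y); have fu' := fP (x', y').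
  have xx : x = x'.
    apply/matrixP => l c; rewrite ord1; apply: ord_cong_inj.
    have := rpredB (fq (x', y') l) (fq (x, y) l).
    by rewrite fE opprB addrC subrKA !mxE.
  congr pair => //; apply/matrixP => l c; rewrite ord1; apply: ord_cong_inj.
  have := rpredB (fu' l) (fu l); rewrite fE opprB addrC subrKA /= xx.
  rewrite !addmx_entry opprD addrACA subrr add0r !scalemx_entry -mulrBr PoszM.
  by rewrite dvdz_mul2l ?mxE // -lt0n.
have fB : bijective f.
  by apply: (inj_card_bij fI); rewrite card_prod !card_mx !card_ord !muln1 expnMn.
rewrite (reindex f) /=; last exact: onW_bij.
transitivity (\sum_(x : 'cV['I_q]_n) \sum_(y : 'cV['I_d]_n) F (int_lift (f (x, y)))).
  by rewrite pair_big /=; apply: eq_bigr => -[x y].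
rewrite mulr_sumr.
apply: eq_bigr => x _; rewrite (eq_bigr (fun=> F (int_lift x))) => [|y _].
  by rewrite sumr_const card_mx card_ord muln1 mulr_natl.
exact: FP (fq (x, y)).
Qed.

Lemma gauss_sum_mul a1 a2 q d : (0 < q)%N -> (0 < d)%N ->
  gauss_sum R (q * d) (pencilZ Q1 Q2 (a1 * d) (a2 * d)) =
  (d ^ n)%:R * gauss_sum R q (pencilZ Q1 Q2 a1 a2).
Proof.
move=> q0 d0; pose M := pencilZ Q1 Q2 a1 a2.
rewrite -(residue_sum_mul (F := fun x => eq_char R q (qform M x))) //; last first.
  by move=> x y /(qform_cong (pencilZ_sym a1 a2))/(eq_char_cong R q0).
apply: eq_bigr => z _; rewrite /eq_char; congr e2pii.
rewrite !qform_pencilZ !PoszM !rmorphD !rmorphM /= ?natrM.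
have d0' : d%:R != 0 :> R by rewrite pnatr_eq0 -lt0n.
have q0' : q%:R != 0 :> R by rewrite pnatr_eq0 -lt0n.
by field; rewrite q0'.
Qed.

Lemma sum_eq_char q c : (0 < q)%N ->
  \sum_(1 <= a < q.+1) eq_char R q (a%:Z * c) = if (q%:Z %| c)%Z then q%:R else 0.
Proof.
move=> q0; set z := eq_char R q c.
have zX (a : nat) : eq_char R q (a%:Z * c) = z ^+ a.
  elim: a => [|a IH]; first by rewrite mul0r eq_char_dvd.
  by rewrite exprS -IH -eq_charD; congr eq_char; rewrite intS; ring.
under eq_bigr => a _ do rewrite zX.
case: ifPn => qc.
  rewrite /z eq_char_dvd // (eq_bigr (fun=> 1)) => [|a _]; last by rewrite expr1n.
  by rewrite sumr_const_nat subn1.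
rewrite big_add1 /= big_mkord.
under eq_bigr => a _ do rewrite exprS.
rewrite -mulr_sumr; have /eqP : z ^+ q - 1 = 0.
  by rewrite -zX eq_char_dvd ?subrr // dvdz_mulr.
rewrite subrX1 mulf_eq0 subr_eq0 (negbTE (eq_char_neq1 R q0 qc)) => /eqP ->.
by rewrite mulr0.
Qed.

Lemma sum_gauss_sum Q : (0 < Q)%N ->
  \sum_(1 <= a1 < Q.+1) \sum_(1 <= a2 < Q.+1) gauss_sum R Q (pencilZ Q1 Q2 a1 a2) =
  (Q ^ 2 * #|zero_mod Q1 Q2 Q|)%:R.
Proof.
move=> Q0.
transitivity (\sum_(z : 'cV['I_Q]_n) (\sum_(1 <= a1 < Q.+1) eq_char R Q (a1%:Z * qform Q1 (int_lift z)))
    * (\sum_(1 <= a2 < Q.+1) eq_char R Q (a2%:Z * qform Q2 (int_lift z)))).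
  under [RHS]eq_bigr => z _ do rewrite mulr_suml.
  rewrite [RHS]exchange_big; apply: eq_bigr => a1 _.
  under [RHS]eq_bigr => z _ do rewrite mulr_sumr.
  rewrite [RHS]exchange_big; apply: eq_bigr => a2 _; apply: eq_bigr => z _.
  by rewrite -eq_charD qform_pencilZ.
under eq_bigr => z _ do rewrite !sum_eq_char //.
rewrite natrM mulr_natr -sumr_const [RHS]big_mkcond /=; apply: eq_bigr => z _.
rewrite inE; case: ifP => _ /=; last by rewrite mul0r.
by case: ifP => _; rewrite ?mulr0 // natrX expr2.
Qed.

(** Without the coprimality condition the sum over [a1] and [a2] modulo [Q] counts solutions, by
    orthogonality of characters. Reducing the fractions splits it into the series terms of all
    denominators dividing [Q]. *)
Lemma sum_divisors_term Q : (0 < Q)%N ->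
  \sum_(q <- divisors Q) singular_series_term R Q1 Q2 q =
  (Q ^ 2 * #|zero_mod Q1 Q2 Q|)%:R / Q%:R ^+ n.
Proof.
move=> Q0; rewrite -sum_gauss_sum // sum_by_gcd // mulr_suml.
rewrite big_seq [RHS]big_seq; apply: eq_bigr => q; rewrite -dvdn_divisors // => qQ.
rewrite /singular_series_term mulrC mulr_suml [RHS]mulr_suml.
apply: eq_bigr => b1 _; rewrite !mulr_suml; apply: eq_bigr => b2 _.
have q0 := dvdn_gt0 Q0 qQ; set d := (Q %/ q)%N.
have d0 : (0 < d)%N by rewrite divn_gt0 //; exact: dvdn_leq Q0 qQ.
have -> : Q = (q * d)%N by rewrite mulnC divnK.
rewrite complete_sumE gauss_sum_mul // natrM exprMn natrX.
have d0' : d%:R != 0 :> R[i] by rewrite pnatr_eq0 -lt0n.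
have q0' : q%:R != 0 :> R[i] by rewrite pnatr_eq0 -lt0n.
by field; rewrite !expf_neq0.
Qed.

Lemma term_bound : condition1 Q1 Q2 -> (9 <= n)%N -> exists C : nat, forall q, (0 < q)%N ->
  `|singular_series_term R Q1 Q2 q| <= C%:R / q%:R ^+ 2.
Proof.
move=> hC n9; have n1 : (1 < n)%N by rewrite (leq_trans _ n9).
have [C [C0 CP]] := card_kernel_mod s1 s2 hC n1; exists C => q q0.
have qn0 : q%:R != 0 :> R[i] by rewrite pnatr_eq0 -lt0n.
(* The exponent [n - 4] is what leaves [q^-2] after summing over at most [q^2] pairs and dividing by
   [q^n]. Weyl's bound is [C q^(n + 1)] for the square, and [n >= 9] gives [n + 1 <= 2 (n - 4)]. *)
have gb a1 a2 : coprime (gcdn a1 a2) q ->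
    `|complete_sum R Q1 Q2 a1 a2 q| <= (C * q ^ (n - 4))%:R.
  move=> cop; rewrite complete_sumE -(@ler_pXn2r _ 2) ?nnegrE ?ler0n //.
  apply: le_trans (weyl_bound R q0 (pencilZ_sym a1 a2)) _.
  rewrite -natrX ler_nat; apply: (@leq_trans (q ^ n * (C * q))).
    by rewrite leq_mul2l CP ?orbT.
  rewrite mulnCA expnMn -expnSr leq_mul //; first by rewrite -{1}[C]expn1 leq_pexp2l.
  by rewrite -expnM leq_pexp2l //; clear -n9; lia.
rewrite normrM normrV ?unitfE ?expf_neq0 // normrX normr_nat.
have : `|\sum_(1 <= a1 < q.+1) \sum_(1 <= a2 < q.+1 | gcdn (gcdn a1 a2) q == 1%N)
     complete_sum R Q1 Q2 a1 a2 q| <= (q * (q * (C * q ^ (n - 4))))%:R.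
  have sumb (F : nat -> R[i]) (B : nat) : (forall a, `|F a| <= B%:R) ->
      `|\sum_(1 <= a < q.+1) F a| <= (q * B)%:R.
    move=> FB; apply: le_trans (ler_norm_sum _ _ _) _.
    apply: (@le_trans _ _ (\sum_(1 <= a < q.+1) B%:R)); first exact: ler_sum.
    by rewrite sumr_const_nat subn1 natrM mulr_natl.
  apply: (sumb) => a1; rewrite big_mkcond; apply: (sumb) => a2.
  by case: ifP => [/gb//|_]; rewrite normr0 ler0n.
set S := (X in X <= _) => Sb.
have -> : C%:R / q%:R ^+ 2 = q%:R ^- n * (q * (q * (C * q ^ (n - 4))))%:R :> R[i].
  rewrite !natrM natrX -{1}(subnK (leq_trans (isT : (4 <= 9)%N) n9)) exprD.
  by field; rewrite qn0 expf_neq0.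
by rewrite ler_wpM2l // invr_ge0 exprn_ge0 // ler0n.
Qed.

End SeriesTerms.

(** * Splitting an integer by the size of its primes *)

Section PrimePowerSplit.

Lemma coprime_prodr m (I : Type) (r : seq I) (P : pred I) (F : I -> nat) :
  (forall i, P i -> coprime m (F i)) -> coprime m (\prod_(i <- r | P i) F i).
Proof.
move=> h; elim/big_ind: _ => //; first by rewrite coprimen1.
by move=> a b ma mb; rewrite coprimeMr ma.
Qed.

(** The product may run over all integers of the range, as [logn p m] is 0 when [p] is not prime. *)
Definition prime_part (a b m : nat) : nat := \prod_(a <= p < b) p ^ logn p m.

Lemma prime_part_coprime a b c d m : (b <= c)%N ->
  coprime (prime_part a b m) (prime_part c d m).
Proof.
move=> bc; rewrite /prime_part big_seq coprime_sym; apply/coprime_prodr => p.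
rewrite mem_index_iota => /andP[_ pb].
rewrite big_seq coprime_sym; apply/coprime_prodr => r; rewrite mem_index_iota => /andP[cr _].
have pr : (p < r)%N by rewrite (leq_trans pb) // (leq_trans bc).
case pp: (prime p); last by rewrite lognE pp expn0 coprime1n.
case pr': (prime r); last by rewrite [logn r m]lognE pr' expn0 coprimen1.
apply/coprimeXl/coprimeXr; rewrite prime_coprime // dvdn_prime2 //.
by rewrite neq_ltn pr.
Qed.

Lemma prime_part_gt0 a b m : (0 < prime_part a b m)%N.
Proof.
apply: prodn_gt0 => p; have [pp|/negbTE pp] := boolP (prime p).
  by rewrite expn_gt0 prime_gt0.
by rewrite lognE pp.
Qed.

Lemma prime_part_split P m : (0 < m)%N -> (P <= m.+1)%N ->
  m = (prime_part 0 P m * prime_part P m.+1 m)%N.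
Proof.
move=> m0 Pm; by rewrite /prime_part -big_cat_nat //= -[LHS]partnT.
Qed.

Lemma prime_part_divisor_ge P b m q : (q %| prime_part P b m)%N -> q != 1%N -> (P <= q)%N.
Proof.
move=> qd q1; have q0 : (0 < q)%N := dvdn_gt0 (prime_part_gt0 P b m) qd.
have q1' : (1 < q)%N by rewrite ltn_neqAle eq_sym q1.
have pp := pdiv_prime q1'; apply: leq_trans _ (pdiv_leq q0).
have := dvdn_trans (pdiv_dvd q) qd; rewrite leqNgt; apply: contraL => qP.
rewrite -prime_coprime // /prime_part big_seq; apply/coprime_prodr => r.
rewrite mem_index_iota => /andP[Pr _].
case pr: (prime r); last by rewrite lognE pr expn0 coprimen1.
apply: coprimeXr; rewrite prime_coprime // dvdn_prime2 //.
by rewrite neq_ltn (leq_trans qP).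
Qed.

End PrimePowerSplit.

Section SeriesPositivity.
Variables (R : realType) (n : nat) (Q1 Q2 : 'M[int]_n).
Hypotheses (s1 : integral_form Q1) (s2 : integral_form Q2).
Hypotheses (hC : condition1 Q1 Q2) (n9 : (9 <= n)%N).

Local Notation T := (singular_series_term R Q1 Q2).

Definition local_density (Q : nat) : R := (Q ^ 2 * #|zero_mod Q1 Q2 Q|)%:R / Q%:R ^+ n.

Lemma local_densityE Q : (0 < Q)%N ->
  (local_density Q)%:C%C = \sum_(q <- divisors Q) T q.
Proof.
move=> Q0; rewrite sum_divisors_term // /local_density rmorphM fmorphV rmorphXn /=.
by rewrite !rmorph_nat.
Qed.

(** The density modulo [q] is real and is the sum of the terms over the divisors of [q]. By strong
    induction the terms of the proper divisors are real, hence so is the remaining one. *)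
Lemma term_real q : (0 < q)%N -> T q = (complex.Re (T q))%:C%C.
Proof.
elim/ltn_ind: q => q IH q0.
have := local_densityE q0; rewrite (bigD1_seq q) ?divisors_uniq -?dvdn_divisors //=.
move=> E; have -> : T q = (local_density q)%:C%C - \sum_(i <- divisors q | i != q) T i.
  by rewrite E addrK.
have -> : \sum_(i <- divisors q | i != q) T i =
    (\sum_(i <- divisors q | i != q) complex.Re (T i))%:C%C.
  rewrite rmorph_sum big_seq_cond [RHS]big_seq_cond; apply: eq_bigr => i /andP[].
  rewrite -dvdn_divisors // => iq iq'; apply: IH; last exact: dvdn_gt0 iq.
  by rewrite ltn_neqAle iq' dvdn_leq.
by rewrite -rmorphB.
Qed.

Lemma local_density_sum Q : (0 < Q)%N ->
  local_density Q = \sum_(q <- divisors Q) complex.Re (T q).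
Proof.
move=> Q0; apply: complexI; rewrite local_densityE // rmorph_sum.
rewrite big_seq [RHS]big_seq; apply: eq_bigr => q; rewrite -dvdn_divisors // => qQ.
exact: term_real (dvdn_gt0 Q0 qQ).
Qed.

Lemma term_Re_bound : exists C : nat, forall q, (0 < q)%N ->
  `|complex.Re (T q)| <= C%:R / q%:R ^+ 2.
Proof.
have [C CP] := term_bound R s1 s2 hC n9; exists C => q q0.
rewrite -lecR; apply: le_trans (normc_ge_Re _) _; apply: le_trans (CP q q0) _.
by rewrite rmorphM fmorphV rmorphXn /= !rmorph_nat.
Qed.

Lemma local_density_mul a b : coprime a b -> (0 < a)%N -> (0 < b)%N ->
  local_density a * local_density b <= local_density (a * b).
Proof.
move=> cab a0 b0; rewrite /local_density mulf_div -natrM [(a * b)%:R]natrM exprMn.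
rewrite ler_pM2r ?invr_gt0 ?mulr_gt0 ?exprn_gt0 ?ltr0n // ler_nat.
rewrite mulnACA expnMn leq_mul2l; apply/orP; right.
exact: card_zero_mod_mul.
Qed.

Lemma local_density1 : local_density 1 = 1.
Proof.
have c1 : #|zero_mod Q1 Q2 1| = 1%N.
  apply/eqP; rewrite eqn_leq card_zero_mod_gt0 // andbT.
  by apply: leq_trans (max_card _) _; rewrite card_mx card_ord exp1n.
by rewrite /local_density c1 expr1n divr1.
Qed.

Lemma term1 : complex.Re (T 1) = 1.
Proof.
have := local_density_sum (isT : (0 < 1)%N).
by rewrite local_density1 [divisors 1]/= big_seq1 => <-.
Qed.

Lemma sum_inv_sqr a b : (0 < a)%N ->
  \sum_(a.+1 <= q < b) (q%:R ^+ 2)^-1 <= (a%:R)^-1 :> R.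
Proof.
move=> a0; have [ba|ab] := leqP b a.+1; first by rewrite big_geq // invr_ge0.
apply: (@le_trans _ _ (a%:R^-1 - (b.-1)%:R^-1)); last first.
  by rewrite lerBlDr lerDl invr_ge0.
case: b ab => // b; rewrite ltnS => ab /=.
have -> : a%:R^-1 - b%:R^-1 = \sum_(a.+1 <= q < b.+1) ((q.-1)%:R^-1 - q%:R^-1) :> R.
  have := telescope_sumr (fun k => - (k%:R^-1) : R) (ltnW ab).
  rewrite opprK addrC => <-; rewrite big_add1 /=; apply: eq_bigr => k _.
  by rewrite opprK addrC.
rewrite big_nat [leRHS]big_nat; apply: ler_sum => q /andP[aq _].
case: q aq => // q; rewrite ltnS => aq /=; have q0 : (0 < q)%N := leq_trans a0 aq.
have h0 : 0 < q%:R :> R by rewrite ltr0n.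
have h1 : 0 < q.+1%:R :> R by rewrite ltr0n.
have -> : q%:R^-1 - q.+1%:R^-1 = (q%:R * q.+1%:R)^-1 :> R.
  by rewrite -natr1; field; rewrite natr1 !gt_eqF.
by rewrite lef_pV2 ?posrE ?mulr_gt0 ?exprn_gt0 // expr2 ler_pM2r // ler_nat.
Qed.

Lemma divisor_tail (C a Q : nat) (P : pred nat) : (0 < a)%N -> (0 < Q)%N ->
  (forall q, (0 < q)%N -> `|complex.Re (T q)| <= C%:R / q%:R ^+ 2) ->
  (forall q, (q %| Q)%N -> P q -> (a < q)%N) ->
  `|\sum_(q <- divisors Q | P q) complex.Re (T q)| <= C%:R / a%:R.
Proof.
move=> a0 Q0 CP Pa; apply: le_trans (ler_norm_sum _ _ _) _.
apply: (@le_trans _ _ (\sum_(a.+1 <= q < Q.+1) C%:R * (q%:R ^+ 2)^-1)); last first.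
  by rewrite -mulr_sumr ler_wpM2l // sum_inv_sqr.
rewrite -big_filter; set s := seq.filter _ _.
have sS : {subset s <= index_iota a.+1 Q.+1}.
  move=> q; rewrite mem_filter -dvdn_divisors // mem_index_iota ltnS => /andP[Pq qQ].
  by rewrite Pa //= dvdn_leq.
have su : uniq s by rewrite filter_uniq // divisors_uniq.
have -> : \sum_(a.+1 <= q < Q.+1) C%:R * (q%:R ^+ 2)^-1 =
    \sum_(q <- s) C%:R * (q%:R ^+ 2)^-1 +
    \sum_(a.+1 <= q < Q.+1 | q \notin s) C%:R * (q%:R ^+ 2)^-1 :> R.
  rewrite (bigID (mem s)) /=; congr (_ + _); rewrite -[LHS]big_filter.
  apply: perm_big; apply: uniq_perm => //; first by rewrite filter_uniq // iota_uniq.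
  by move=> q; rewrite mem_filter andb_idr //; exact: sS.
rewrite -[leLHS]addr0 lerD //; last first.
  by apply: sumr_ge0 => q _; rewrite mulr_ge0 // invr_ge0 exprn_ge0.
rewrite big_seq [leRHS]big_seq; apply: ler_sum => q.
by rewrite mem_filter -dvdn_divisors // => /andP[_ qQ]; apply: CP; exact: dvdn_gt0 qQ.
Qed.

Hypothesis hp : forall p : nat, prime p -> nonzero_solution (padic_int p) Q1 Q2.

Lemma local_density_prime_power p : prime p ->
  exists2 c : R, 0 < c & forall e, c <= local_density (p ^ e).
Proof.
move=> pp; have n0 : (0 < n)%N by rewrite (leq_trans _ n9).
have [N NP] := card_zero_mod_prime_power s1 s2 pp hC n0 (hp pp).
have p0 : 0 < p%:R :> R by rewrite ltr0n prime_gt0.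
exists (p%:R ^- (N * (n - 2))); first by rewrite invr_gt0 exprn_gt0.
move=> e; rewrite /local_density ler_pdivlMr ?exprn_gt0 ?ltr0n ?expn_gt0 ?prime_gt0 //.
rewrite mulrC ler_pdivrMr ?exprn_gt0 // -!natrX -natrM ler_nat.
have n2 := leq_trans (isT : (2 <= 9)%N) n9.
have -> : ((p ^ e) ^ n = p ^ (e * 2) * p ^ (e * (n - 2)))%N.
  by rewrite -expnM -expnD -mulnDr subnKC.
rewrite -expnM; apply: (@leq_trans (p ^ (e * 2) * (p ^ (N * (n - 2)) * #|zero_mod Q1 Q2 (p ^ e)|))).
  by rewrite leq_mul2l NP orbT.
by rewrite -mulnA [X in (_ <= _ * X)%N]mulnC.
Qed.

(** The exponents of the primes below [P] are unbounded as [m] varies, so the Hensel estimate is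
    needed uniformly in the exponent; one prime is added at a time. *)
Lemma local_density_smooth P :
  exists2 c : R, 0 < c & forall m, c <= local_density (prime_part 0 P m).
Proof.
elim: P => [|P [c c0 cP]].
  by exists 1 => // m; rewrite /prime_part big_geq // local_density1.
have E m : prime_part 0 P.+1 m = (prime_part 0 P m * P ^ logn P m)%N.
  by rewrite /prime_part big_nat_recr.
case pP: (prime P); last first.
  by exists c => // m; rewrite E [logn P m]lognE pP expn0 muln1.
have [d d0 dP] := local_density_prime_power pP.
exists (c * d) => [|m]; first exact: mulr_gt0.
have copr : coprime (prime_part 0 P m) (P ^ logn P m).
  have := prime_part_coprime 0 P.+1 m (leqnn P).
  by rewrite {2}/prime_part big_nat1.
rewrite E; apply: le_trans (local_density_mul copr _ _).
- by rewrite ler_pM // ltW.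
- exact: prime_part_gt0.
- by rewrite expn_gt0 prime_gt0.
Qed.

(* Split [m!] into the part composed of primes below a bound [P], bounded below by Hensel's
   lemma at finitely many primes, and the rest, all of whose divisors other than 1 are at
   least [P] and so contribute less than 1/2 by absolute convergence. *)
Lemma local_density_lower :
  exists2 c : R, 0 < c & exists P, forall m, (P <= m)%N -> c <= local_density m.
Proof.
(* Divisors other than 1 of the part with large primes exceed [2 C + 1], so their terms sum to at
   most [C / (2 C + 1) <= 1/2], against the term 1 of [q = 1]. *)
have [C CP] := term_Re_bound; pose P := (2 * C).+2.
have [c c0 cP] := local_density_smooth P.
exists (c / 2); first by rewrite divr_gt0.
exists P => m Pm; have m0 : (0 < m)%N by rewrite (leq_trans _ Pm).
rewrite [X in local_density X](prime_part_split (P := P) m0) ?leqW //.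
apply: le_trans (local_density_mul _ _ _); last exact: prime_part_gt0.
- rewrite ler_pM ?(ltW c0) // ?invr_ge0 //.
  set B := prime_part P _ _; have B0 : (0 < B)%N by exact: prime_part_gt0.
  rewrite local_density_sum // (bigD1_seq 1%N) ?divisors_uniq -?dvdn_divisors //=.
  have : `|\sum_(q <- divisors B | q != 1%N) complex.Re (T q)| <= C%:R / (2 * C).+1%:R.
    apply: divisor_tail => // q qB q1; exact: prime_part_divisor_ge qB q1.
  rewrite term1; set x := \sum_(_ <- _ | _) _ => xb.
  have C2 : C%:R / (2 * C).+1%:R <= 2^-1 :> R.
    have E : (2 * C).+1%:R = 2 * C%:R + 1 :> R by rewrite -addn1 natrD natrM.
    by rewrite ler_pdivrMr ?ltr0n // E; lra.
  move: xb C2; move: (C%:R / _) => y; rewrite ler_norml => /andP[h1 h2] h3; lra.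
- exact: prime_part_coprime.
- exact: prime_part_gt0.
Qed.

End SeriesPositivity.

Section SeriesConclusion.
Variables (R : realType) (n : nat) (Q1 Q2 : 'M[int]_n).
Hypotheses (s1 : integral_form Q1) (s2 : integral_form Q2).
Hypotheses (hC : condition1 Q1 Q2) (n9 : (9 <= n)%N).
Local Notation T := (singular_series_term R Q1 Q2).

Lemma real_partial_cvg : cvgn (fun N => \sum_(1 <= q < N.+1) complex.Re (T q)).
Proof.
have [C CP] := term_Re_bound R s1 s2 hC n9.
pose f k : R := complex.Re (T k.+1).
have -> : (fun N => \sum_(1 <= q < N.+1) complex.Re (T q)) = series f.
  by apply/funext => N; rewrite big_add1.
apply: normed_cvg; apply: nondecreasing_is_cvgn.
  apply/nondecreasing_seqP => k; rewrite /normed_series_of /= !seriesEnat /= big_nat_recr //= lerDl; exact: normr_ge0.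
exists (C%:R * 2) => _ [N _ <-] /=.
apply: (@le_trans _ _ (\sum_(1 <= q < N.+1) C%:R * (q%:R ^+ 2)^-1)).
  rewrite big_add1 /=; apply: ler_sum => k _; exact: CP.
rewrite -mulr_sumr ler_wpM2l //.
case: N => [|N]; first by rewrite big_geq.
rewrite big_ltn // expr1n invr1 (_ : 2 = 1 + 1) // lerD2l.
by apply: le_trans (sum_inv_sqr R _ (isT : (0 < 1)%N)) _; rewrite invr1.
Qed.

Lemma singular_series_positive :
  (forall p : nat, prime p -> nonzero_solution (padic_int p) Q1 Q2) ->
  cvgn (singular_series_partial R Q1 Q2) /\
  complex.Im (singular_series R Q1 Q2) = 0 /\
  0 < complex.Re (singular_series R Q1 Q2).
Proof.
move=> hp; pose u N : R := \sum_(1 <= q < N.+1) complex.Re (T q).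
have cu : cvgn u := real_partial_cvg.
have pE N : singular_series_partial R Q1 Q2 N = (u N)%:C%C.
  rewrite /singular_series_partial /u rmorph_sum big_nat [RHS]big_nat.
  by apply: eq_bigr => q /andP[q0 _]; exact: term_real.
have cS : singular_series_partial R Q1 Q2 @ \oo --> ((limn u)%:C%C : R[i]^o).
  apply/cvgrPdist_lt => e e0.
  have eE : e = (complex.Re e)%:C%C by rewrite RRe_real // ger0_real // ltW.
  have r0 : 0 < complex.Re e by move: e0; rewrite eE ltcR.
  have /cvgrPdist_lt/(_ _ r0) := cu; apply: filterS => N h.
  rewrite pE -rmorphB eE /=; apply: le_lt_trans (_ : `|limn u - u N|%:C%C < _).
    by rewrite normc_def /= expr0n /= addr0 sqrtr_sqr.
  by rewrite ltcR.
have SE : singular_series R Q1 Q2 = (limn u)%:C%C.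
  exact: (cvg_lim (@norm_hausdorff _ _) cS).
split; first by apply/cvg_ex; exists (limn u)%:C%C.
rewrite SE /=; split=> //.
have [c c0 [P cP]] := local_density_lower R s1 s2 hC n9 hp.
have [C CP] := term_Re_bound R s1 s2 hC n9.
apply: (@lt_le_trans _ _ (c / 2)); first by rewrite divr_gt0.
apply: limr_ge => //.
(* For [m >= 2 C / c] the terms beyond [m] amount to at most [C / m <= c / 2], half of the lower
   bound for the densities. *)
pose K := Num.truncn (2 * C%:R / c).
exists (P + K.+1)%N => // m /= Pm.
have m0 : (0 < m)%N by rewrite (leq_trans _ Pm) // addnS.
have lb : c <= local_density R Q1 Q2 m`!.
  by apply: cP; rewrite (leq_trans _ (fact_geq m)) // (leq_trans _ Pm) // leq_addr.
(* Every positive [q <= m] divides [m!], so the density modulo [m!] is the [m]th partial sum of the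
   series plus terms of denominators above [m]. *)
have sumE : local_density R Q1 Q2 m`! = u m +
    \sum_(q <- divisors m`! | (m < q)%N) complex.Re (T q).
  rewrite local_density_sum ?fact_gt0 // (bigID (fun q => (m < q)%N)) /= addrC; congr (_ + _).
  rewrite -big_filter /u; apply: perm_big; apply: uniq_perm.
  - by rewrite filter_uniq // divisors_uniq.
  - exact: iota_uniq.
  move=> q; rewrite mem_filter -dvdn_divisors ?fact_gt0 // -leqNgt mem_index_iota ltnS.
  apply/andP/andP => -[]; first by move=> -> /(dvdn_gt0 (fact_gt0 m)).
  by move=> q0 qm; split=> //; rewrite dvdn_fact // q0.
have tail : `|\sum_(q <- divisors m`! | (m < q)%N) complex.Re (T q)| <= C%:R / m%:R.
  by apply: divisor_tail => //; exact: fact_gt0.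
have Cm : C%:R / m%:R <= c / 2.
  have mK : 2 * C%:R / c <= m%:R.
    apply: ltW; apply: lt_le_trans (truncnS_gt _) _.
    by rewrite ler_nat (leq_trans _ Pm) // leq_addl.
  rewrite ler_pdivrMr ?ltr0n //; move: mK; rewrite ler_pdivrMr // => mK.
  have -> : c / 2 * m%:R = m%:R * c / 2 by ring.
  by lra.
move: tail lb Cm; rewrite sumE; move: (C%:R / m%:R) (\sum_(_ <- _ | _) _) => x y.
by rewrite ler_norml -/(u m) => /andP[t1 t2] lb xc; lra.
Qed.

End SeriesConclusion.

(** * Integration over tuples *)

Section MatrixNorm.
Variables (R : realType) (n : nat).
Implicit Types x y : 'cV[R]_n.

Lemma cV_norm_lt x (e : R) : 0 < e -> (forall i, `|x i 0| < e) -> `|x| < e.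
Proof.
move=> e0 h; rewrite [ltLHS]/Num.Def.normr /= mx_normrE.
by apply/bigmax_ltP; split=> // -[i j] _ /=; rewrite ord1.
Qed.

Lemma cV_norm_le x (e : R) : 0 <= e -> (forall i, `|x i 0| <= e) -> `|x| <= e.
Proof.
move=> e0 h; rewrite [leLHS]/Num.Def.normr /= mx_normrE.
by apply/bigmax_leP; split=> // -[i j] _ /=; rewrite ord1.
Qed.

Lemma cV_coord_le x i : `|x i 0| <= `|x|.
Proof.
rewrite [leRHS]/Num.Def.normr /= mx_normrE.
exact: (le_bigmax _ (fun ij : 'I_n * 'I_1 => `|x ij.1 ij.2|) (i, 0)).
Qed.

End MatrixNorm.

Section MeasurableContinuous.
Context d (X : measurableType d) (R : realType) (n : nat).

Lemma measurable_fun_floor (a : X -> R) (v : int) : measurable_fun setT a ->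
  measurable [set x | Num.floor (a x) = v].
Proof.
move=> ma; have -> : [set x | Num.floor (a x) = v] =
    setT `&` a @^-1` `[v%:~R, (v + 1)%:~R[%classic.
  rewrite setTI; apply/seteqP; split => x /=; rewrite in_itv /=.
    by move/eqP; rewrite floor_eq.
  by rewrite -floor_eq => /eqP.
exact: ma.
Qed.

(** Round the vector down to the grid of mesh [1 / (m + 1)]. The rounded function takes countably
    many values on measurable sets and converges pointwise by continuity of [g], so no sigma-algebra
    on column vectors is involved. *)
Lemma measurable_continuous_comp (a : 'I_n -> X -> R) (g : 'cV[R]_n -> R) :
  (forall i, measurable_fun setT (a i)) -> continuous g ->
  measurable_fun setT (fun x => g (\col_i a i x)).
Proof.
move=> ma gc.
pose fl (m : nat) x : 'cV[int]_n := \col_i Num.floor (m.+1%:R * a i x).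
pose G (m : nat) (v : 'cV[int]_n) : R := g (\col_i ((v i 0)%:~R / m.+1%:R)).
apply: (@measurable_fun_cvg _ _ _ _ (fun m x => G m (fl m x))).
  move=> m _ Y mY; rewrite setTI.
  pose F (v : 'cV[int]_n) : set X := if asbool (Y (G m v)) then
    \bigcap_(i in setT) [set x | Num.floor (m.+1%:R * a i x) = v i 0] else set0.
  have -> : (fun x => G m (fl m x)) @^-1` Y = \bigcup_v F v.
    apply/seteqP; split=> [x /= Yx|x [v _]].
      by exists (fl m x) => //; rewrite /F asboolT // => i _ /=; rewrite mxE.
    rewrite /F; case: asboolP => // Yv /= vx.
    suff -> : fl m x = v by [].
    by apply/matrixP => i j; rewrite ord1 mxE; exact: vx.
  apply: countable_bigcupT_measurable; first exact: countableP.
  move=> v; rewrite /F; case: asboolP => _; last exact: measurable0.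
  apply: fin_bigcap_measurable; first exact: finite_finset.
  move=> i _; apply: measurable_fun_floor; apply: measurable_funM => //.
move=> x _; pose y : 'cV[R]_n := \col_i a i x.
have yc : (fun m => \col_i ((fl m x i 0)%:~R / m.+1%:R)) @ \oo --> y.
  apply/cvgrPdist_lt => e e0.
  exists (Num.truncn e^-1).+1 => // m /= me.
  have m0 : 0 < m.+1%:R :> R by rewrite ltr0n.
  apply: cV_norm_lt => // i; rewrite !mxE.
  have := eqxx (Num.floor (m.+1%:R * a i x)); rewrite floor_eq => /andP[f1 f2].
  have -> : a i x - (Num.floor (m.+1%:R * a i x))%:~R / m.+1%:R =
      (m.+1%:R * a i x - (Num.floor (m.+1%:R * a i x))%:~R) / m.+1%:R.
    by field; rewrite gt_eqF.
  rewrite ger0_norm ?divr_ge0 ?subr_ge0 // ?(ltW m0) // ltr_pdivrMr //.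
  apply: (@lt_trans _ _ 1); first by rewrite ltrBlDr -[1]/(1%:~R) addrC -intrD.
  rewrite -ltr_pdivrMl // mulr1; apply: lt_trans (truncnS_gt _) _.
  by rewrite ltr_nat ltnS.
exact: continuous_cvg (gc y) yc.
Qed.

End MeasurableContinuous.

Section LebesgueInvariance.
Variable R : realType.
Local Notation T := (measurableTypeR R).
Local Notation mu := (@lebesgue_measure R).
Local Open Scope ereal_scope.

(** Preserving the measure of half-open intervals is enough, by uniqueness of Lebesgue measure;
    translations and the reflection are the two instances. *)
Lemma ge0_integral_invariant (phi : T -> T) (f : T -> \bar R) :
  measurable_fun setT phi ->
  (forall X, ocitv X -> mu X = mu (phi @^-1` X)) ->
  measurable_fun setT f -> (forall x, 0 <= f x) ->
  \int[mu]_x f (phi x) = \int[mu]_x f x.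
Proof.
move=> mphi hphi mf f0.
pose m := measure_function_pushforward__canonical__measure_function_Measure mu mphi.
have E : forall A, measurable A -> mu A = m A by exact: lebesgue_measure_unique.
rewrite -[LHS](@ge0_integral_pushforward _ _ _ _ _ _ mphi mu setT f) //.
by apply: eq_measure_integral => A mA _; rewrite [RHS]E.
Qed.

Lemma ge0_integral_shift (a : R) (f : T -> \bar R) :
  measurable_fun setT f -> (forall x, 0 <= f x) ->
  \int[mu]_x f (x + a)%R = \int[mu]_x f x.
Proof.
apply: (@ge0_integral_invariant (fun x : T => (x + a)%R)).
  exact: measurable_funD.
move=> _ [[u v] _ <-]; rewrite /= (_ : _ @^-1` _ = `](u - a)%R, (v - a)%R]%classic); last first.
  by apply/seteqP; split => x /=; rewrite !in_itv /= ltrBlDr lerBrDr.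
rewrite !lebesgue_measure_itv /= !lte_fin ltrD2r; case: ifP => // _.
by rewrite -!EFinB; congr EFin; ring.
Qed.

Lemma ge0_integral_opp (f : T -> \bar R) :
  measurable_fun setT f -> (forall x, 0 <= f x) ->
  \int[mu]_x f (- x)%R = \int[mu]_x f x.
Proof.
apply: (@ge0_integral_invariant (fun x : T => (- x)%R)).
  exact: measurable_funN.
move=> _ [[u v] _ <-]; rewrite /= (_ : _ @^-1` _ = `[(- v)%R, (- u)%R[%classic); last first.
  by apply/seteqP; split => x /=; rewrite !in_itv /= lerNl ltrNr andbC.
rewrite !lebesgue_measure_itv /= !lte_fin ltrN2; case: ifP => // _.
by rewrite -!EFinB; congr EFin; ring.
Qed.

End LebesgueInvariance.

Section TupleMeasure.
Variable R : realType.
Local Notation T := (measurableTypeR R).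
Local Notation mu := (@lebesgue_measure R).
Local Open Scope ereal_scope.

Definition tcons n (x : T) (u : n.-tuple T) : n.+1.-tuple T :=
  [the n.+1.-tuple T of x :: u].

Lemma measurable_tcons n : measurable_fun setT (fun u : T * n.-tuple T => tcons u.1 u.2).
Proof. exact: measurable_cons. Qed.

Lemma ge0_integral_tuple_cons n (G : n.+1.-tuple T -> \bar R) :
  measurable_fun setT G -> (forall t, 0 <= G t) ->
  \int[@lebesgue_tuple R n.+1]_t G t =
  \int[mu]_x \int[@lebesgue_tuple R n]_u G (tcons x u).
Proof.
move=> mG G0; pose f := fun u : T * n.-tuple T => (tcons u.1 u.2).
have mf : measurable_fun setT f by exact: measurable_tcons.
pose pm : {measure set (T * n.-tuple T) -> \bar R} := mu \x @lebesgue_tuple R n.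
transitivity (\int[pushforward pm f]_u G u); first by [].
transitivity (\int[pm]_u G (f u)).
  by rewrite (@ge0_integral_pushforward _ _ _ _ _ _ mf pm setT G).
rewrite (@fubini_tonelli1 _ _ _ _ _ mu (@lebesgue_tuple R n) (G \o f)) //.
  exact: measurableT_comp.
by move=> u; exact: G0.
Qed.

Definition tuple_shift n (h : 'cV[R]_n) (t : n.-tuple T) : n.-tuple T :=
  [tuple (tnth t i + h i 0)%R | i < n].

Lemma measurable_tuple_shift n (h : 'cV[R]_n) : measurable_fun setT (tuple_shift h).
Proof.
apply/measurable_fun_tnthP => i.
rewrite (_ : _ \o _ = fun t => (tnth t i + h i 0)%R); last first.
  by apply/funext => t /=; rewrite tnth_mktuple.
by apply: measurable_funD => //; exact: measurable_tnth.
Qed.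

Lemma ge0_integral_tuple_shift n (h : 'cV[R]_n) (G : n.-tuple T -> \bar R) :
  measurable_fun setT G -> (forall t, 0 <= G t) ->
  \int[@lebesgue_tuple R n]_t G (tuple_shift h t) = \int[@lebesgue_tuple R n]_t G t.
Proof.
elim: n h G => [|n IH] h G mG G0.
  by apply: eq_integral => t _; rewrite tuple0 [t]tuple0.
have mGs := measurableT_comp mG (measurable_tuple_shift h).
rewrite (ge0_integral_tuple_cons mG G0).
rewrite (ge0_integral_tuple_cons mGs (fun t => G0 (tuple_shift h t))).
pose h' : 'cV[R]_n := \col_i h (lift ord0 i) 0%R.
have shE (x : T) u : tuple_shift h (tcons x u) =
    (tcons (x + h ord0 0)%R (tuple_shift h' u)).
  apply: eq_from_tnth => i; rewrite tnth_mktuple.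
  have [j ->|->] := unliftP ord0 i; rewrite ?tnth0 // !tnthS tnth_mktuple.
  by rewrite mxE.
have mGx x : measurable_fun setT (fun u : n.-tuple T => G (tcons x u)).
  apply: (measurableT_comp mG).
  by apply: measurable_cons; [exact: measurable_cst | exact: measurable_id].
transitivity (\int[mu]_x \int[@lebesgue_tuple R n]_u G (tcons (x + h ord0 0)%R u)).
  apply: eq_integral => x _; under eq_integral => u _ do rewrite /comp shE.
  exact: (IH h' (fun u => G (tcons (x + h ord0 0)%R u))).
apply: (@ge0_integral_shift R (h ord0 0%R)
  (fun x : T => \int[@lebesgue_tuple R n]_u G (tcons x u))).
  have mf : measurable_fun setT (fun u : T * n.-tuple T => G (tcons u.1 u.2)).
    by have := measurableT_comp mG (@measurable_tcons n); exact.
  exact: (@measurable_fun_fubini_tonelli_F _ _ _ _ _ (@lebesgue_tuple R n) _ mf (fun u => G0 _)).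
by move=> x; exact: integral_ge0.
Qed.

Definition cube n (c : 'cV[R]_n) (r : R) : set (n.-tuple T) :=
  [set t | forall i, (`|tnth t i - c i 0| <= r)%R].

Lemma measurable_cube n (c : 'cV[R]_n) r : measurable (cube c r).
Proof.
have -> : cube c r = \bigcap_(i in setT) [set t | (`|tnth t i - c i 0| <= r)%R].
  by apply/seteqP; split=> [t h i _|t h i]; exact: h.
apply: fin_bigcap_measurable; first exact: finite_finset.
move=> i _.
have -> : [set t : n.-tuple T | (`|tnth t i - c i 0| <= r)%R] =
    setT `&` (fun t => tnth t i) @^-1` `[(c i 0 - r)%R, (c i 0 + r)%R]%classic.
  by rewrite setTI; apply/seteqP; split=> t /=; rewrite in_itv /= ler_distl.
apply: measurable_tnth => //.
Qed.

Lemma lebesgue_tuple_cube n (c : 'cV[R]_n) r : (0 <= r)%R ->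
  @lebesgue_tuple R n (cube c r) = (((2 * r) ^+ n)%R)%:E.
Proof.
move=> r0; elim: n c => [|n IH] c.
  by rewrite expr0 /= diracE mem_set // => -[].
pose c' : 'cV[R]_n := \col_i c (lift ord0 i) 0%R.
rewrite /lebesgue_tuple -/(@lebesgue_tuple R n) /pushforward.
have -> : (fun u : T * n.-tuple T => (tcons u.1 u.2)) @^-1` cube c r =
    `[(c ord0 0 - r)%R, (c ord0 0 + r)%R]%classic `*` cube c' r.
  apply/seteqP; split=> -[x u] /=.
    move=> h; split; first by have := h ord0; rewrite tnth0 ler_distl in_itv.
    by move=> i; have := h (lift ord0 i); rewrite tnthS mxE.
  move=> [xr ur] i; have [j ->|->] := unliftP ord0 i.
    by rewrite tnthS; have := ur j; rewrite mxE.
  by move: xr; rewrite tnth0 ler_distl in_itv.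
have mI : mu `[(c ord0 0 - r)%R, (c ord0 0 + r)%R]%classic = (2 * r)%:E.
  rewrite lebesgue_measure_itv /= lte_fin ltrBlDr -addrA ltrDl.
  case: ifPn => [_|]; first by rewrite -EFinB; congr EFin; ring.
  rewrite -leNgt => r0'; have -> : r = 0%R by apply/eqP; rewrite eq_le r0 andbT; lra.
  by rewrite mulr0.
have E := @product_measure1E _ _ _ _ _ mu (@lebesgue_tuple R n) _ _
  (measurable_itv `[(c ord0 0 - r)%R, (c ord0 0 + r)%R]) (measurable_cube c' r).
by rewrite [LHS]E exprS EFinM -mI -(IH c').
Qed.

End TupleMeasure.

Section BoundedSupport.
Context d (X : measurableType d) (R : realType) (mu : {measure set X -> \bar R}).
Implicit Types (f g : X -> R) (A : set X).

Lemma integrable_indic_lty A : measurable A -> (mu A < +oo)%E ->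
  mu.-integrable setT (EFin \o (\1_A : X -> R)).
Proof.
move=> mA Afin; apply/integrableP; split; first exact/measurable_EFinP.
rewrite (eq_integral (fun x => (\1_A x)%:E)); last first.
  by move=> t _ /=; rewrite ger0_norm.
by rewrite integral_indic // setIT.
Qed.

(** For such functions integrability, Fubini's theorem and the bound by [C] times the measure of [A]
    hold without further hypotheses; weights and triangles put the integrands below into this
    class. *)
Definition bsupp f (C : R) A := [/\ measurable_fun setT f, measurable A,
  (mu A < +oo)%E, (forall x, `|f x| <= C) & forall x, ~ A x -> f x = 0].

Lemma bsupp_integrable f C A : bsupp f C A -> mu.-integrable setT (EFin \o f).
Proof.
move=> [mf mA Afin fC fA].
apply: (@le_integrable _ _ _ mu setT _ _ (fun x => (C * \1_A x)%:E)) => //.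
- exact/measurable_EFinP.
- move=> x _ /=; rewrite lee_fin indicE; have [xA|xA] := boolP (x \in A).
    by rewrite mulr1 (le_trans (fC x)) // ler_norm.
  by rewrite fA ?normr0 ?mulr0 ?normr0 // => Ax; rewrite mem_set in xA.
- apply: (@eq_integrable _ _ _ mu setT _ (cst C%:E \* (EFin \o \1_A))%E) => //.
  by apply: integrableZl => //; exact: integrable_indic_lty.
Qed.

Lemma bsupp_le f C A : bsupp f C A -> `|\int[mu]_x f x| <= C * fine (mu A).
Proof.
move=> bf; have [mf mA Afin fC fA] := bf.
have int_f := bsupp_integrable bf.
apply: le_trans (le_normr_Rintegral measurableT int_f) _.
have -> : C * fine (mu A) = \int[mu]_x (C * \1_A x).
  rewrite RintegralZl //; last exact: integrable_indic_lty.
  by rewrite /Rintegral integral_indic // setIT.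
apply: le_Rintegral => //.
- exact: (integrable_norm int_f).
- apply: (@eq_integrable _ _ _ mu setT _ (cst C%:E \* (EFin \o \1_A))%E) => //.
  by apply: integrableZl => //; exact: integrable_indic_lty.
- move=> x _; rewrite indicE; have [xA|xA] := boolP (x \in A).
    by rewrite mulr1.
  by rewrite fA ?normr0 ?mulr0 // => Ax; rewrite mem_set in xA.
Qed.

End BoundedSupport.

Section RealFubini.
Context d1 d2 (X : measurableType d1) (Y : measurableType d2) (R : realType).
Variables (m1 : {sigma_finite_measure set X -> \bar R})
  (m2 : {sigma_finite_measure set Y -> \bar R}).

Lemma Rintegral_fubini1 (f : X * Y -> R) :
  (m1 \x m2)%E.-integrable setT (EFin \o f) ->
  (forall x, m2.-integrable setT (EFin \o (fun y => f (x, y)))) ->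
  \int[m1]_x \int[m2]_y f (x, y) = \int[(m1 \x m2)%E]_z f z.
Proof.
move=> mf f1; rewrite /Rintegral -integral12_prod_meas1 //; congr fine.
apply: eq_integral => x _ /=; have fin := integrable_fin_num measurableT (f1 x).
by rewrite fineK.
Qed.

Lemma Rintegral_fubini (f : X * Y -> R) :
  (m1 \x m2)%E.-integrable setT (EFin \o f) ->
  (forall x, m2.-integrable setT (EFin \o (fun y => f (x, y)))) ->
  (forall y, m1.-integrable setT (EFin \o (fun x => f (x, y)))) ->
  \int[m1]_x \int[m2]_y f (x, y) = \int[m2]_y \int[m1]_x f (x, y).
Proof.
move=> mf f1 f2; rewrite Rintegral_fubini1 // /Rintegral -integral21_prod_meas1 //.
congr fine; apply: eq_integral => y _ /=.
by have fin := integrable_fin_num measurableT (f2 y); rewrite fineK.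
Qed.

Lemma Rintegral_fubini_integrable (f : X * Y -> R) :
  (m1 \x m2)%E.-integrable setT (EFin \o f) ->
  (forall x, m2.-integrable setT (EFin \o (fun y => f (x, y)))) ->
  m1.-integrable setT (EFin \o (fun x => \int[m2]_y f (x, y))).
Proof.
move=> mf f1; apply: (@eq_integrable _ _ _ m1 setT _ (fubini_F m2 (EFin \o f))) => //.
  by move=> x _; have fin := integrable_fin_num measurableT (f1 x); rewrite /= fineK.
exact: integrable_fubini_F.
Qed.

Lemma bsupp_prod (f : X * Y -> R) C A B : measurable_fun setT f ->
  measurable A -> measurable B -> (m1 A < +oo)%E -> (m2 B < +oo)%E ->
  (forall z, `|f z| <= C) -> (forall z, ~ (A z.1 /\ B z.2) -> f z = 0) ->
  [/\ bsupp (m1 \x m2)%E f C (A `*` B),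
    (forall x, bsupp m2 (fun y => f (x, y)) C B) &
    (forall y, bsupp m1 (fun x => f (x, y)) C A)].
Proof.
move=> mf mA mB Af Bf fC f0; split.
- split => //; first exact: measurableX.
  have E := product_measure1E m1 m2 mA mB.
  by rewrite [X in (X < _)%E]E lte_mul_pinfty // ge0_fin_numE.
- move=> x; split => //.
    exact: (measurableT_comp mf (measurable_pair1 x)).
  by move=> y By; apply: f0 => -[].
- move=> y; split => //.
    exact: (measurableT_comp mf (measurable_pair2 y)).
  by move=> x Ax; apply: f0 => -[].
Qed.

End RealFubini.

Section TupleShift.
Variable R : realType.
Local Notation T := (measurableTypeR R).

Lemma Rintegral_tuple_shift n (h : 'cV[R]_n) (f : n.-tuple T -> R) :
  measurable_fun setT f ->
  \int[@lebesgue_tuple R n]_t f (tuple_shift h t) = \int[@lebesgue_tuple R n]_t f t.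
Proof.
move=> mf; have mEf : measurable_fun setT (EFin \o f) by exact/measurable_EFinP.
rewrite /Rintegral; congr fine.
have P := ge0_integral_tuple_shift h (measurable_funepos mEf) (funepos_ge0 (EFin \o f)).
have N := ge0_integral_tuple_shift h (measurable_funeneg mEf) (funeneg_ge0 (EFin \o f)).
by rewrite integralE (integralE _ _ (fun x => (f x)%:E)) -[in RHS]P -[in RHS]N;
  congr (_ - _)%E; apply: eq_integral => t _; rewrite ?funeposE ?funenegE.
Qed.

Lemma Rintegral_opp (f : T -> R) : measurable_fun setT f ->
  \int[@lebesgue_measure R]_x f (- x) = \int[@lebesgue_measure R]_x f x.
Proof.
move=> mf; have mEf : measurable_fun setT (EFin \o f) by exact/measurable_EFinP.
rewrite /Rintegral; congr fine.
have P := ge0_integral_opp (measurable_funepos mEf) (funepos_ge0 (EFin \o f)).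
have N := ge0_integral_opp (measurable_funeneg mEf) (funeneg_ge0 (EFin \o f)).
by rewrite integralE (integralE _ _ (fun x => (f x)%:E)) -[in RHS]P -[in RHS]N;
  congr (_ - _)%E; apply: eq_integral => t _; rewrite ?funeposE ?funenegE.
Qed.

End TupleShift.

(** * Decay of the oscillatory integral *)

Section Differences.
Variables (R : realType) (n : nat).
Implicit Types (g f : 'cV[R]_n -> R) (a z : 'cV[R]_n).

Definition fdiff a g : 'cV[R]_n -> R := fun z => g (z + a) - g z.
Definition fdiffn N a g := iter N (fdiff a) g.

Lemma fdiffnS N a g : fdiffn N.+1 a g = fdiffn N a (fdiff a g).
Proof. by rewrite /fdiffn iterSr. Qed.

Lemma fdiffnD N a f g : fdiffn N a (fun z => f z + g z) = (fun z => fdiffn N a f z + fdiffn N a g z).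
Proof.
elim: N f g => [//|N IH] f g; rewrite !fdiffnS -IH; congr fdiffn.
by apply/funext => z; rewrite /fdiff; ring.
Qed.

Lemma fdiffn_shift N a b g : fdiffn N a (fun z => g (z + b)) = (fun z => fdiffn N a g (z + b)).
Proof.
elim: N g => [//|N IH] g; rewrite !fdiffnS -IH; congr fdiffn.
by apply/funext => z; rewrite /fdiff addrAC.
Qed.

(** The Leibniz rule for differences, [D(f g) = (D f) g(. + a) + f (D g)]; each application doubles
    the number of products, whence [2 ^+ N]. *)
Lemma fdiffn_mul N a (e C D : R) f g : 0 <= e ->
  (forall r z, (r <= N)%N -> `|fdiffn r a f z| <= C * e ^+ r) ->
  (forall r z, (r <= N)%N -> `|fdiffn r a g z| <= D * e ^+ r) ->
  forall z, `|fdiffn N a (fun z => f z * g z) z| <= 2 ^+ N * (C * D) * e ^+ N.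
Proof.
move=> e0; elim: N f g C D => [|N IH] f g C D fC gD z.
  have := fC 0%N z (leqnn _); have := gD 0%N z (leqnn _).
  rewrite /= !expr0 !mulr1 mul1r normrM => h1 h2.
  by apply: ler_pM.
rewrite fdiffnS.
have -> : fdiff a (fun z => f z * g z) =
    (fun z => fdiff a f z * (fun y => g (y + a)) z + f z * fdiff a g z).
  by apply/funext => y; rewrite /fdiff; ring.
rewrite fdiffnD; apply: le_trans (ler_normD _ _) _.
have h1 : `|fdiffn N a (fun z => fdiff a f z * (fun y => g (y + a)) z) z|
    <= 2 ^+ N * ((C * e) * D) * e ^+ N.
  apply: IH => r y rN; first by rewrite -fdiffnS (le_trans (fC _ _ _)) // exprS mulrA.
  by rewrite fdiffn_shift gD // leqW.
have h2 : `|fdiffn N a (fun z => f z * fdiff a g z) z| <= 2 ^+ N * (C * (D * e)) * e ^+ N.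
  apply: IH => r y rN; first by rewrite fC // leqW.
  by rewrite -fdiffnS (le_trans (gD _ _ _)) // exprS mulrA.
by apply: le_trans (lerD h1 h2) _; rewrite !exprS le_eqVlt; apply/orP; left; apply/eqP; ring.
Qed.

Lemma is_derive_shift g (l : R) a z (v : 'cV[R]_n) :
  is_derive (z + a) v g l -> is_derive z v (fun y => g (y + a)) l.
Proof.
move=> [dg Dg].
have E : (fun h : R => h^-1 *: (((fun y => g (y + a)) \o shift z) (h *: v) - g (z + a))) =
    (fun h : R => h^-1 *: ((g \o shift (z + a)) (h *: v) - g (z + a))).
  by apply/funext => h /=; rewrite addrA.
by split; rewrite /derivable /derive E.
Qed.

Lemma is_derive_fdiffn N g g' a (v : 'cV[R]_n) :
  (forall z, is_derive z v g (g' z)) ->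
  forall z, is_derive z v (fdiffn N a g) (fdiffn N a g' z).
Proof.
elim: N g g' => [//|N IH] g g' dg; rewrite !fdiffnS; apply: IH => z.
have d1 : is_derive z v (fun y => g (y + a)) (g' (z + a)) by exact: is_derive_shift.
exact: is_deriveB.
Qed.

Lemma is_derive_line g (l : R) z (v : 'cV[R]_n) (t : R) :
  is_derive (z + t *: v) v g l -> is_derive t (1 : R) (fun s : R => g (z + s *: v)) l.
Proof.
move=> [dg Dg].
have E : (fun h : R => h^-1 *: (((fun s : R => g (z + s *: v)) \o shift t) (h *: (1 : R)) - g (z + t *: v))) =
    (fun h : R => h^-1 *: ((g \o shift (z + t *: v)) (h *: v) - g (z + t *: v))).
  apply/funext => h /=; congr (_ *: (g _ - _)).
  by rewrite addrCA -scalerDl [h *: 1]mulr1.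
by split; rewrite /derivable /derive E.
Qed.

Lemma fdiff_bound g g' (v : 'cV[R]_n) (eta B : R) :
  (forall z, is_derive z v g (g' z)) -> (forall z, `|g' z| <= B) ->
  forall z, `|fdiff (eta *: v) g z| <= `|eta| * B.
Proof.
move=> dg gB z; pose ph s := g (z + s *: v).
have dph t : is_derive t (1 : R) ph (g' (z + t *: v)) by exact: is_derive_line.
have mvt x y : x < y -> `|ph y - ph x| <= (y - x) * B.
  move=> xy; have [|c _ ->] := @MVT R ph (fun t => g' (z + t *: v)) x y xy (fun t _ => dph t).
    by apply: derivable_within_continuous => t _; exact: ex_derive.
  by rewrite normrM mulrC [`|y - x|]gtr0_norm ?subr_gt0 // ler_wpM2l // subr_ge0 ltW.
have -> : fdiff (eta *: v) g z = ph eta - ph 0 by rewrite /ph scale0r addr0.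
have [e0|e0|->] := ltgtP eta 0.
- by rewrite distrC [`|eta|]ltr0_norm // -[- eta]add0r; exact: mvt.
- by have := mvt _ _ e0; rewrite subr0 [`|eta|]gtr0_norm.
- by rewrite subrr normr0 mul0r.
Qed.

(** Each difference is traded for one derivative, by the mean value theorem along direction [v];
    differences and derivatives commute. *)
Lemma fdiffn_bound (U : nat -> 'cV[R]_n -> R) (v : 'cV[R]_n) (eta B : R) :
  (forall r z, is_derive z v (U r) (U r.+1 z)) ->
  forall N r, (forall z, `|U (r + N)%N z| <= B) ->
  forall z, `|fdiffn N (eta *: v) (U r) z| <= B * `|eta| ^+ N.
Proof.
move=> dU; elim=> [|N IH] r UB z; first by have := UB z; rewrite addn0 expr0 mulr1.
have := @fdiff_bound (fdiffn N (eta *: v) (U r)) (fdiffn N (eta *: v) (U r.+1))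
  v eta (B * `|eta| ^+ N).
rewrite exprS mulrCA; apply; first exact: is_derive_fdiffn.
by apply: IH => y; rewrite addSnnS.
Qed.

End Differences.

Section CompactSupport.
Variables (R : realType) (n : nat).
Local Notation T := (measurableTypeR R).
Implicit Types (g f : 'cV[R]_n -> R) (a z : 'cV[R]_n).

Definition tcol (t : n.-tuple T) : 'cV[R]_n := \col_i tnth t i.

Definition ccs g (b C : R) := [/\ continuous g, forall z, `|g z| <= C &
  forall z, ~ (forall i, `|z i 0| <= b) -> g z = 0].

Definition Int g : R := \int[@lebesgue_tuple R n]_t g (tcol t).

Lemma measurable_tcol g : continuous g -> measurable_fun setT (g \o tcol).
Proof.
move=> gc; apply: (@measurable_continuous_comp _ _ _ _ (fun i t => tnth t i)) => //.
by move=> i; exact: measurable_tnth.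
Qed.

Lemma ccs_bsupp g b C : 0 <= b -> ccs g b C ->
  bsupp (@lebesgue_tuple R n) (g \o tcol) C (cube 0 b).
Proof.
move=> b0 [gc gC gb]; split.
- exact: measurable_tcol.
- exact: measurable_cube.
- by rewrite [X in (X < _)%E](lebesgue_tuple_cube 0 b0) ltry.
- by move=> t; exact: gC.
- move=> t tb; apply: gb => h; apply: tb => i.
  by have := h i; rewrite !mxE subr0.
Qed.

Lemma fine_cube (c : 'cV[R]_n) r : 0 <= r ->
  fine (@lebesgue_tuple R n (cube c r)) = (2 * r) ^+ n.
Proof. by move=> r0; rewrite lebesgue_tuple_cube. Qed.

Lemma ccs_integrable g b C : 0 <= b -> ccs g b C ->
  (@lebesgue_tuple R n).-integrable setT (EFin \o (g \o tcol)).
Proof. by move=> b0 gC; apply: bsupp_integrable (ccs_bsupp b0 gC). Qed.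

Lemma Int_le g b C : 0 <= b -> ccs g b C -> `|Int g| <= C * (2 * b) ^+ n.
Proof.
by move=> b0 gC; rewrite -(fine_cube 0 b0); exact: bsupp_le (ccs_bsupp b0 gC).
Qed.

Lemma continuous_cV_shift g a : continuous g -> continuous (fun z => g (z + a)).
Proof.
move=> gc z; apply: (@continuous_comp _ _ _ (fun z => z + a) g); last exact: gc.
exact: (cvgD cvg_id (cvg_cst a)).
Qed.

Lemma ccs_mul (h : 'cV[R]_n -> R) g b C : continuous h -> (forall z, `|h z| <= 1) -> ccs g b C ->
  ccs (fun z => h z * g z) b C.
Proof.
move=> hc h1 [gc gC gb]; split.
- by move=> z; exact: (cvgM (hc z) (gc z)).
- by move=> z; rewrite normrM -[C]mul1r ler_pM.
- by move=> z zb; rewrite gb ?mulr0.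
Qed.

Lemma ccs_shift g a b C e : (forall i, `|a i 0| <= e) -> ccs g b C ->
  ccs (fun z => g (z + a)) (b + e) C.
Proof.
move=> ae [gc gC gb]; split.
- exact: continuous_cV_shift.
- by move=> z; exact: gC.
- move=> z zb; apply: gb => h; apply: zb => i; have := h i; have := ae i.
  rewrite mxE => h1 h2; have -> : z i 0 = (z i 0 + a i 0) - a i 0 by ring.
  by rewrite (le_trans (ler_normB _ _)) // lerD.
Qed.

Lemma ccs_fdiff g a b C e : 0 <= e -> (forall i, `|a i 0| <= e) -> ccs g b C ->
  ccs (fdiff a g) (b + e) (2 * C).
Proof.
move=> e0 ae gC; have [sc sC sb] := ccs_shift ae gC; have [gc gC' gb] := gC.
split.
- by move=> z; exact: (cvgB (sc z) (gc z)).
- move=> z; rewrite /fdiff (le_trans (ler_normB _ _)) //.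
  by have := gC' z; have := sC z; lra.
- move=> z zb; rewrite /fdiff sb // gb ?subrr // => h; apply: zb => i.
  by rewrite (le_trans (h i)) // lerDl.
Qed.

Lemma ccs_fdiffn N g a b C e : 0 <= e -> (forall i, `|a i 0| <= e) -> ccs g b C ->
  ccs (fdiffn N a g) (b + N%:R * e) (2 ^+ N * C).
Proof.
move=> e0 ae; elim: N g b C => [|N IH] g b C gC; first by rewrite mul0r addr0 expr0 mul1r.
have := IH _ _ _ (ccs_fdiff e0 ae gC); rewrite fdiffnS exprS => h.
rewrite (_ : N.+1%:R = N%:R + 1 :> R); last by rewrite -addn1 natrD.
have -> : b + (N%:R + 1) * e = b + e + N%:R * e by ring.
by have -> : 2 * 2 ^+ N * C = 2 ^+ N * (2 * C) by ring.
Qed.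

Lemma tcol_shift a t : tcol (tuple_shift a t) = tcol t + a.
Proof. by apply/matrixP => i j; rewrite ord1 !mxE tnth_mktuple. Qed.

Lemma Int_shift g a : continuous g -> Int (fun z => g (z + a)) = Int g.
Proof.
move=> gc; rewrite -[RHS](Rintegral_tuple_shift a (measurable_tcol gc)).
by apply: eq_Rintegral => t _; rewrite /= tcol_shift.
Qed.

Lemma IntB g (h : 'cV[R]_n -> R) b C b' C' : 0 <= b -> 0 <= b' -> ccs g b C -> ccs h b' C' ->
  Int (fun z => g z - h z) = Int g - Int h.
Proof.
move=> b0 b0' gC hC.
by have := RintegralB measurableT (ccs_integrable b0 gC) (ccs_integrable b0' hC).
Qed.

Section Oscillation.
Variables (ph : 'cV[R]_n -> R) (a : 'cV[R]_n).
Hypotheses (phc : continuous ph) (pha : forall z, ph (z + a) = ph z + pi).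
Hypothesis (a1 : forall i, `|a i 0| <= 1).

Lemma continuous_cos_phase : continuous (fun z => cos (ph z)).
Proof. by move=> z; apply: continuous_comp; [exact: phc | exact: continuous_cos]. Qed.

Lemma Int_cos_fdiff g b C : 0 <= b -> ccs g b C ->
  Int (fun z => cos (ph z) * fdiff a g z) = - 2 * Int (fun z => cos (ph z) * g z).
Proof.
move=> b0 gC; have cc := continuous_cos_phase.
have c1 z : `|cos (ph z)| <= 1 := cos_max _.
pose G z := cos (ph z) * g z.
have GC : ccs G b C := ccs_mul cc c1 gC.
have nGC : ccs (fun z => - G z) b C.
  by have [Gc GC' Gb] := GC; split=> [z|z|z /Gb ->]; rewrite ?normrN ?oppr0 //; exact: (cvgN (Gc z)).
have GsC := ccs_shift a1 nGC.
have -> : (fun z => cos (ph z) * fdiff a g z) = (fun z => - G (z + a) - G z).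
  by apply/funext => z; rewrite /G /fdiff pha cosDpi; ring.
rewrite (IntB (b := b + 1) _ b0 GsC GC) ?addr_ge0 //.
rewrite (Int_shift (g := fun z => - G z)); last by have [] := nGC.
have -> : Int (fun z => - G z) = - Int G.
  have := IntB b0 b0 nGC GC.
  have -> : (fun z => - G z - G z) = (fun z => -2 * G z) by apply/funext => z; ring.
  rewrite [Int (fun z => -2 * _)](RintegralZl _ measurableT (ccs_integrable b0 GC)).
  rewrite -/(Int G); lra.
by rewrite /G; ring.
Qed.

(* Shifting by [a] changes the sign of the cosine, so differencing [g] once multiplies the
   integral by -2; this replaces integration by parts. *)
Lemma oscillatory_bound N g b C D : 0 <= b -> ccs g b C ->
  (forall z, `|fdiffn N a g z| <= D) ->
  `|Int (fun z => cos (ph z) * g z)| <= D * (2 * (b + N%:R)) ^+ n.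
Proof.
move=> b0 gC gD; have cc := continuous_cos_phase.
have c1 z : `|cos (ph z)| <= 1 := cos_max _.
have iterE k : Int (fun z => cos (ph z) * fdiffn k a g z) =
    (- 2) ^+ k * Int (fun z => cos (ph z) * g z).
  elim: k => [|k IH]; first by rewrite expr0 mul1r.
  have kC := ccs_fdiffn k ler01 a1 gC.
  rewrite /fdiffn iterS (Int_cos_fdiff _ kC) ?IH ?exprS; first by ring.
  by rewrite mulr1 addr_ge0.
have NC := ccs_fdiffn N ler01 a1 gC.
have ND : ccs (fdiffn N a g) (b + N%:R) D.
  by have [? _ ?] := NC; rewrite mulr1 in NC *; have [? _ ?] := NC; split.
have bN0 : 0 <= b + N%:R by rewrite addr_ge0.
have := Int_le bN0 (ccs_mul cc c1 ND); rewrite iterE normrM normrX normrN.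
apply: le_trans; rewrite ler_peMl // exprn_ege1 // ger0_norm //; lra.
Qed.

End Oscillation.

Section SquareFormula.
Variables (f w : 'cV[R]_n -> R) (b C : R).
Hypotheses (fc : continuous f) (b0 : 0 <= b) (wC : ccs w b C).

Let F (u : n.-tuple T * n.-tuple T) : R :=
  cos (f (tcol u.1 + tcol u.2) - f (tcol u.2)) * (w (tcol u.1 + tcol u.2) * w (tcol u.2)).

Let measurable_pair_comp g : continuous g ->
  measurable_fun setT (fun u : n.-tuple T * n.-tuple T => g (tcol u.2)).
Proof.
move=> gc; apply: (@measurable_continuous_comp _ _ _ _
  (fun i (u : n.-tuple T * n.-tuple T) => tnth u.2 i)) => // i.
exact: (measurableT_comp (@measurable_tnth _ T n i) measurable_snd).
Qed.

Let measurable_sum_comp g : continuous g ->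
  measurable_fun setT (fun u : n.-tuple T * n.-tuple T => g (tcol u.1 + tcol u.2)).
Proof.
move=> gc; have -> : (fun u : n.-tuple T * n.-tuple T => g (tcol u.1 + tcol u.2)) =
    (fun u => g (\col_i (tnth u.1 i + tnth u.2 i))).
  by apply/funext => u; congr g; apply/matrixP => i j; rewrite !mxE.
apply: (@measurable_continuous_comp _ _ _ _
  (fun i (u : n.-tuple T * n.-tuple T) => tnth u.1 i + tnth u.2 i)) => // i.
apply: measurable_funD.
  exact: (measurableT_comp (@measurable_tnth _ T n i) measurable_fst).
exact: (measurableT_comp (@measurable_tnth _ T n i) measurable_snd).
Qed.

Let measurable_F : measurable_fun setT F.
Proof.
have [wc _ _] := wC; apply: measurable_funM.
  apply: (measurableT_comp (continuous_measurable_fun (@continuous_cos R))).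
  by apply: measurable_funB; [exact: measurable_sum_comp | exact: measurable_pair_comp].
by apply: measurable_funM; [exact: measurable_sum_comp | exact: measurable_pair_comp].
Qed.

Let bsupp_F : [/\ bsupp (@lebesgue_tuple R n \x @lebesgue_tuple R n)%E F (C * C)
      (cube 0 (2 * b) `*` cube 0 b),
    (forall t, bsupp (@lebesgue_tuple R n) (fun u => F (t, u)) (C * C) (cube 0 b)) &
    (forall u, bsupp (@lebesgue_tuple R n) (fun t => F (t, u)) (C * C) (cube 0 (2 * b)))].
Proof.
have [wc wC' wb] := wC.
apply: bsupp_prod => //.
- exact: measurable_cube.
- exact: measurable_cube.
- by rewrite [X in (X < _)%E](lebesgue_tuple_cube 0 (mulr_ge0 (ler0n _ 2) b0)) ltry.
- by rewrite [X in (X < _)%E](lebesgue_tuple_cube 0 b0) ltry.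
- move=> u; rewrite /F normrM -[C * C]mul1r ler_pM ?cos_max // normrM.
  by rewrite ler_pM.
- move=> [t u] /= h; rewrite /F /=.
  have [ub|ub] := pselect (forall i, `|tcol u i 0| <= b); last by rewrite (wb (tcol u)) ?mulr0.
  have [tb|tb] := pselect (forall i, `|(tcol t + tcol u) i 0| <= b); last by rewrite (wb (_ + _)) ?mul0r ?mulr0.
  case: h; split=> i; last by have := ub i; rewrite !mxE subr0.
  have := ub i; have := tb i; rewrite !mxE subr0 => h1 h2.
  have -> : tnth t i = (tnth t i + tnth u i) - tnth u i :> R by ring.
  by rewrite (le_trans (ler_normB _ _)) // mulr_natl lerD.
Qed.

(** The left side is [|I|^2] for [I] the integral of [e^(i f) w]. Expand it as a double integral
    over [h + z] and [z] and exchange the order, which the compact support of [w] allows. The gain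
    is that [f (h + z) - f z] is affine in [z] when [f] is quadratic. *)
Lemma square_formula :
  Int (fun z => cos (f z) * w z) ^+ 2 + Int (fun z => sin (f z) * w z) ^+ 2 =
  Int (fun h => Int (fun z => cos (f (h + z) - f z) * (w (h + z) * w z))).
Proof.
have [wc wC' wb] := wC; have [bF bF1 bF2] := bsupp_F.
have cosc : continuous (fun z => cos (f z)).
  by move=> z; apply: continuous_comp; [exact: fc | exact: continuous_cos].
have sinc : continuous (fun z => sin (f z)).
  by move=> z; apply: continuous_comp; [exact: fc | exact: continuous_sin].
have cC : ccs (fun z => cos (f z) * w z) b C by apply: ccs_mul => // z; exact: cos_max.
have sC : ccs (fun z => sin (f z) * w z) b C by apply: ccs_mul => // z; exact: sin_max.
have := @Rintegral_fubini _ _ _ _ R (@lebesgue_tuple R n) (@lebesgue_tuple R n) F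
  (bsupp_integrable bF) (fun t => bsupp_integrable (bF1 t)) (fun u => bsupp_integrable (bF2 u)).
rewrite /Int => ->.
set Ic := \int[_]_t (cos (f (tcol t)) * _); set Is := \int[_]_t (sin (f (tcol t)) * _).
have ic := ccs_integrable b0 cC; have ibs := ccs_integrable b0 sC.
transitivity (\int[@lebesgue_tuple R n]_u (Ic * (cos (f (tcol u)) * w (tcol u))
    + Is * (sin (f (tcol u)) * w (tcol u)))).
  rewrite RintegralD //.
  - rewrite (RintegralZl _ measurableT ic) (RintegralZl _ measurableT ibs).
    by rewrite !expr2.
  - exact: (integrableZl measurableT Ic ic).
  - exact: (integrableZl measurableT Is ibs).
apply: eq_Rintegral => u _.
have sh g : continuous g -> \int[@lebesgue_tuple R n]_t g (tcol t + tcol u) =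
    \int[@lebesgue_tuple R n]_t g (tcol t).
  by move=> gc; exact: (Int_shift (tcol u) gc).
rewrite /F /= (sh (fun z => cos (f z - f (tcol u)) * (w z * w (tcol u)))); last first.
  move=> z; apply: (cvgM _ (cvgM (wc z) (cvg_cst (w (tcol u))))).
  apply: (@continuous_comp _ _ _ (fun z => f z - f (tcol u)) cos); last exact: continuous_cos.
  by apply: continuousB; [exact: fc | exact: cst_continuous].
transitivity (\int[@lebesgue_tuple R n]_t (cos (f (tcol u)) * w (tcol u) * (cos (f (tcol t)) * w (tcol t))
   + sin (f (tcol u)) * w (tcol u) * (sin (f (tcol t)) * w (tcol t)))).
  rewrite RintegralD //.
  - rewrite (RintegralZl _ measurableT ic) (RintegralZl _ measurableT ibs).
    by rewrite -/Ic -/Is; ring.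
  - exact: (integrableZl measurableT _ ic).
  - exact: (integrableZl measurableT _ ibs).
by apply: eq_Rintegral => t _; rewrite cosD sinN cosN; ring.
Qed.

(* Off a set [A] of differences [h] the linear phase [f (h + z) - f z] oscillates; on [A] the
   trivial bound is used. *)
Lemma square_bound (A : set (n.-tuple T)) (K1 K2 : R) : measurable A ->
  A `<=` cube 0 (2 * b) -> 0 <= K1 -> 0 <= K2 ->
  (forall t, A t -> `|Int (fun z => cos (f (tcol t + z) - f z) * (w (tcol t + z) * w z))| <= K1) ->
  (forall t, cube 0 (2 * b) t -> ~ A t ->
    `|Int (fun z => cos (f (tcol t + z) - f z) * (w (tcol t + z) * w z))| <= K2) ->
  Int (fun z => cos (f z) * w z) ^+ 2 + Int (fun z => sin (f z) * w z) ^+ 2 <=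
  K1 * fine (@lebesgue_tuple R n A) + K2 * (4 * b) ^+ n.
Proof.
move=> mA AB K10 K20 h1 h2; rewrite square_formula /Int; have [bF bF1 bF2] := bsupp_F.
have iF := Rintegral_fubini_integrable (bsupp_integrable bF) (fun t => bsupp_integrable (bF1 t)).
have b20 : 0 <= 2 * b by rewrite mulr_ge0.
have Bfin : (@lebesgue_tuple R n (cube 0 (2 * b)) < +oo)%E.
  by rewrite [X in (X < _)%E](lebesgue_tuple_cube 0 b20) ltry.
have mB := measurable_cube (0 : 'cV[R]_n) (2 * b).
have Afin : (@lebesgue_tuple R n A < +oo)%E.
  by apply: le_lt_trans Bfin; apply: le_measure; rewrite ?inE.
have iA := integrable_indic_lty mA Afin; have iB := integrable_indic_lty mB Bfin.
have iKA := integrableZl measurableT K1 iA; have iKB := integrableZl measurableT K2 iB.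
have -> : K1 * fine (@lebesgue_tuple R n A) + K2 * (4 * b) ^+ n =
    \int[@lebesgue_tuple R n]_t (K1 * \1_A t + K2 * \1_(cube 0 (2 * b)) t).
  rewrite RintegralD // (RintegralZl _ measurableT iA) (RintegralZl _ measurableT iB).
  rewrite /Rintegral !integral_indic // !setIT fine_cube //; congr (_ + _ * _ ^+ n); ring.
apply: le_Rintegral => //.
  exact: (integrableD measurableT iKA iKB).
move=> t _; apply: le_trans (ler_norm _) _.
rewrite !indicE; have [tA|tA] := boolP (t \in A).
  rewrite mulr1; apply: le_trans (h1 t _) _; first by rewrite inE in tA.
  by rewrite lerDl mulr_ge0.
rewrite mulr0 add0r; have [tB|tB] := boolP (t \in cube 0 (2 * b)).
  by rewrite mulr1 h2 //; [rewrite inE in tB | move=> At; rewrite mem_set in tA].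
rewrite mulr0 (@eq_Rintegral _ _ _ _ _ (cst 0)) => [|u _].
  by rewrite Rintegral_cst // mul0r normr0.
have [_ _ _ _ F0] := bF2 u.
by apply: F0 => tB'; rewrite mem_set in tB.
Qed.

End SquareFormula.
End CompactSupport.

Section MatrixBounds.
Variable R : realType.

Lemma horner_bound (p : {poly R}) (m : R) : `|m| <= 1 ->
  `|p.[m]| <= \sum_(i < size p) `|p`_i|.
Proof.
move=> m1; rewrite horner_coef; apply: le_trans (ler_norm_sum _ _ _) _.
by apply: ler_sum => i _; rewrite normrM normrX ler_piMr // exprn_ile1.
Qed.

Lemma det_bound n (M : 'M[R]_n) (E : R) : (forall i j, `|M i j| <= E) ->
  `|\det M| <= n`!%:R * E ^+ n.
Proof.
move=> ME; apply: le_trans (ler_norm_sum _ _ _) _.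
have -> : n`!%:R * E ^+ n = \sum_(s : 'S_n) E ^+ n.
  by rewrite sumr_const mulr_natl -card_Sn.
apply: ler_sum => s _; rewrite normrM normrX normrN1 expr1n mul1r normr_prod.
rewrite -[n in E ^+ n]card_ord -prodr_const; apply: ler_prod => i _.
by rewrite normr_ge0 ME.
Qed.

Lemma adj_bound n (M : 'M[R]_n) (E : R) i j : (forall i j, `|M i j| <= E) ->
  `|\adj M i j| <= (n.-1)`!%:R * E ^+ n.-1.
Proof.
move=> ME; rewrite mxE normrM normrX normrN1 expr1n mul1r.
by apply: det_bound => a b; rewrite !mxE.
Qed.

Lemma mulmx_bound n p q (M : 'M[R]_(n, p)) (N : 'M[R]_(p, q)) (E F : R) i j :
  (forall i j, `|M i j| <= E) -> (forall i j, `|N i j| <= F) ->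
  `|(M *m N) i j| <= p%:R * (E * F).
Proof.
move=> ME NF; rewrite mxE; apply: le_trans (ler_norm_sum _ _ _) _.
rewrite mulr_natl -[p in _ *+ p]card_ord -sumr_const; apply: ler_sum => k _.
by rewrite normrM ler_pM.
Qed.

End MatrixBounds.

(** * Vectors almost annihilated by a pencil member *)

Section Slab.
Variables (R : realType) (n : nat) (Q1 Q2 : 'M[int]_n).
Hypotheses (s1 : integral_form Q1) (s2 : integral_form Q2).
Hypotheses (hC : condition1 Q1 Q2) (n0 : (0 < n)%N).
Local Notation T := (measurableTypeR R).

Definition entry_bound : R := 1 + \sum_i \sum_j (`|(Q1 i j)%:~R| + `|(Q2 i j)%:~R|).

Lemma entry_bound_ge (i j : 'I_n) : `|(Q1 i j)%:~R| + `|(Q2 i j)%:~R| <= entry_bound - 1.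
Proof.
rewrite /entry_bound [leRHS]addrAC subrr add0r (bigD1 i) //= (bigD1 j) //= -addrA lerDl.
apply: addr_ge0; first by apply: sumr_ge0 => *; exact: addr_ge0.
by apply: sumr_ge0 => *; apply: sumr_ge0 => *; exact: addr_ge0.
Qed.

Lemma entry_bound_ge1 : 1 <= entry_bound.
Proof.
by rewrite lerDl; apply: sumr_ge0 => *; apply: sumr_ge0 => *; exact: addr_ge0.
Qed.

Lemma pencil_entry_bound (m : R) i j : `|m| <= 1 -> `|pencil Q1 Q2 1 m i j| <= entry_bound.
Proof.
move=> m1; rewrite !mxE mul1r; apply: le_trans (ler_normD _ _) _.
have := entry_bound_ge i j; rewrite normrM.
have : `|m| * `|(Q2 i j)%:~R| <= `|(Q2 i j)%:~R| :> R by rewrite ler_piMl.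
lra.
Qed.

(** The ideal identity bounds [|D|] by a constant times the largest adjugate entry, because the
    determinant is itself an entry of [M *m \adj M]. Taking the identity over real polynomials makes
    its coefficients bounded for [|m| <= 1], so the bound is uniform without a compactness
    argument. *)
Lemma pencil_adj_lower : exists2 c : R, 0 < c & forall m : R, `|m| <= 1 ->
  exists i j, c <= `|\adj (pencil Q1 Q2 1 m) i j|.
Proof.
have [D [e [D0 H]]] := condition1_ideal s1 s2 hC n0.
have [[a [b HX]] _] := H {poly R} 1 'X; rewrite expr1n mulr1 in HX.
pose Ka := \sum_(i < size a) `|a`_i|; pose Kb := \sum_(i < size b) `|b`_i|.
have Ka0 : 0 <= Ka by exact: sumr_ge0.
have Kb0 : 0 <= Kb by exact: sumr_ge0.
have E1 := entry_bound_ge1; set E := entry_bound in E1.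
pose N : R := n%:R.
have N0 : 0 <= N by exact: ler0n.
(* Chosen so that adjugate entries below [|D| / K] would give [|D| <= (K - 1) |D| / K]. *)
pose K := Ka * (N * E) + Kb * (N * (N * E)) + 1.
have K0 : 0 < K.
  by rewrite ltr_wpDl // addr_ge0 // !mulr_ge0 // (le_trans ler01).
exists (`|D%:~R| / K); first by rewrite divr_gt0 // normr_gt0 intr_eq0.
move=> m m1; pose M := pencil Q1 Q2 1 m.
apply: contrapT => /forallNP hn.
pose c := `|D%:~R : R| / K.
have adjc i j : `|\adj M i j| <= c.
  by have /forallNP/(_ j)/negP := hn i; rewrite -ltNge => /ltW.
have Mev : map_mx (horner_eval m) (pencil Q1 Q2 1 'X) = M.
  apply/matrixP => i j; rewrite !mxE /horner_eval !hornerE.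
  by rewrite -[(Q1 i j)%:~R](rmorph_int (@polyC R)) -[(Q2 i j)%:~R](rmorph_int (@polyC R)) !hornerC.
have ev : D%:~R = a.[m] * \det M + b.[m] * \tr (\adj M *m map_mx intr Q2).
  have := congr1 (horner_eval m) HX; rewrite rmorph_int rmorphD !rmorphM /=.
  rewrite -det_map_mx Mev /horner_eval => ->; congr (_ + _ * _).
  rewrite -/(horner_eval m _) -trace_map_mx map_mxM map_mx_adj Mev; congr (\tr (_ *m _)).
  by apply/matrixP => k l; rewrite !mxE rmorph_int.
have c0 : 0 <= c by rewrite divr_ge0 // ltW.
have detb : `|\det M| <= N * E * c.
  pose i0 : 'I_n := Ordinal n0.
  have -> : \det M = (M *m \adj M) i0 i0 by rewrite mul_mx_adj mxE eqxx.
  rewrite -mulrA; apply: mulmx_bound => // i j; exact: pencil_entry_bound.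
have trb : `|\tr (\adj M *m map_mx intr Q2)| <= N * (N * E) * c.
  apply: le_trans (ler_norm_sum _ _ _) _.
  rewrite -mulrA /N mulr_natl -[n in _ *+ n]card_ord -sumr_const; apply: ler_sum => i _.
  rewrite -mulrA [E * c]mulrC; apply: mulmx_bound => // k l; rewrite mxE.
  by have := entry_bound_ge k l; rewrite -/E; have := normr_ge0 ((Q1 k l)%:~R : R); lra.
have : `|D%:~R : R| <= Ka * (N * E * c) + Kb * (N * (N * E) * c).
  rewrite ev; apply: le_trans (ler_normD _ _) _; rewrite !normrM.
  by apply: lerD; apply: ler_pM => //; exact: horner_bound.
have -> : Ka * (N * E * c) + Kb * (N * (N * E) * c) = (K - 1) * c by rewrite /K; ring.
have -> : `|D%:~R : R| = K * c by rewrite /c mulrC divfK // gt_eqF.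
have cp : 0 < c by rewrite divr_gt0 // normr_gt0 intr_eq0.
by rewrite mulrBl mul1r lerBrDr gerDl leNgt cp.
Qed.

(* One small coordinate and a small image under a nearly singular pencil member force a
   vector to be small: replace a row of the matrix by the coordinate form. *)
Lemma pencil_rigid : exists2 K : R, 1 <= K & forall m : R, `|m| <= 1 ->
  exists j : 'I_n, forall (x : 'cV[R]_n) (r : R), `|x j 0| <= r ->
    (forall i, `|(pencil Q1 Q2 1 m *m x) i 0| <= r) -> forall i, `|x i 0| <= K * r.
Proof.
have [c c0 cP] := pencil_adj_lower; have E1 := entry_bound_ge1.
pose F := (n.-1)`!%:R * entry_bound ^+ n.-1.
have F0 : 0 <= F by rewrite mulr_ge0 // exprn_ge0 // (le_trans ler01).
exists (n%:R * F / c + 1); first by rewrite lerDr divr_ge0 ?(ltW c0) // mulr_ge0.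
move=> m m1; have [j [l adjc]] := cP m m1; exists j => x r xr Mr i.
pose M := set_row_delta (pencil Q1 Q2 1 m) l j.
have ME a b : `|M a b| <= entry_bound.
  rewrite mxE; case: ifP => _; last exact: pencil_entry_bound.
  by case: (b == j); rewrite ?normr1 ?normr0 // (le_trans ler01).
have Mx a b : `|(M *m x) a b| <= r.
  by rewrite ord1 set_row_delta_mul; case: ifP.
have r0 : 0 <= r by apply: le_trans xr.
have /matrixP/(_ i 0) := mulmxA (\adj M) M x.
rewrite mul_adj_mx mul_scalar_mx [RHS]mxE det_set_row_delta => dx.
have : `|\adj (pencil Q1 Q2 1 m) j l * x i 0| <= n%:R * (F * r).
  by rewrite -dx; apply: mulmx_bound => // a b; exact: adj_bound.
rewrite normrM => h.
have : c * `|x i 0| <= n%:R * (F * r) by apply: le_trans h; rewrite ler_wpM2r.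
rewrite -ler_pdivlMl // => h2; apply: le_trans h2 _.
rewrite mulrDl mul1r (_ : c^-1 * _ = n%:R * F / c * r); last by ring.
by rewrite lerDl.
Qed.

Definition slab (B m r : R) : set (n.-tuple T) := cube 0 B `&`
  [set t | forall i, `|(pencil Q1 Q2 1 m *m tcol t) i 0| <= r].

Lemma measurable_slab B m r : measurable (slab B m r).
Proof.
apply: measurableI; first exact: measurable_cube.
have -> : [set t : n.-tuple T | forall i, `|(pencil Q1 Q2 1 m *m tcol t) i 0| <= r] =
    \bigcap_(i in setT) (setT `&` (fun t => (pencil Q1 Q2 1 m *m tcol t) i 0) @^-1` `[- r, r]%classic).
  apply/seteqP; split=> [t h i _|t h i].
    by split=> //=; rewrite in_itv /= -ler_norml; exact: h.
  by have [_] := h i Logic.I; rewrite /= in_itv /= -ler_norml.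
apply: fin_bigcap_measurable; first exact: finite_finset.
move=> i _.
have mf : measurable_fun setT (fun t : n.-tuple T => (pencil Q1 Q2 1 m *m tcol t) i 0).
  rewrite (_ : (fun _ => _) = (fun t : n.-tuple T => \sum_k pencil Q1 Q2 1 m i k * tnth t k)); last first.
    by apply/funext => t; rewrite mxE; apply: eq_bigr => k _; rewrite [tcol t _ _]mxE.
  apply: measurable_sum => k; apply: measurable_funM; first exact: measurable_cst.
  exact: measurable_tnth.
exact: mf.
Qed.

(** Coordinate [j] cuts the slab into [O(1 / r)] cells of width [r]. The difference of two points of
    one cell has small coordinate [j] and small image, so by rigidity each cell lies in a cube of
    side [O(r)], and the measure is [O(r^-1 r^n)]. *)
Lemma slab_measure (B : R) : 0 <= B -> exists2 C : R, 0 <= C & forall m r : R,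
  `|m| <= 1 -> 0 < r -> r <= 1 ->
  fine (@lebesgue_tuple R n (slab B m r)) <= C * r ^+ n.-1.
Proof.
move=> B0; have [K K1 KP] := pencil_rigid.
have K0 : 0 <= K := le_trans ler01 K1.
exists ((2 * B + 1) * (2 * (K * 2)) ^+ n); first by rewrite mulr_ge0 ?exprn_ge0 ?mulr_ge0 ?addr_ge0 ?mulr_ge0.
move=> m r m1 r0 r1; have [j jP] := KP m m1.
pose cell (t : n.-tuple T) := Num.truncn ((tnth t j + B) / r).
pose N := Num.truncn (2 * B / r).
have cellN t : slab B m r t -> (cell t < N.+1)%N.
  move=> [tB _]; rewrite ltnS; apply: le_truncn; rewrite ler_pM2r ?invr_gt0 //.
  by have := tB j; rewrite mxE subr0 ler_norml => /andP[_]; lra.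
have [c cP] : exists c : nat -> n.-tuple T, forall k, (exists2 t, slab B m r t & cell t = k) ->
    slab B m r (c k) /\ cell (c k) = k.
  apply: (ex_choice (P := fun k c => (exists2 t, slab B m r t & cell t = k) ->
    slab B m r c /\ cell c = k)) => k.
  have [[t tA tk]|h] := pselect (exists2 t, slab B m r t & cell t = k); first by exists t.
  by exists [tuple 0 | i < n] => /h.
have cover : slab B m r `<=` \big[setU/set0]_(k < N.+1) cube (tcol (c k)) (K * (2 * r)).
  move=> t tA; rewrite -(bigcup_mkord N.+1 (fun k => cube (tcol (c k)) (K * (2 * r)))); exists (cell t) => /=; first exact: cellN.
  have [cA cc] := cP (cell t) (ex_intro2 _ _ t tA erefl); move: (c _) cA cc => u uA uc i.
  have [tB tM] := tA; have [uB uM] := uA.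
  have : `|(tcol t - tcol u) i 0| <= K * (2 * r); last by rewrite !mxE.
  apply: jP.
    have f (v : n.-tuple T) : slab B m r v -> (cell v)%:R * r <= tnth v j + B < ((cell v).+1)%:R * r.
      move=> [vB _]; rewrite -ler_pdivlMr // -ltr_pdivrMr //; apply: truncn_itv.
      by apply: divr_ge0; last exact: ltW; have := vB j; rewrite mxE subr0 ler_norml => /andP[]; lra.
    have := f t tA; have := f u uA; rewrite uc -natr1 => /andP[h1 h2] /andP[h3 h4].
    by rewrite !mxE ler_norml; apply/andP; split; lra.
  have oppE (v : 'cV[R]_n) a : (- v) a 0 = - v a 0 by rewrite mxE.
  move=> a; rewrite mulmxBr addmx_entry oppE.
  by have := tM a; have := uM a; rewrite !ler_norml => /andP[? ?] /andP[? ?]; apply/andP; split; lra.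
have r2 : 0 <= K * (2 * r) by rewrite !mulr_ge0 // ltW.
have ub : (@lebesgue_tuple R n (slab B m r) <= (N.+1%:R * (2 * (K * (2 * r))) ^+ n)%:E)%E.
  apply: (@le_trans _ _ (@lebesgue_tuple R n (\big[setU/set0]_(k < N.+1) cube (tcol (c k)) (K * (2 * r))))).
    apply: le_measure; rewrite ?inE //; first exact: measurable_slab.
    by apply: bigsetU_measurable => k _; exact: measurable_cube.
  have mC k : (k < N.+1)%N -> measurable (cube (tcol (c k)) (K * (2 * r))) by move=> _; exact: measurable_cube.
  apply: le_trans (Boole_inequality (@lebesgue_tuple R n) mC) _.
  rewrite (eq_bigr (fun=> ((2 * (K * (2 * r))) ^+ n)%:E)) => [|k _]; last first.
    exact: lebesgue_tuple_cube.
  by rewrite sumEFin sumr_const card_ord -[X in (X%:E <= _)%E]mulr_natl.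
have slab_fin : (@lebesgue_tuple R n (slab B m r)) \is a fin_num.
  by rewrite ge0_fin_numE ?measure_ge0 // (le_lt_trans ub) // ltry.
rewrite -lee_fin fineK //; apply: le_trans ub _; rewrite lee_fin.
have -> : (2 * (K * (2 * r))) ^+ n = (2 * (K * 2)) ^+ n * (r * r ^+ n.-1).
  by rewrite -exprS prednK // -exprMn; congr (_ ^+ n); ring.
have NB : N.+1%:R * r <= 2 * B + 1.
  have NN : N%:R <= 2 * B / r by rewrite truncn_le divr_ge0 ?mulr_ge0 // ltW.
  rewrite -natr1 mulrDl mul1r lerD // -ler_pdivlMr //.
have p0 : 0 <= (2 * (K * 2)) ^+ n * r ^+ n.-1.
  by rewrite mulr_ge0 // exprn_ge0 ?mulr_ge0 // ltW.
by have := ler_wpM2r p0 NB; lra.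
Qed.

End Slab.

Section SmoothBounds.
Variables (R : realType) (n : nat) (w : 'cV[R]_n -> R).
Hypotheses (ws : smooth w) (wK : compactly_supported w).

Lemma iter_partial_out s z : ~ closure [set z | w z != 0] z -> iter_partial s w z = 0.
Proof.
elim: s z => [|j s IH] z zK /=.
  by have [//|wz] := eqVneq (w z) 0; case: zK; apply: subset_closure.
have near0 : \forall y \near z, iter_partial s w y = cst 0 y.
  have oK : open (~` closure [set z | w z != 0]) by apply: closed_openC; exact: closed_closure.
  by apply: filterS (open_nbhs_nbhs (conj oK zK)) => y /IH.
by rewrite (near_eq_derive _ near0) derive_cst.
Qed.

Lemma iter_partial_bounded s : exists2 C, 0 <= C & forall z, `|iter_partial s w z| <= C.
Proof.
have [sc _] := ws s.
have cK : compact (iter_partial s w @` closure [set z | w z != 0]).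
  by apply: continuous_compact => //; exact: continuous_subspaceT.
have [M [_ MP]] := compact_bounded cK.
have M1 : M < `|M| + 1 by rewrite (le_lt_trans (ler_norm _)) // ltrDl.
exists (`|M| + 1) => [|z]; first by rewrite addr_ge0.
have [zK|zK] := pselect (closure [set z | w z != 0] z).
  by apply: (MP _ M1); exists z.
by rewrite iter_partial_out // normr0 addr_ge0.
Qed.

Lemma smooth_ccs : exists2 b, 0 <= b & exists C, ccs w b C.
Proof.
have [M [_ MP]] := compact_bounded wK.
have M1 : M < `|M| + 1 by rewrite (le_lt_trans (ler_norm _)) // ltrDl.
exists (`|M| + 1) => [|]; first by rewrite addr_ge0.
have [C C0 CP] := iter_partial_bounded [::].
exists C; split=> //; first by have [] := ws [::].
move=> z zb; apply: (@iter_partial_out [::]) => zK; apply: zb => i.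
by apply: le_trans (cV_coord_le _ _) _; exact: (MP _ M1).
Qed.

Lemma fdiffn_smooth_bound N : exists2 D, 0 <= D & forall i (eta : R) r z, (r <= N)%N ->
  `|fdiffn r (eta *: delta_mx i 0) w z| <= D * `|eta| ^+ r.
Proof.
have [c cP] : exists c : seq 'I_n -> R, forall s, 0 <= c s /\ forall z, `|iter_partial s w z| <= c s.
  apply: (ex_choice (P := fun s c => 0 <= c /\ forall z, `|iter_partial s w z| <= c)) => s.
  by have [C] := iter_partial_bounded s; exists C.
pose D := \sum_(i < n) \sum_(r < N.+1) c (nseq r i).
exists D; first by apply: sumr_ge0 => i _; apply: sumr_ge0 => r _; case: (cP (nseq r i)).
move=> i eta r z rN.
have dU : forall r z, is_derive z (delta_mx i 0) (iter_partial (nseq r i) w) (iter_partial (nseq r.+1 i) w z).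
  move=> k y; have [_ dk] := ws (nseq k i); exact: derivableP.
apply: le_trans (@fdiffn_bound _ _ (fun k => iter_partial (nseq k i) w) _ _ (c (nseq r i)) dU r 0 _ z) _.
  by move=> y; rewrite add0n; case: (cP (nseq r i)).
rewrite ler_wpM2r ?exprn_ge0 // /D (bigD1 i) //= (bigD1 (Ordinal (rN : r < N.+1)%N)) //= -addrA lerDl.
apply: addr_ge0; first by apply: sumr_ge0 => k _; case: (cP (nseq k i)).
by apply: sumr_ge0 => k _; apply: sumr_ge0 => l _; case: (cP (nseq l k)).
Qed.

End SmoothBounds.

Section Phase.
Variables (R : realType) (n : nat).

Lemma qform_sum (A : comNzRingType) (Q : 'M[int]_n) (z : 'cV[A]_n) :
  qform Q z = \sum_j (\sum_i z i 0 * (Q i j)%:~R) * z j 0.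
Proof.
rewrite /qform mxE; apply: eq_bigr => j _; congr (_ * _).
by rewrite mxE; apply: eq_bigr => i _; rewrite !mxE.
Qed.

Lemma continuous_sum (S : topologicalType) I (r : seq I) (F : I -> S -> R) :
  (forall i, continuous (F i)) -> continuous (fun x => \sum_(i <- r) F i x).
Proof.
move=> Fc; elim: r => [|i r IH].
  have -> : (fun x => \sum_(i <- [::]) F i x) = cst 0 by apply/funext => x; rewrite big_nil.
  exact: cst_continuous.
have -> : (fun x => \sum_(j <- i :: r) F j x) = (fun x => F i x + \sum_(j <- r) F j x).
  by apply/funext => x; rewrite big_cons.
by move=> x; exact: (cvgD (Fc i x) (IH x)).
Qed.

Lemma continuous_qform (Q : 'M[int]_n) : continuous (fun z : 'cV[R]_n => qform Q z).
Proof.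
have -> : (fun z : 'cV[R]_n => qform Q z) = (fun z => \sum_j (\sum_i z i 0 * (Q i j)%:~R) * z j 0).
  by apply/funext => z; exact: qform_sum.
have cc (k : 'I_n) : continuous (fun y : 'cV[R]_n => y k 0) by exact: coord_continuous.
have c1 (j : 'I_n) : continuous (fun z : 'cV[R]_n => \sum_i z i 0 * (Q i j)%:~R).
  by apply: continuous_sum => i y; exact: (cvgM (cc i y) (cvg_cst _)).
by apply: continuous_sum => j z; exact: (cvgM (c1 j z) (cc j z)).
Qed.

Variables Q1 Q2 : 'M[int]_n.

Definition qphase (a b : R) (z : 'cV[R]_n) := 2 * pi * (a * qform Q1 z + b * qform Q2 z).

Lemma continuous_qphase a b : continuous (qphase a b).
Proof.
move=> z; have c1 := @continuous_qform Q1 z; have c2 := @continuous_qform Q2 z.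
exact: (cvgM (cvg_cst (2 * pi)) (cvgD (cvgM (cvg_cst a) c1) (cvgM (cvg_cst b) c2))).
Qed.

(** The differenced phase is affine in [z] with slope [4 pi] times the pencil member applied to [h];
    this links oscillation to the slab. *)
Lemma qphase_step (s1 : integral_form Q1) (s2 : integral_form Q2) a b (h z : 'cV[R]_n) i eta :
  qphase a b (h + (z + eta *: delta_mx i 0)) - qphase a b (z + eta *: delta_mx i 0) =
  qphase a b (h + z) - qphase a b z + 4 * pi * eta * (pencil Q1 Q2 a b *m h) i 0.
Proof.
rewrite /qphase !(qformD h) // !mulmxDr !addmx_entry.
pose d : 'cV[R]_n := delta_mx i 0.
have -> : (pencil Q1 Q2 a b *m h) i 0 = (h^T *m pencil Q1 Q2 a b *m d) 0 0.
  by rewrite -colE -[X in h^T *m X](pencil_sym s1 s2) -trmx_mul !mxE.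
rewrite -/d mulmxDr mulmxDl addmx_entry -!scalemxAr -!scalemxAl !scalemx_entry.
ring.
Qed.

End Phase.

Section Decay.
Variables (R : realType) (n : nat).
Implicit Types (Q : 'M[int]_n) (w : 'cV[R]_n -> R).

Lemma continuous_cV_shiftl (h : 'cV[R]_n) (g : 'cV[R]_n -> R) : continuous g -> continuous (fun z => g (h + z)).
Proof.
move=> gc; have -> : (fun z => g (h + z)) = (fun z => g (z + h)) by apply/funext => z; rewrite addrC.
exact: continuous_cV_shift.
Qed.

(* With [tau ^ 9 = |a|], the differences [h] with all [|(M h) i| <= tau] form a slab of measure
   [O((tau / |a|) ^ 9) = O(|a| ^ -8)], and elsewhere 72 differences gain [tau ^ -72]. *)
Lemma decay_chart Q1 Q2 w (s1 : integral_form Q1) (s2 : integral_form Q2)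
    (hC : condition1 Q1 Q2) (n10 : (10 <= n)%N) (ws : smooth w) (wK : compactly_supported w) :
  exists2 C, 0 <= C & forall a b : R, 1 <= `|a| -> `|b| <= `|a| ->
    Int (fun z => cos (qphase Q1 Q2 a b z) * w z) ^+ 2 +
    Int (fun z => sin (qphase Q1 Q2 a b z) * w z) ^+ 2 <= C * `|a| ^- 8.
Proof.
have n0 : (0 < n)%N by apply: leq_trans n10.
have [B B0 [C wC]] := smooth_ccs ws wK.
have [D D0 DP] := fdiffn_smooth_bound ws wK 72.
have B20 : 0 <= 2 * B by rewrite mulr_ge0.
have [C' C'0 C'P] := slab_measure s1 s2 hC n0 B20.
have [wc wC' wb] := wC.
have C0 : 0 <= C by apply: le_trans (wC' 0).
pose K1 := C * C * (2 * B) ^+ n.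
pose L := (2 * (B + 72%:R)) ^+ n.
have L0 : 0 <= L by rewrite exprn_ge0 // mulr_ge0 // addr_ge0.
have K10 : 0 <= K1 by apply: mulr_ge0; [exact: mulr_ge0 | exact: exprn_ge0].
have B4 : 0 <= (4 * B) ^+ n by apply: exprn_ge0; exact: mulr_ge0.
have D72 : 0 <= 2 ^+ 72 * (D * D) by apply: mulr_ge0; [exact: exprn_ge0 | exact: mulr_ge0].
exists (K1 * C' + 2 ^+ 72 * (D * D) * L * (4 * B) ^+ n).
  by apply: addr_ge0; [exact: mulr_ge0 | apply: mulr_ge0 => //; exact: mulr_ge0].
move=> a b a1 ba; set r0 := `|a| in a1 ba *.
(* From [n - 1 >= 9] the slab contributes [(tau / |a|)^9], and [tau^9 = |a|] is the largest
   threshold for which this is still [|a|^-8], the decay needed for an integral of size [|a|^-4]. *)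
pose tau := r0 `^ (9%:R^-1).
have tau9 : tau ^+ 9 = r0.
  by rewrite -powR_mulrn ?powR_ge0 // -powRrM mulVf ?powRr1 // (le_trans ler01).
have tau1 : 1 <= tau by rewrite -(powRr0 r0) ler_powR.
have tau0 : 0 < tau by rewrite (lt_le_trans ltr01).
have r00 : 0 < r0 by rewrite (lt_le_trans ltr01).
have a0 : a != 0 by rewrite -normr_gt0.
pose m := b / a.
have m1 : `|m| <= 1 by rewrite normrM normfV ler_pdivrMr // mul1r.
pose r := tau / r0.
have rE : r = tau ^- 8.
  rewrite /r -tau9 [tau ^+ 9]exprS invfM mulrA divff ?mul1r //; exact: lt0r_neq0.
have rp : 0 < r by rewrite divr_gt0.
have r1 : r <= 1 by rewrite rE invf_le1 ?exprn_gt0 // exprn_ege1.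
have fc := @continuous_qphase R n Q1 Q2 a b.
set f := qphase Q1 Q2 a b in fc *.
pose K2 := 2 ^+ 72 * (D * D) * tau^-1 ^+ 72 * L.
have Wc (h : 'cV[R]_n) : ccs (fun z => w (h + z) * w z) B (C * C).
  split=> [z|z|z zb]; last by rewrite (wb z) ?mulr0.
    exact: (cvgM (@continuous_cV_shiftl h w wc z) (wc z)).
  by rewrite normrM ler_pM.
have phc (h : 'cV[R]_n) : continuous (fun z => f (h + z) - f z).
  by move=> z; exact: (cvgB (@continuous_cV_shiftl h f fc z) (fc z)).
have K20 : 0 <= K2.
  by apply: mulr_ge0 => //; apply: mulr_ge0 => //; rewrite exprn_ge0 // invr_ge0 ltW.
have bound := square_bound fc B0 wC (measurable_slab Q1 Q2 (2 * B) m r)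
  (fun t => @proj1 _ _) K10 K20.
apply: le_trans (bound _ _) _ => {bound}.
- move=> t _; apply: Int_le => //; apply: ccs_mul (Wc (tcol t)).
    by move=> z; apply: continuous_comp; [exact: phc | exact: continuous_cos].
  by move=> z; exact: cos_max.
- move=> t tB tA.
  have [i ti] : exists i, r < `|(pencil Q1 Q2 1 m *m tcol t) i 0|.
    apply: contrapT => /forallNP h; apply: tA; split=> // i.
    by have /negP := h i; rewrite -leNgt.
  pose p := (pencil Q1 Q2 a b *m tcol t) i 0.
  have pE : p = a * (pencil Q1 Q2 1 m *m tcol t) i 0.
    rewrite -scalemx_entry scalemxAl /pencil scalerDr !scalerA mulr1 /m mulrCA divff ?mulr1 //.
  have tp : tau < `|p|.
    by rewrite pE normrM -/r0 mulrC -ltr_pdivrMr.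
  have p0 : p != 0 by rewrite -normr_gt0 (lt_trans tau0).
  (* The phase has slope [4 pi p] along coordinate [i], so a step [eta] moves it by [pi], half a
     period. *)
  pose eta := (4 * p)^-1.
  have eta_le : `|eta| <= tau^-1.
    rewrite normfV lef_pV2 ?posrE ?normr_gt0 ?mulf_neq0 //.
    by rewrite normrM ger0_norm //; move: tp; lra.
  have tauV1 : tau^-1 <= 1 by rewrite invf_le1.
  apply: (@oscillatory_bound R n (fun z => f (tcol t + z) - f z) (eta *: delta_mx i 0)
    (phc (tcol t)) _ _ 72 _ B (C * C) _ B0 (Wc (tcol t))).
  + move=> z; rewrite qphase_step // -/p /eta; congr (_ + _).
    by field.
  + move=> k; rewrite scalemx_entry mxE andbT normrM.
    by case: (k == i); rewrite ?normr1 ?normr0 ?mulr1 ?mulr0 // (le_trans eta_le).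
  + move=> z; apply: le_trans (@fdiffn_mul _ _ 72 _ `|eta| D D (fun z => w (tcol t + z)) w _ _ _ z) _ => //.
    * move=> k y k72; have -> : (fun z => w (tcol t + z)) = (fun z => w (z + tcol t)).
        by apply/funext => u; rewrite addrC.
      by rewrite fdiffn_shift; exact: DP.
    * by move=> k y k72; exact: DP.
    * apply: ler_wpM2l; first by rewrite !mulr_ge0 ?exprn_ge0.
      by rewrite lerXn2r // ?nnegrE ?invr_ge0 // ltW.
have t72 : tau^-1 ^+ 72 = r0 ^- 8 by rewrite exprVn -tau9 -exprM.
rewrite /K2 t72.
have r9 : r ^+ n.-1 <= r0 ^- 8.
  have -> : r0 ^- 8 = r ^+ 9 by rewrite rE -tau9 exprVn -!exprM.
  have n9 : (9 <= n.-1)%N by move: n10; clear; lia.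
  by apply: ler_wiXn2l => //; exact: ltW.
have h := C'P m r m1 rp r1.
have h1 : K1 * fine (@lebesgue_tuple R n (slab Q1 Q2 (2 * B) m r)) <= K1 * (C' * r0 ^- 8).
  by apply: ler_wpM2l => //; apply: le_trans h _; exact: ler_wpM2l.
by apply: le_trans (lerD h1 (lexx _)) _; rewrite le_eqVlt; apply/orP; left; apply/eqP; ring.
Qed.

End Decay.

Section Integrability.
Variables (R : realType) (n : nat).
Local Notation T := (measurableTypeR R).
Local Notation mu := (@lebesgue_measure R).

(** Outside the unit square, [decay_chart] for the forms in one of the two orders gives
    [I^2 = O(r^-8)], with [r] the larger of [|a|] and [|b|]. Since [(1 + a^2) (1 + b^2) <= 4 r^4]
    for [r >= 1], the exponent 8 is just what the integrable majorant needs. *)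
Lemma decay (Q1 Q2 : 'M[int]_n) (w : 'cV[R]_n -> R) (s1 : integral_form Q1) (s2 : integral_form Q2)
    (hC : condition1 Q1 Q2) (n10 : (10 <= n)%N) (ws : smooth w) (wK : compactly_supported w) :
  exists2 C, 0 <= C & forall a b : R,
    `|Int (fun z => cos (qphase Q1 Q2 a b z) * w z)| <= C * ((oneDsqr a)^-1 * (oneDsqr b)^-1) /\
    `|Int (fun z => sin (qphase Q1 Q2 a b z) * w z)| <= C * ((oneDsqr a)^-1 * (oneDsqr b)^-1).
Proof.
have [C1 C10 P1] := decay_chart s1 s2 hC n10 ws wK.
have [C2 C20 P2] := decay_chart s2 s1 (condition1C hC) n10 ws wK.
have [B B0 [C3 wC]] := smooth_ccs ws wK.
have C30 : 0 <= C3 by have [_ h _] := wC; apply: le_trans (h 0).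
have K0 : 0 <= C3 * (2 * B) ^+ n by rewrite mulr_ge0 ?exprn_ge0 ?mulr_ge0.
exists (4 * (1 + C1 + C2 + C3 * (2 * B) ^+ n)); first by rewrite mulr_ge0 ?addr_ge0.
move=> a b; rewrite /oneDsqr.
pose den := (1 + a ^+ 2) * (1 + b ^+ 2).
have a2 : 0 <= a ^+ 2 by exact: sqr_ge0.
have b2 : 0 <= b ^+ 2 by exact: sqr_ge0.
have den0 : 0 < den by rewrite mulr_gt0 // ltr_pwDl.
rewrite -invfM -/den !ler_pdivlMr //.
pose S := Int (fun z => cos (qphase Q1 Q2 a b z) * w z) ^+ 2 +
  Int (fun z => sin (qphase Q1 Q2 a b z) * w z) ^+ 2.
have [m1|m1] := ltP (Num.max `|a| `|b|) 1.
  have [al bl] : `|a| < 1 /\ `|b| < 1 by split; apply: le_lt_trans m1; rewrite le_max lexx ?orbT.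
  have den4 : den <= 4.
    have : a ^+ 2 <= 1 by rewrite -real_normK ?num_real // expr_le1 // ltW.
    have : b ^+ 2 <= 1 by rewrite -real_normK ?num_real // expr_le1 // ltW.
    by rewrite /den; nra.
  have trig (f : R -> R) : continuous f -> (forall x, `|f x| <= 1) ->
      `|Int (fun z => f (qphase Q1 Q2 a b z) * w z)| * den <= 4 * (1 + C1 + C2 + C3 * (2 * B) ^+ n).
    move=> fc f1.
    have : `|Int (fun z => f (qphase Q1 Q2 a b z) * w z)| <= C3 * (2 * B) ^+ n.
      apply: Int_le => //; apply: ccs_mul wC => // z.
      by apply: continuous_comp; [exact: continuous_qphase | exact: fc].
    set I := `|_|; set K := C3 * _ in K0 *.
    have I0 : 0 <= I by exact: normr_ge0.
    move=> IK; nra.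
  by split; [apply: (trig cos (@continuous_cos R)) => x; exact: cos_max
            |apply: (trig sin (@continuous_sin R)) => x; exact: sin_max].
pose r := Num.max `|a| `|b|; rewrite -/r in m1.
have Sr : S <= (C1 + C2) * r ^- 8.
  have r8 : 0 <= r ^- 8 by rewrite invr_ge0 exprn_ge0 // (le_trans ler01).
  have [ba|ab] := leP `|b| `|a|.
    have rE : r = `|a| by exact/max_idPl.
    have a1 : 1 <= `|a| by rewrite -rE.
    have := P1 a b a1 ba; rewrite -rE => h; apply: le_trans h _.
    by rewrite ler_wpM2r // lerDl.
  have rE : r = `|b| by apply/max_idPr; exact: ltW.
  have b1 : 1 <= `|b| by rewrite -rE.
  have := P2 b a b1 (ltW ab); rewrite -rE.
  have -> : qphase Q2 Q1 b a = qphase Q1 Q2 a b by apply/funext => z; rewrite /qphase addrC.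
  by move=> h; apply: le_trans h _; rewrite ler_wpM2r // lerDr.
have r0 : 0 < r by rewrite (lt_le_trans ltr01).
have r2 : 1 <= r ^+ 2 by rewrite exprn_ege1.
have denr : den <= 4 * r ^+ 4.
  have ar : a ^+ 2 <= r ^+ 2.
    by rewrite -[a ^+ 2]real_normK ?num_real // lerXn2r ?nnegrE ?(ltW r0) // le_max lexx.
  have br : b ^+ 2 <= r ^+ 2.
    by rewrite -[b ^+ 2]real_normK ?num_real // lerXn2r ?nnegrE ?(ltW r0) // le_max lexx orbT.
  have -> : 4 * r ^+ 4 = (2 * r ^+ 2) * (2 * r ^+ 2) by ring.
  by apply: ler_pM; rewrite ?addr_ge0 //; lra.
have fin I : I ^+ 2 <= S -> `|I| * den <= 4 * (1 + C1 + C2 + C3 * (2 * B) ^+ n).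
  move=> IS; have r4 : 0 < r ^+ 4 by rewrite exprn_gt0.
  have h : (`|I| * r ^+ 4) ^+ 2 <= (1 + C1 + C2) ^+ 2.
    apply: (@le_trans _ _ (C1 + C2)).
      rewrite exprMn real_normK ?num_real // -exprM -ler_pdivlMr ?exprn_gt0 //.
      exact: le_trans IS Sr.
    nra.
  have h2 : `|I| * r ^+ 4 <= 1 + C1 + C2.
    by move: h; rewrite ler_sqr ?nnegrE ?addr_ge0 // mulr_ge0 // ltW.
  have h3 : `|I| * den <= `|I| * (4 * r ^+ 4) by rewrite ler_wpM2l.
  lra.
by split; apply: fin; rewrite /S ?lerDl ?lerDr sqr_ge0.
Qed.

Lemma integrable_oneDsqr : mu.-integrable setT (fun x : T => (oneDsqr x)^-1%:E).
Proof.
have pos (x : R) : 0 <= (oneDsqr x)^-1 by rewrite invr_ge0 (le_trans ler01).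
have mf : measurable_fun setT (fun x : T => (oneDsqr x)^-1).
  exact: continuous_measurable_fun (@continuous_oneDsqrV R).
apply/integrableP; split; first exact/measurable_EFinP.
rewrite (eq_integral (fun x : T => (oneDsqr x)^-1%:E)); last first.
  by move=> x _ /=; rewrite ger0_norm.
rewrite ge0_symfun_integralT //; last by move=> x; rewrite /= /oneDsqr sqrrN.
  have -> : [set x : R | 0 <= x] = `[0, +oo[%classic by apply/seteqP; split=> x /=; rewrite in_itv /= andbT.
  by rewrite integral0y_oneDsqr -EFinM ltry.
exact: continuous_oneDsqrV.
Qed.

Lemma integrable_prod_oneDsqr : (mu \x mu)%E.-integrable setT
  (fun u : T * T => ((oneDsqr u.1)^-1 * (oneDsqr u.2)^-1)%:E).
Proof.
have pos (x : R) : 0 <= (oneDsqr x)^-1 by rewrite invr_ge0 (le_trans ler01).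
have mf : measurable_fun setT (fun x : T => (oneDsqr x)^-1).
  exact: continuous_measurable_fun (@continuous_oneDsqrV R).
have iO := integrable_oneDsqr.
have fin : (\int[mu]_x (oneDsqr x)^-1%:E)%E = (\int[mu]_x (oneDsqr x)^-1)%:E.
  by rewrite /Rintegral fineK // integrable_fin_num.
apply/integrable12ltyP.
  apply/measurable_EFinP; apply: measurable_funM.
    exact: (measurableT_comp mf measurable_fst).
  exact: (measurableT_comp mf measurable_snd).
under eq_integral => x _.
  under eq_integral => y _ do rewrite /= ger0_norm ?mulr_ge0 // EFinM.
  rewrite ge0_integralZl //; last exact/measurable_EFinP.
  rewrite fin.
  over.
rewrite ge0_integralZr //; last 2 first.
- exact/measurable_EFinP.
- by rewrite lee_fin; apply: Rintegral_ge0.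
by rewrite fin -EFinM ltry.
Qed.

End Integrability.

Section Oscillatory.
Variables (R : realType) (n : nat).
Local Notation T := (measurableTypeR R).
Local Notation mu := (@lebesgue_measure R).
Variables (Q1 Q2 : 'M[int]_n) (w : 'cV[R]_n -> R).
Variables (b C : R).
Hypotheses (b0 : 0 <= b) (wC : ccs w b C) (w0 : forall z, 0 <= w z).

Definition phase_integral (f : R -> R) (u : T * T) : R :=
  Int (fun z => f (qphase Q1 Q2 u.1 u.2 z) * w z).

Lemma Re_oscillatory_integral u : complex.Re (oscillatory_integral Q1 Q2 w u) = phase_integral cos u.
Proof.
rewrite /phase_integral /Int /oscillatory_integral /=.
by apply: eq_Rintegral => t _ /=; rewrite mulr0 subr0.
Qed.

Lemma Im_oscillatory_integral u : complex.Im (oscillatory_integral Q1 Q2 w u) = phase_integral sin u.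
Proof.
rewrite /phase_integral /Int /oscillatory_integral /=.
by apply: eq_Rintegral => t _ /=; rewrite mulr0 add0r.
Qed.

Lemma measurable_qphase : measurable_fun setT
  (fun u : (T * T) * n.-tuple T => qphase Q1 Q2 u.1.1 u.1.2 (tcol u.2)).
Proof.
have m1 : measurable_fun setT (fun u : (T * T) * n.-tuple T => u.1.1).
  exact: (measurableT_comp measurable_fst measurable_fst).
have m2 : measurable_fun setT (fun u : (T * T) * n.-tuple T => u.1.2).
  exact: (measurableT_comp measurable_snd measurable_fst).
have mq Q : measurable_fun setT (fun u : (T * T) * n.-tuple T => qform Q (tcol u.2)).
  exact: (measurableT_comp (measurable_tcol (@continuous_qform R n Q)) measurable_snd).
apply: measurable_funM; first exact: measurable_cst.
by apply: measurable_funD; apply: measurable_funM.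
Qed.

(** Tonelli's theorem gives measurability of a parameter integral with nonnegative integrand:
    integrate [(1 + f) w] instead and subtract the constant [Int w]. *)
Lemma measurable_phase_integral (f : R -> R) : continuous f -> (forall x, `|f x| <= 1) ->
  measurable_fun setT (phase_integral f).
Proof.
move=> fc f1; have [wc wC' wb] := wC.
have cphase u : continuous (fun z => f (qphase Q1 Q2 u.1 u.2 z)).
  by move=> z; apply: continuous_comp; [exact: continuous_qphase | exact: fc].
have fC u := ccs_mul (cphase u) (fun z => f1 (qphase Q1 Q2 u.1 u.2 z)) wC.
have ifw u := ccs_integrable b0 (fC u); have iw := ccs_integrable b0 wC.
pose F (u : (T * T) * n.-tuple T) :=
  ((1 + f (qphase Q1 Q2 u.1.1 u.1.2 (tcol u.2))) * w (tcol u.2))%:E.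
have mF : measurable_fun setT F.
  apply/measurable_EFinP; apply: measurable_funM.
    apply: measurable_funD; first exact: measurable_cst.
    exact: (measurableT_comp (continuous_measurable_fun fc) measurable_qphase).
  exact: (measurableT_comp (measurable_tcol wc) measurable_snd).
have F0 u : (0 <= F u)%E.
  rewrite lee_fin mulr_ge0 //; have := f1 (qphase Q1 Q2 u.1.1 u.1.2 (tcol u.2)).
  by rewrite ler_norml => /andP[]; lra.
have -> : phase_integral f = (fun u => fine (fubini_F (@lebesgue_tuple R n) F u) - Int w).
  apply/funext => u; rewrite /phase_integral /fubini_F /F /=.
  have -> : (fun y => ((1 + f (qphase Q1 Q2 u.1 u.2 (tcol y))) * w (tcol y))%:E) =
     (fun y => (w (tcol y) + f (qphase Q1 Q2 u.1 u.2 (tcol y)) * w (tcol y))%:E).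
    by apply/funext => y; rewrite mulrDl mul1r.
  have := RintegralD measurableT iw (ifw u); rewrite {1}/Rintegral => ->.
  by rewrite -/(Int w) addrAC subrr add0r.
apply: measurable_funB; last exact: measurable_cst.
have mG := measurable_fun_fubini_tonelli_F F mF F0.
have mfine : measurable_fun setT (@fine R) by exact: fine_measurable.
exact: (measurableT_comp mfine (mG (@lebesgue_tuple R n))).
Qed.

Lemma integrable_phase_integral (f : R -> R) K : continuous f -> (forall x, `|f x| <= 1) ->
  (forall u : T * T, `|phase_integral f u| <= K * ((oneDsqr u.1)^-1 * (oneDsqr u.2)^-1)) ->
  (mu \x mu)%E.-integrable setT (EFin \o phase_integral f).
Proof.
move=> fc f1 fK; have iP := integrableZl measurableT K (@integrable_prod_oneDsqr R).
apply: le_integrable iP => //.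
  by apply/measurable_EFinP; exact: measurable_phase_integral.
move=> u _ /=; rewrite lee_fin; apply: le_trans (fK u) _; exact: ler_norm.
Qed.

End Oscillatory.

(** * Positivity of the singular integral *)

Section Triangle.
Variables (R : realType) (L : R).
Hypothesis L0 : 0 < L.
Local Notation T := (measurableTypeR R).
Local Notation mu := (@lebesgue_measure R).

Definition triangle (x : R) : R := Num.max 0 (1 - `|x| / L).

Lemma triangle_ge0 x : 0 <= triangle x.
Proof. by rewrite le_max lexx. Qed.

Lemma triangle_le1 x : triangle x <= 1.
Proof. by rewrite ge_max ler01 lerBlDr lerDl divr_ge0 // ltW. Qed.

Lemma triangle_out x : L <= `|x| -> triangle x = 0.
Proof. by move=> h; apply/max_idPl; rewrite subr_le0 ler_pdivlMr // mul1r. Qed.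

Lemma triangle_in x : 0 <= x <= L -> triangle x = 1 - x / L.
Proof.
move=> /andP[x0 xL]; rewrite /triangle ger0_norm //; apply/max_idPr.
by rewrite subr_ge0 ler_pdivrMr // mul1r.
Qed.

Lemma triangleN x : triangle (- x) = triangle x.
Proof. by rewrite /triangle normrN. Qed.

Lemma continuous_triangle : continuous triangle.
Proof.
have c1 : continuous (fun x : R => 1 - `|x| / L).
  move=> x; apply: cvgB; first exact: cvg_cst.
  by apply: cvgM; [exact: norm_continuous | exact: cvg_cst].
move=> x; have c0 : {for x, continuous (fun=> 0 : R)} by exact: cst_continuous.
exact: (continuous_max c0 (c1 x)).
Qed.

Lemma triangle_bsupp (f : R -> R) : continuous f -> (forall x, `|f x| <= 1) ->
  bsupp mu (fun x : T => f x * triangle x) 1 `[- L, L]%classic.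
Proof.
move=> fc f1; split.
- by apply: continuous_measurable_fun => x; apply: cvgM; [exact: fc | exact: continuous_triangle].
- exact: measurable_itv.
- by rewrite [X in (X < _)%E](lebesgue_measure_itv `[- L, L]) /=; case: ifP => _; rewrite ?ltry // -EFinD ltry.
- move=> x; rewrite normrM mulr_ile1 // ger0_norm ?triangle_ge0 //; exact: triangle_le1.
- move=> x xL; rewrite triangle_out ?mulr0 // leNgt; apply/negP => h; apply: xL.
  by rewrite /= in_itv /= -ler_norml ltW.
Qed.

Lemma even_integral (g H h : R -> R) : (forall x, 0 <= g x) -> continuous g ->
  (forall x, g (- x) = g x) -> (forall x, L <= x -> g x = 0) ->
  (forall x, is_derive x (1 : R) H (h x)) -> (forall x, 0 <= x <= L -> g x = h x) ->
  \int[mu]_x g x = 2 * (H L - H 0).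
Proof.
move=> g0 gc gN gL dH gh; rewrite /Rintegral ge0_symfun_integralT //.
  rewrite [X in (_ * X)%E](_ : _ = \int[mu]_(x in `[0%R, L]) (g x)%:E)%E.
    rewrite (@continuous_FTC2 _ g H) //.
    - by apply: continuous_subspaceT.
    - split; first by move=> x _; exact: ex_derive.
        by apply: cvg_at_right_filter; apply: differentiable_continuous; apply/derivable1_diffP; exact: ex_derive.
      by apply: cvg_at_left_filter; apply: differentiable_continuous; apply/derivable1_diffP; exact: ex_derive.
    - move=> x; rewrite in_itv /= => /andP[x0 xL]; rewrite derive1E.
      by rewrite gh ?(ltW x0) ?(ltW xL) //; exact: derive_val.
  rewrite integral_mkcond [RHS]integral_mkcond; apply: eq_integral => x _.
  rewrite !patchE.
  have -> : (x \in [set x : R | 0 <= x]) = (0 <= x) by apply/idP/idP; rewrite inE.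
  have -> : (x \in `[0, L]%classic) = (0 <= x <= L) by apply/idP/idP; rewrite inE /= in_itv.
  by case: (leP 0 x) => //= x0; case: leP => // /ltW /gL ->.
by move=> x; rewrite /= gN.
Qed.

(** The Fourier transform of the triangle, that is, the Fejer kernel
    [L (sin (pi L s) / (pi L s))^2]; with height [L] and width of order [1 / L] it approximates a
    point mass at 0. *)
Definition fejer (s : R) : R := \int[mu]_(x in setT) (cos (2 * pi * s * x) * triangle x).

Let cosl_continuous (a : R) : continuous (fun x => cos (a * x)).
Proof.
move=> x; apply: (@continuous_comp _ _ _ (fun x => a * x) cos); last exact: continuous_cos.
by apply: cvgM; [exact: cvg_cst | exact: cvg_id].
Qed.

Let triangle_integrable : mu.-integrable setT (EFin \o triangle).
Proof.
have c1 : continuous (fun _ : R => 1 : R) by move=> x; exact: cst_continuous.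
have n1 (x : R) : `|1 : R| <= 1 by rewrite normr1.
have := bsupp_integrable (triangle_bsupp c1 n1).
by rewrite (_ : (fun x => 1 * triangle x) = triangle) //; apply/funext => x; rewrite mul1r.
Qed.

Let cos_triangle_integrable a : mu.-integrable setT (EFin \o (fun x : T => cos (a * x) * triangle x)).
Proof. by apply: bsupp_integrable (triangle_bsupp _ _); [exact: cosl_continuous | move=> x; exact: cos_max]. Qed.

Let is_derive_quadratic x : is_derive x (1 : R) (fun x => x - x ^+ 2 / (2 * L)) (1 - x / L).
Proof.
have d2 := is_deriveX 2 (is_derive_id x (1 : R)).
have d := is_deriveB (is_derive_id x (1 : R)) (is_deriveZ (2 * L)^-1 d2).
have -> : (fun x => x - x ^+ 2 / (2 * L)) = (id - (2 * L)^-1 \*: (id ^+ 2) : R -> R).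
  by apply/funext => y; rewrite /= [_ / _]mulrC.
apply: is_derive_eq d _.
rewrite /= expr1 /GRing.scale /=; field; exact: lt0r_neq0.
Qed.

Lemma triangle_integral : \int[mu]_x triangle x = L.
Proof.
rewrite (even_integral triangle_ge0 continuous_triangle triangleN _ is_derive_quadratic triangle_in).
  by field; exact: lt0r_neq0.
by move=> x Lx; rewrite triangle_out // (le_trans Lx) // ler_norm.
Qed.

Let is_derive_fejer a x : a != 0 -> is_derive x (1 : R)
  (fun x => (1 - x / L) * sin (a * x) / a - cos (a * x) / (L * a ^+ 2)) ((1 - x / L) * cos (a * x)).
Proof.
move=> a0; have L_neq0 : L != 0 by exact: lt0r_neq0.
have da : is_derive x (1 : R) (fun x => a * x) a.
  by apply: is_derive_eq (is_deriveZ a (is_derive_id x (1 : R))) _; rewrite /GRing.scale /= mulr1.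
have ds := is_derive1_comp (is_derive_sin (a * x)) da.
have dc := is_derive1_comp (is_derive_cos (a * x)) da.
have dl : is_derive x (1 : R) (fun x => 1 - x / L) (- L^-1).
  have -> : (fun x => 1 - x / L) = (cst 1 - L^-1 \*: id : R -> R).
    by apply/funext => y; rewrite /= [_ / _]mulrC.
  have dcst : is_derive x (1 : R) (cst (1 : R)) 0 by exact: is_derive_cst.
  have d := is_deriveB dcst (is_deriveZ L^-1 (is_derive_id x (1 : R))).
  by apply: is_derive_eq d _; rewrite /GRing.scale /= mulr1 sub0r.
have d := is_deriveB (is_deriveZ a^-1 (is_deriveM dl ds)) (is_deriveZ (L * a ^+ 2)^-1 dc).
have -> : (fun x => (1 - x / L) * sin (a * x) / a - cos (a * x) / (L * a ^+ 2)) =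
   (a^-1 \*: ((fun x => 1 - x / L) * (sin \o (fun x => a * x)))
     - (L * a ^+ 2)^-1 \*: (cos \o (fun x => a * x)) : R -> R).
  by apply/funext => y; rewrite /= [_ / a]mulrC [_ / (L * _)]mulrC.
apply: is_derive_eq d _; rewrite /GRing.scale /=; field.
by rewrite L_neq0 a0.
Qed.

Lemma fejer_ge0 s : 0 <= fejer s.
Proof.
rewrite /fejer; set a := 2 * pi * s; have [a0|a0] := eqVneq a 0.
  by apply: Rintegral_ge0 => x _; rewrite a0 mul0r cos0 mul1r triangle_ge0.
have cosm x : -1 <= cos (a * x) by have := cos_max (a * x); rewrite ler_norml => /andP[].
(* [even_integral] wants a nonnegative integrand, so the triangle, whose integral is [L], is added
   and subtracted again. The value comes out as [2 (1 - cos (a L)) / (L a^2)]. *)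
pose g x := (1 + cos (a * x)) * triangle x.
have gE : \int[mu]_x (cos (a * x) * triangle x) = \int[mu]_x g x - L.
  rewrite -triangle_integral -(RintegralB measurableT _ triangle_integrable).
    by apply: eq_Rintegral => x _; rewrite /g; ring.
  rewrite (_ : g = (fun x => triangle x + cos (a * x) * triangle x)); last first.
    by apply/funext => x; rewrite /g mulrDl mul1r.
  exact: (integrableD measurableT triangle_integrable (cos_triangle_integrable a)).
have dH x : is_derive x (1 : R) (fun x => (x - x ^+ 2 / (2 * L)) +
    ((1 - x / L) * sin (a * x) / a - cos (a * x) / (L * a ^+ 2)))
    ((1 - x / L) + (1 - x / L) * cos (a * x)).
  exact: (is_deriveD (is_derive_quadratic x) (is_derive_fejer x a0)).
rewrite gE (even_integral _ _ _ _ dH).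
- rewrite /= mulr0 sin0 cos0 divff ?lt0r_neq0 //.
  have -> : 2 * (L - L ^+ 2 / (2 * L) + ((1 - 1) * sin (a * L) / a - cos (a * L) / (L * a ^+ 2)) -
    (0 - 0 ^+ 2 / (2 * L) + ((1 - 0 / L) * 0 / a - 1 / (L * a ^+ 2)))) - L =
    2 / (L * a ^+ 2) * (1 - cos (a * L)) by field; rewrite a0 lt0r_neq0.
  have c0 : 0 <= 1 - cos (a * L).
    by rewrite subr_ge0; have := cos_max (a * L); rewrite ler_norml => /andP[].
  apply: mulr_ge0 => //; apply: divr_ge0 => //; apply: mulr_ge0; [exact: ltW | exact: sqr_ge0].
- by move=> x; rewrite mulr_ge0 ?triangle_ge0 //; have := cosm x; lra.
- move=> x; apply: cvgM; last exact: continuous_triangle.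
  by apply: cvgD; [exact: cvg_cst | exact: cosl_continuous].
- by move=> x; rewrite /g mulrN cosN triangleN.
- by move=> x Lx; rewrite /g triangle_out ?mulr0 // (le_trans Lx) // ler_norm.
- by move=> x xL; rewrite /g triangle_in //; ring.
Qed.

Lemma cos_ge_half (x : R) : `|x| <= pi / 4 -> 2^-1 <= cos x.
Proof.
rewrite ler_norml => /andP[h1 h2]; have p0 := pi_gt0 R.
have c2 : 0 <= cos (x *+ 2) by apply: cos_ge0_pihalf; rewrite [x *+ 2]mulr2n; apply/andP; split; lra.
have c1 : 0 <= cos x by apply: cos_ge0_pihalf; apply/andP; split; lra.
by rewrite cos_mulr2n in c2; nra.
Qed.

(** For [|x| <= L] the phase [2 pi s x] is at most [2 pi / 8 = pi / 4] in absolute value, where the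
    cosine is at least 1/2; this is the origin of the factor 8. *)
Lemma fejer_lower s : `|s| <= (8 * L)^-1 -> L / 2 <= fejer s.
Proof.
move=> sL; rewrite /fejer; set a := 2 * pi * s.
have -> : L / 2 = \int[mu]_x (2^-1 * triangle x).
  by rewrite (RintegralZl _ measurableT triangle_integrable) triangle_integral mulrC.
apply: le_Rintegral => //.
- exact: (integrableZl measurableT 2^-1 triangle_integrable).
move=> x _; have [Lx|Lx] := leP L `|x|; first by rewrite triangle_out // !mulr0.
apply: ler_wpM2r; first exact: triangle_ge0.
apply: cos_ge_half; rewrite /a !normrM (ger0_norm (pi_ge0 R)) ger0_norm //.
have : `|s| * `|x| <= 8^-1.
  have -> : 8^-1 = (8 * L)^-1 * L by field; exact: lt0r_neq0.
  by apply: ler_pM => //; exact: ltW.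
have := pi_gt0 R; nra.
Qed.

Lemma sin_triangle_integral (s : R) : \int[mu]_x (sin (2 * pi * s * x) * triangle x) = 0.
Proof.
set a := 2 * pi * s.
have sc : continuous (fun x => sin (a * x)).
  move=> x; apply: (@continuous_comp _ _ _ (fun x => a * x) sin); last exact: continuous_sin.
  by apply: cvgM; [exact: cvg_cst | exact: cvg_id].
have bs := triangle_bsupp sc (fun x => sin_max (a * x)).
have [mf _ _ _ _] := bs.
have odd : \int[mu]_x (sin (a * - x) * triangle (- x)) = -1 * \int[mu]_x (sin (a * x) * triangle x).
  rewrite -(RintegralZl _ measurableT (bsupp_integrable bs)).
  by apply: eq_Rintegral => x _; rewrite mulrN sinN triangleN; ring.
have := Rintegral_opp mf; rewrite odd; lra.
Qed.

End Triangle.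

Section PlaneMeasure.
Variable R : realType.
Local Notation T := (measurableTypeR R).
Local Notation mu := (@lebesgue_measure R).

Lemma itv_measure_lty (L : R) : (mu `[(- L)%R, L]%classic < +oo)%E.
Proof. by rewrite [X in (X < _)%E](lebesgue_measure_itv `[- L, L]) /=; case: ifP => _; rewrite ?ltry // -EFinD ltry. Qed.

Lemma sigma_finite_plane : sigma_finite setT (mu \x mu)%E.
Proof.
exists (fun m : nat => `[(- m%:R)%R, m%:R]%classic `*` `[(- m%:R)%R, m%:R]%classic).
  apply/seteqP; split=> // -[x y] _.
  exists (Num.truncn (Num.max `|x| `|y|)).+1 => //=.
  have h : Num.max `|x| `|y| < (Num.truncn (Num.max `|x| `|y|)).+1%:R := truncnS_gt _.
  by rewrite !in_itv /= -!ler_norml !ltW // (le_lt_trans _ h) // le_max lexx ?orbT.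
move=> m; have mI : measurable (`[(- m%:R)%R, m%:R]%classic : set T) by exact: measurable_itv.
split; first exact: measurableX.
by rewrite [X in (X < _)%E](product_measure1E mu mu mI mI) lte_mul_pinfty ?ge0_fin_numE ?itv_measure_lty.
Qed.

(* The product is packed by hand: for a product measure, canonical structure inference of
   sigma-finiteness only succeeds on finite factors. *)
Definition plane_measure : {sigma_finite_measure set (T * T)%type -> \bar R} :=
  HB.pack (mu \x mu)%E (Measure_isSigmaFinite.Build _ _ _ (mu \x mu)%E sigma_finite_plane).

End PlaneMeasure.

(** * The integral against two triangles *)

Section Regularized.
Variables (R : realType) (L : R).
Hypothesis L0 : 0 < L.
Local Notation T := (measurableTypeR R).
Local Notation mu := (@lebesgue_measure R).
Local Notation tri := (triangle L).

Definition triangle2 (u : T * T) : R := tri u.1 * tri u.2.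

Lemma triangle2_ge0 u : 0 <= triangle2 u.
Proof. by rewrite mulr_ge0 ?triangle_ge0. Qed.

Lemma triangle2_le1 u : triangle2 u <= 1.
Proof. by rewrite mulr_ile1 ?triangle_ge0 ?triangle_le1. Qed.

Lemma triangle2_out u : ~ (`[- L, L]%classic u.1 /\ `[- L, L]%classic u.2) -> triangle2 u = 0.
Proof.
have out x : ~ `[- L, L]%classic x -> tri x = 0.
  move=> xL; rewrite triangle_out // leNgt; apply/negP => h; apply: xL.
  by rewrite /= in_itv /= -ler_norml ltW.
move=> h; rewrite /triangle2; have [h1|/out ->] := pselect (`[- L, L]%classic u.1); last by rewrite mul0r.
by have [h2|/out ->] := pselect (`[- L, L]%classic u.2); [case: h | rewrite mulr0].
Qed.

Lemma measurable_triangle2 : measurable_fun setT triangle2.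
Proof.
have mt : measurable_fun setT (tri : T -> R) := continuous_measurable_fun (@continuous_triangle R L).
by apply: measurable_funM; [exact: (measurableT_comp mt measurable_fst) | exact: (measurableT_comp mt measurable_snd)].
Qed.

Lemma phase_bsupp (f : R -> R) (s1 s2 : R) : continuous f -> (forall x, `|f x| <= 1) ->
  let F (u : T * T) := f (2 * pi * (u.1 * s1 + u.2 * s2)) * triangle2 u in
  [/\ bsupp (mu \x mu)%E F 1 (`[- L, L] `*` `[- L, L])%classic,
    (forall x, bsupp mu (fun y => F (x, y)) 1 `[- L, L]%classic) &
    (forall y, bsupp mu (fun x => F (x, y)) 1 `[- L, L]%classic)].
Proof.
move=> fc f1 F; apply: bsupp_prod.
- apply: measurable_funM; last exact: measurable_triangle2.
  apply: (measurableT_comp (continuous_measurable_fun fc)).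
  apply: measurable_funM; first exact: measurable_cst.
  by apply: measurable_funD; apply: measurable_funM.
- exact: measurable_itv.
- exact: measurable_itv.
- exact: itv_measure_lty.
- exact: itv_measure_lty.
- by move=> u; rewrite /F normrM mulr_ile1 // ger0_norm ?triangle2_ge0 // triangle2_le1.
- by move=> u h; rewrite /F triangle2_out // mulr0.
Qed.

Let trig_integrable (f : R -> R) s : continuous f -> (forall x, `|f x| <= 1) ->
  mu.-integrable setT (EFin \o (fun x : T => f (2 * pi * s * x) * tri x)).
Proof.
move=> fc f1; apply: bsupp_integrable (triangle_bsupp L0 _ _) => [x|x]; last exact: f1.
apply: (@continuous_comp _ _ _ (fun x => 2 * pi * s * x) f); last exact: fc.
by apply: cvgM; [exact: cvg_cst | exact: cvg_id].
Qed.

Let cosI s := trig_integrable s (@continuous_cos R) (@cos_max R).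
Let sinI s := trig_integrable s (@continuous_sin R) (@sin_max R).

Let linear2 (g h : T -> R) (a b : R) : mu.-integrable setT (EFin \o g) -> mu.-integrable setT (EFin \o h) ->
  \int[mu]_x (a * g x + b * h x) = a * \int[mu]_x g x + b * \int[mu]_x h x.
Proof.
move=> ig ih; rewrite RintegralD //.
- by rewrite (RintegralZl a measurableT ig) (RintegralZl b measurableT ih).
- exact: (integrableZl measurableT a ig).
- exact: (integrableZl measurableT b ih).
Qed.

Lemma cos_triangle2_integral s1 s2 :
  \int[(mu \x mu)%E]_u (cos (2 * pi * (u.1 * s1 + u.2 * s2)) * triangle2 u) = fejer L s1 * fejer L s2.
Proof.
have [b1 b2 b3] := phase_bsupp s1 s2 (@continuous_cos R) (@cos_max R).
rewrite -(Rintegral_fubini1 (bsupp_integrable b1) (fun x => bsupp_integrable (b2 x))).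
transitivity (\int[mu]_x (fejer L s2 * (cos (2 * pi * s1 * x) * tri x))).
  apply: eq_Rintegral => x _.
  transitivity (\int[mu]_y ((cos (2 * pi * s1 * x) * tri x) * (cos (2 * pi * s2 * y) * tri y) +
     (- (sin (2 * pi * s1 * x) * tri x)) * (sin (2 * pi * s2 * y) * tri y))).
    apply: eq_Rintegral => y _; rewrite /triangle2 /=.
    have -> : 2 * pi * (x * s1 + y * s2) = 2 * pi * s1 * x + 2 * pi * s2 * y by ring.
    by rewrite cosD; ring.
  by rewrite linear2 // sin_triangle_integral // mulr0 addr0 mulrC.
by rewrite (RintegralZl _ measurableT (cosI s1)) mulrC.
Qed.

Lemma sin_triangle2_integral s1 s2 :
  \int[(mu \x mu)%E]_u (sin (2 * pi * (u.1 * s1 + u.2 * s2)) * triangle2 u) = 0.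
Proof.
have [b1 b2 b3] := phase_bsupp s1 s2 (@continuous_sin R) (@sin_max R).
rewrite -(Rintegral_fubini1 (bsupp_integrable b1) (fun x => bsupp_integrable (b2 x))).
transitivity (\int[mu]_x (fejer L s2 * (sin (2 * pi * s1 * x) * tri x))).
  apply: eq_Rintegral => x _.
  transitivity (\int[mu]_y ((sin (2 * pi * s1 * x) * tri x) * (cos (2 * pi * s2 * y) * tri y) +
     (cos (2 * pi * s1 * x) * tri x) * (sin (2 * pi * s2 * y) * tri y))).
    apply: eq_Rintegral => y _; rewrite /triangle2 /=.
    have -> : 2 * pi * (x * s1 + y * s2) = 2 * pi * s1 * x + 2 * pi * s2 * y by ring.
    by rewrite sinD; ring.
  by rewrite linear2 // sin_triangle_integral // mulr0 addr0 mulrC.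
by rewrite (RintegralZl _ measurableT (sinI s1)) sin_triangle_integral // mulr0.
Qed.

Section Weighted.
Variables (n : nat) (Q1 Q2 : 'M[int]_n) (w : 'cV[R]_n -> R) (b C : R).
Hypotheses (b0 : 0 <= b) (wC : ccs w b C).

(** The triangles confine [u] to a square and [w] confines [z] to a cube, so the integrand is
    bounded with bounded support and the integrations commute. *)
Lemma regularized_fubini (f : R -> R) : continuous f -> (forall x, `|f x| <= 1) ->
  \int[(mu \x mu)%E]_u (phase_integral Q1 Q2 w f u * triangle2 u) =
  Int (fun z => w z * \int[(mu \x mu)%E]_u
    (f (2 * pi * (u.1 * qform Q1 z + u.2 * qform Q2 z)) * triangle2 u)).
Proof.
move=> fc f1; have [wc wC' wb] := wC.
pose F (v : (T * T) * n.-tuple T) :=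
  f (qphase Q1 Q2 v.1.1 v.1.2 (tcol v.2)) * w (tcol v.2) * triangle2 v.1.
(* The slopes 0 are placeholders: this only supplies that the square is measurable of finite
   measure. *)
have [bs _ _] := phase_bsupp 0 0 fc f1.
have [_ mA Afin _ _] := bs.
have mF : measurable_fun setT F.
  apply: measurable_funM; last exact: (measurableT_comp measurable_triangle2 measurable_fst).
  apply: measurable_funM; last exact: (measurableT_comp (measurable_tcol wc) measurable_snd).
  exact: (measurableT_comp (continuous_measurable_fun fc) (@measurable_qphase R n Q1 Q2)).
have Bfin : (@lebesgue_tuple R n (cube 0 b) < +oo)%E.
  by rewrite [X in (X < _)%E](lebesgue_tuple_cube 0 b0) ltry.
have FC v : `|F v| <= C.
  rewrite /F -[C]mulr1 normrM; apply: ler_pM => //; last first.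
    by rewrite ger0_norm ?triangle2_ge0 // triangle2_le1.
  by rewrite normrM -[C]mul1r ler_pM.
have F0 v : ~ ((`[- L, L] `*` `[- L, L])%classic v.1 /\ cube 0 b v.2) -> F v = 0.
  move=> h; rewrite /F; have [h1|/triangle2_out ->] := pselect (`[- L, L]%classic v.1.1 /\ `[- L, L]%classic v.1.2); last by rewrite mulr0.
  rewrite wb ?mulr0 ?mul0r // => h2; apply: h; split=> [//|i].
  by have := h2 i; rewrite !mxE subr0.
have [bF b1 b2] := @bsupp_prod _ _ _ _ R (plane_measure R) (@lebesgue_tuple R n) F C _ _ mF mA
  (measurable_cube 0 b) Afin Bfin FC F0.
have := Rintegral_fubini (bsupp_integrable bF) (fun x => bsupp_integrable (b1 x)) (fun y => bsupp_integrable (b2 y)).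
have cphase u : continuous (fun z => f (qphase Q1 Q2 u.1 u.2 z)).
  by move=> z; apply: continuous_comp; [exact: continuous_qphase | exact: fc].
have fC u := ccs_mul (cphase u) (fun z => f1 (qphase Q1 Q2 u.1 u.2 z)) wC.
move=> E; transitivity (\int[(mu \x mu)%E]_u \int[@lebesgue_tuple R n]_t F (u, t)).
  apply: eq_Rintegral => u _; rewrite /F /= [LHS]mulrC /phase_integral /Int.
  rewrite -(RintegralZl (triangle2 u) measurableT (ccs_integrable b0 (fC u))).
  by apply: eq_Rintegral => t _ /=; rewrite mulrC.
rewrite E /Int; apply: eq_Rintegral => t _; rewrite /F /=.
have [bt _ _] := phase_bsupp (qform Q1 (tcol t)) (qform Q2 (tcol t)) fc f1.
rewrite -(RintegralZl (w (tcol t)) measurableT (bsupp_integrable bt)).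
by apply: eq_Rintegral => u _ /=; rewrite /qphase; ring.
Qed.

Lemma regularized_cos :
  \int[(mu \x mu)%E]_u (phase_integral Q1 Q2 w cos u * triangle2 u) =
  Int (fun z => w z * (fejer L (qform Q1 z) * fejer L (qform Q2 z))).
Proof.
rewrite (regularized_fubini (@continuous_cos R) (@cos_max R)) /Int.
by apply: eq_Rintegral => t _; rewrite cos_triangle2_integral.
Qed.

Lemma regularized_sin :
  \int[(mu \x mu)%E]_u (phase_integral Q1 Q2 w sin u * triangle2 u) = 0.
Proof.
rewrite (regularized_fubini (@continuous_sin R) (@sin_max R)) /Int.
rewrite (@eq_Rintegral _ _ _ _ _ (cst 0)) => [|t _].
  by rewrite Rintegral_cst // mul0r.
by rewrite sin_triangle2_integral mulr0.
Qed.

End Weighted.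
End Regularized.

(** * Newton's method over the reals *)

Section RealNewton.
Variables (R : realType) (n : nat) (Q1 Q2 : 'M[int]_n).
Hypotheses (s1 : integral_form Q1) (s2 : integral_form Q2).
Implicit Types (Q : 'M[int]_n) (x y z : 'cV[R]_n).
Let E : R := entry_bound R Q1 Q2.
Let A : R := n%:R * E + n%:R * (n%:R * E).
Let entry_le Q := forall i j, `|(Q i j)%:~R| <= E.

Let E0 : 0 <= E. Proof. exact: le_trans ler01 (entry_bound_ge1 R Q1 Q2). Qed.
Let A0 : 0 <= A. Proof. by rewrite addr_ge0 ?mulr_ge0. Qed.

Let entry1 : entry_le Q1.
Proof.
move=> i j; have := entry_bound_ge R Q1 Q2 i j; rewrite -/E.
by have := normr_ge0 ((Q2 i j)%:~R : R); lra.
Qed.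

Let entry2 : entry_le Q2.
Proof.
move=> i j; have := entry_bound_ge R Q1 Q2 i j; rewrite -/E.
by have := normr_ge0 ((Q1 i j)%:~R : R); lra.
Qed.

Let image_bound Q x i : entry_le Q -> `|(map_mx intr Q *m x) i 0| <= A * `|x|.
Proof.
move=> QE; apply: (@le_trans _ _ (n%:R * (E * `|x|))).
  by apply: mulmx_bound => a b; rewrite ?mxE // ord1 cV_coord_le.
by rewrite mulrA ler_wpM2r // lerDl !mulr_ge0.
Qed.

Let bilinear_bound Q x y : entry_le Q ->
  `|(x^T *m map_mx intr Q *m y) 0 0| <= A * (`|x| * `|y|).
Proof.
move=> QE; apply: (@le_trans _ _ (n%:R * ((n%:R * (`|x| * E)) * `|y|))).
  apply: mulmx_bound => a b; last by rewrite ord1 cV_coord_le.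
  by apply: mulmx_bound => c d; rewrite mxE ?QE // ord1 cV_coord_le.
rewrite (_ : n%:R * (n%:R * (`|x| * E) * `|y|) = (n%:R * (n%:R * E)) * (`|x| * `|y|)); last by ring.
by rewrite ler_wpM2r ?mulr_ge0 // lerDr mulr_ge0.
Qed.

Let qform_lip Q x y : integral_form Q -> entry_le Q ->
  `|qform Q (x + y) - qform Q x| <= A * (2 * `|x| * `|y| + `|y| ^+ 2).
Proof.
move=> Qs QE; rewrite qformD //.
have -> : qform Q x + 2 * (x^T *m map_mx intr Q *m y) 0 0 + qform Q y - qform Q x =
  2 * (x^T *m map_mx intr Q *m y) 0 0 + qform Q y by ring.
apply: le_trans (ler_normD _ _) _; rewrite normrM ger0_norm // mulrDr.
apply: lerD; last by rewrite expr2; exact: bilinear_bound.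
by have := bilinear_bound x y QE; lra.
Qed.

Section Step.
Variables (i j : 'I_n) (m0 B : R).
Hypotheses (m00 : 0 < m0) (B0 : 0 <= B).
Let D := 4 * A * B / (2 * m0).
Let K := 1 + D + A * D ^+ 2.

Let D0 : 0 <= D. Proof. by rewrite divr_ge0 ?mulr_ge0 // ltW. Qed.
Let K1 : 1 <= K. Proof. by rewrite /K -addrA lerDl addr_ge0 // mulr_ge0 ?sqr_ge0. Qed.

(** The expansion along [newton_dir] is exact. With [t = - 1 / (2 G)] and the current values of the
    forms as weights, the linear terms cancel both values, and the remainder [t^2 Q(d)] is quadratic
    in [s] because [d] is linear in those values. *)
Lemma newton_step z s : `|z| <= B -> m0 <= `|grad_minor Q1 Q2 z i j| ->
  `|qform Q1 z| <= s -> `|qform Q2 z| <= s -> exists z',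
  [/\ forall l, l != i -> l != j -> z' l 0 = z l 0, `|z' - z| <= K * s,
    `|qform Q1 z'| <= K * s ^+ 2 & `|qform Q2 z'| <= K * s ^+ 2].
Proof.
move=> zB mz q1 q2; set G := grad_minor _ _ _ _ _ in mz.
have G0 : G != 0 by rewrite -normr_gt0 (lt_le_trans m00).
have s0 : 0 <= s by apply: le_trans q1.
set d := newton_dir Q1 Q2 i j z (qform Q1 z) (qform Q2 z).
pose t := - (2 * G)^-1.
have tle : `|t| <= (2 * m0)^-1.
  rewrite normrN normfV lef_pV2 ?posrE ?normr_gt0 ?mulf_neq0 ?mulr_gt0 //.
  by rewrite normrM ger0_norm // ler_pM2l.
have dle : `|d| <= 4 * A * B * s.
  have r0 : 0 <= 4 * A * B * s by rewrite !mulr_ge0.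
  have img Q a : entry_le Q -> `|(map_mx intr Q *m z) a 0| <= A * B.
    by move=> QE; apply: le_trans (image_bound z a QE) _; exact: ler_wpM2l.
  have pr (a b c e : R) : `|a| <= s -> `|b| <= A * B -> `|c| <= s -> `|e| <= A * B ->
      `|a * b - c * e| <= 2 * (A * B * s).
    move=> ha hb hc he; apply: le_trans (ler_normB _ _) _; rewrite !normrM.
    have := ler_pM (normr_ge0 a) (normr_ge0 b) ha hb.
    have := ler_pM (normr_ge0 c) (normr_ge0 e) hc he; lra.
  have de (c : R) (k l : 'I_n) : `|(c *: delta_mx k 0 : 'cV[R]_n) l 0| <= `|c|.
    rewrite scalemx_entry mxE andbT normrM; case: (l == k); rewrite ?normr1 ?normr0 ?mulr1 ?mulr0 //.
  apply: cV_norm_le => // l; rewrite /d /newton_dir addmx_entry.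
  apply: le_trans (ler_normD _ _) _.
  have h1 := pr _ _ _ _ q1 (img Q2 j entry2) q2 (img Q1 j entry1).
  have h2 := pr _ _ _ _ q2 (img Q1 i entry1) q1 (img Q2 i entry2).
  have := le_trans (de _ i l) h1; have := le_trans (de _ j l) h2; lra.
have tdle : `|t *: d| <= D * s.
  rewrite normrZ; have := ler_pM (normr_ge0 _) (normr_ge0 _) tle dle.
  by rewrite (_ : (2 * m0)^-1 * (4 * A * B * s) = D * s) // /D; ring.
have qtd Q : entry_le Q -> `|qform Q (t *: d)| <= K * s ^+ 2.
  move=> QE; apply: le_trans (bilinear_bound _ _ QE) _.
  have h : `|t *: d| * `|t *: d| <= (D * s) * (D * s) by exact: ler_pM.
  apply: le_trans (ler_wpM2l A0 h) _.
  rewrite (_ : A * (D * s * (D * s)) = (A * D ^+ 2) * s ^+ 2); last by ring.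
  by rewrite ler_wpM2r ?sqr_ge0 // lerDr addr_ge0.
have [e1 e2] := qform_newton s1 s2 i j z t (qform Q1 z) (qform Q2 z).
have tG (q : R) : q + 2 * t * q * G = 0 by rewrite /t; field.
exists (z + t *: d); split.
- by move=> l li lj; rewrite addmx_entry scalemx_entry newton_dir_out // mulr0 addr0.
- rewrite addrAC subrr add0r; apply: le_trans tdle _.
  by rewrite ler_wpM2r // /K addrAC lerDr addr_ge0 // mulr_ge0 ?sqr_ge0.
- by rewrite e1 tG add0r -qformZ; exact: qtd.
- by rewrite e2 tG add0r -qformZ; exact: qtd.
Qed.

(** Since [s <= 1 / (2 K)] turns [K s^2] into at most [s / 2], each step halves the error bound. The
    step lengths [K s], [K s / 2], ... add up to at most [2 K s], the room reserved inside the ball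
    where the minor stays bounded below. *)
Lemma newton_descent z0 (r : R) : (forall z, `|z - z0| <= r -> `|z| <= B /\ m0 <= `|grad_minor Q1 Q2 z i j|) ->
  forall k z s, `|z - z0| <= r - 2 * K * s -> s <= (2 * K)^-1 ->
  `|qform Q1 z| <= s -> `|qform Q2 z| <= s -> exists z',
  [/\ forall l, l != i -> l != j -> z' l 0 = z l 0, `|z' - z| <= 2 * K * s,
    `|qform Q1 z'| <= s / 2 ^+ k & `|qform Q2 z'| <= s / 2 ^+ k].
Proof.
move=> good; elim=> [|k IH] z s zr sK q1 q2.
  have s0 : 0 <= s by apply: le_trans q1.
  exists z; rewrite expr0 divr1 subrr normr0; split=> //.
  by rewrite !mulr_ge0 // (le_trans ler01).
have s0 : 0 <= s by apply: le_trans q1.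
have K0 : 0 < K by rewrite (lt_le_trans ltr01).
have Ks : 2 * K * s <= 1 by rewrite -ler_pdivlMl ?mulr_gt0 // mulr1.
have Ks0 : 0 <= K * s by rewrite mulr_ge0 // ltW.
have [|zB zm] := good z; first by apply: le_trans zr _; lra.
have [z1 [u1 d1 a1 b1]] := newton_step zB zm q1 q2.
have half : K * s ^+ 2 <= s / 2 by nra.
have K2 : K * (s / 2) = K * s / 2 by ring.
have [||||z' [u2 d2 a2 b2]] := IH z1 (s / 2).
- rewrite (_ : z1 - z0 = (z - z0) + (z1 - z)); last by apply/matrixP => ? ?; rewrite !mxE; ring.
  apply: le_trans (ler_normD _ _) _; lra.
- by apply: le_trans sK; lra.
- exact: le_trans a1 half.
- exact: le_trans b1 half.
exists z'; split.
- by move=> l li lj; rewrite u2 // u1.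
- rewrite (_ : z' - z = (z' - z1) + (z1 - z)); last by apply/matrixP => ? ?; rewrite !mxE; ring.
  apply: le_trans (ler_normD _ _) _; lra.
- by rewrite exprS invfM mulrA.
- by rewrite exprS invfM mulrA.
Qed.

End Step.

Lemma continuous_grad_minor i j : continuous (fun z : 'cV[R]_n => grad_minor Q1 Q2 z i j).
Proof.
have cc Q k : continuous (fun z : 'cV[R]_n => (map_mx intr Q *m z) k 0).
  have -> : (fun z : 'cV[R]_n => (map_mx intr Q *m z) k 0) = (fun z => \sum_l (Q k l)%:~R * z l 0).
    by apply/funext => z; rewrite mxE; apply: eq_bigr => l _; rewrite mxE.
  apply: continuous_sum => l z.
  have cl : {for z, continuous (fun y : 'cV[R]_n => y l 0)} by exact: coord_continuous.
  exact: (cvgM (cvg_cst _) cl).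
by move=> z; exact: (cvgB (cvgM (cc Q1 i z) (cc Q2 j z)) (cvgM (cc Q1 j z) (cc Q2 i z))).
Qed.

(** Prepares a covering argument: every [p] near [z0] reaches, by a move in the coordinates [i] and
    [j] only, a point where both forms are small, with a margin proportional to [d] around it. The
    constants are fixed before [d], which will shrink like [1 / L]. *)
Lemma zero_nearby (w : 'cV[R]_n -> R) z0 i j : continuous w -> 0 < w z0 ->
  qform Q1 z0 = 0 -> qform Q2 z0 = 0 -> grad_minor Q1 Q2 z0 i j != 0 ->
  exists r ka c0 : R, [/\ 0 < r, 0 < ka, ka <= 1, 0 < c0 &
    forall (d : R) p, 0 < d -> d <= 1 -> `|p - z0| <= r -> exists z,
    [/\ forall l, l != i -> l != j -> z l 0 = p l 0, forall l, `|p l 0 - z l 0| <= 1 &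
      forall v, `|v| <= ka * d -> [/\ c0 <= w (z + v), `|qform Q1 (z + v)| <= d & `|qform Q2 (z + v)| <= d]]].
Proof.
move=> wc wz q1 q2 g0; pose m0 := `|grad_minor Q1 Q2 z0 i j| / 2; pose c0 := w z0 / 2.
have m00 : 0 < m0 by rewrite divr_gt0 // normr_gt0.
have c00 : 0 < c0 by rewrite divr_gt0.
have near1 : \forall z \near z0, c0 < w z.
  have h : c0 < w z0 by rewrite /c0; lra.
  exact: (@cvgr_gt R _ (nbhs z0) _ w (w z0) (wc z0) c0 h).
have near2 : \forall z \near z0, m0 < `|grad_minor Q1 Q2 z i j|.
  have cg : {for z0, continuous (fun z => `|grad_minor Q1 Q2 z i j|)}.
    apply: (@continuous_comp _ _ _ (fun z => grad_minor Q1 Q2 z i j) (fun x : R => `|x|)).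
      exact: continuous_grad_minor.
    exact: norm_continuous.
  have g0' : 0 < `|grad_minor Q1 Q2 z0 i j| by rewrite normr_gt0.
  have h : m0 < `|grad_minor Q1 Q2 z0 i j| by rewrite /m0; lra.
  exact: (@cvgr_gt R _ (nbhs z0) _ (fun z => `|grad_minor Q1 Q2 z i j|) _ cg m0 h).
have [e0 /= e00 eP] := (nbhs_normP _ _).1 (filterI near1 near2).
pose e := Num.min (e0 / 2) 1.
have e_gt0 : 0 < e by rewrite lt_min divr_gt0 //= ltr01.
have ee0 : e < e0 by rewrite gt_min; apply/orP; left; lra.
have e1 : e <= 1 by rewrite ge_min lexx orbT.
have good z : `|z - z0| <= e -> c0 < w z /\ m0 < `|grad_minor Q1 Q2 z i j|.
  by move=> ze; apply: eP; rewrite /= distrC (le_lt_trans ze).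
pose B := `|z0| + 1.
have B0 : 0 <= B by rewrite addr_ge0.
have zB z : `|z - z0| <= e -> `|z| <= B.
  move=> ze; have -> : z = z0 + (z - z0) by apply/matrixP => ? ?; rewrite !mxE; ring.
  by apply: le_trans (ler_normD _ _) _; rewrite lerD // (le_trans ze).
pose D := 4 * A * B / (2 * m0); pose K := 1 + D + A * D ^+ 2.
have D0 : 0 <= D by rewrite divr_ge0 ?mulr_ge0 // ltW.
have K1 : 1 <= K by rewrite /K -addrA lerDl addr_ge0 // mulr_ge0 ?sqr_ge0.
have K0 : 0 < K by rewrite (lt_le_trans ltr01).
have goodB z : `|z - z0| <= e -> `|z| <= B /\ m0 <= `|grad_minor Q1 Q2 z i j|.
  by move=> ze; have [_ h] := good z ze; split; [exact: zB | exact: ltW].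
have desc : forall k z s, `|z - z0| <= e - 2 * K * s -> s <= (2 * K)^-1 ->
  `|qform Q1 z| <= s -> `|qform Q2 z| <= s -> exists z',
  [/\ forall l, l != i -> l != j -> z' l 0 = z l 0, `|z' - z| <= 2 * K * s,
    `|qform Q1 z'| <= s / 2 ^+ k & `|qform Q2 z'| <= s / 2 ^+ k].
  exact: (newton_descent m00 B0 goodB).
(* [S r] bounds the forms within [r] of [z0], and [S ka d] bounds their change under a displacement
   of size [ka d]. With [r] and [ka] as below, the bound [2 K S r] for the Newton path is [e / 4],
   and that change is at most [d / 4]. *)
pose S := 3 * A * B + 3 * A + 1.
have S0 : 0 < S by rewrite ltr_wpDl // addr_ge0 // !mulr_ge0.
pose r := e / (8 * K * S).
have r0 : 0 < r by rewrite divr_gt0 // !mulr_gt0.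
pose ka := e / (4 * S).
have ka0 : 0 < ka by rewrite divr_gt0 // mulr_gt0.
have S1 : 1 <= S by rewrite lerDr addr_ge0 // !mulr_ge0.
have rS : 8 * (K * (S * r)) = e.
  by rewrite /r; field; rewrite !gt_eqF.
have kS : 4 * (S * ka) = e by rewrite /ka; field; rewrite gt_eqF.
have Sr0 : 0 <= S * r by rewrite mulr_ge0 // ltW.
have rSr : r <= S * r by rewrite ler_peMl // ltW.
have KSr : S * r <= K * (S * r) by rewrite ler_peMl.
have kSk : ka <= S * ka by rewrite ler_peMl // ltW.
exists r, ka, c0; split=> //; first by lra.
move=> d p d0 d1 pr.
have qs Q : integral_form Q -> entry_le Q -> qform Q z0 = 0 -> `|qform Q p| <= S * r.
  move=> Qs QE q0; have := qform_lip z0 (p - z0) Qs QE.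
  rewrite (_ : z0 + (p - z0) = p) ?q0 ?subr0; last by apply/matrixP => ? ?; rewrite !mxE; ring.
  move=> h; apply: le_trans h _.
  have zb : `|z0| <= B by rewrite lerDl.
  have h1 : `|z0| * `|p - z0| <= B * r by exact: ler_pM.
  have h2 : `|p - z0| ^+ 2 <= 1 * r.
    by rewrite expr2; apply: ler_pM => //; apply: le_trans pr _; lra.
  have h3 : 2 * `|z0| * `|p - z0| + `|p - z0| ^+ 2 <= 2 * (B * r) + r by rewrite -mulrA; lra.
  apply: le_trans (ler_wpM2l A0 h3) _; rewrite /S.
  have r0' := ltW r0.
  have : 0 <= A * (B * r) by apply: mulr_ge0 => //; exact: mulr_ge0.
  have : 0 <= A * r by exact: mulr_ge0.
  move=> ? ?; lra.
have [k kd] : exists k : nat, S * r / 2 ^+ k <= d / 2.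
  exists (Num.truncn (2 * (S * r) / d)).+1.
  set N := (Num.truncn _).+1.
  have N1 : 2 * (S * r) / d < N%:R := truncnS_gt _.
  have N2 : N%:R <= 2 ^+ N :> R by rewrite -natrX ler_nat ltnW // ltn_expl.
  rewrite ler_pdivrMr ?exprn_gt0 //.
  move: N1; rewrite ltr_pdivrMr // => N1.
  have N3 : N%:R * d <= 2 ^+ N * d by rewrite ler_wpM2r // ltW.
  by rewrite mulrAC ler_pdivlMr // mulrC [leRHS]mulrC; exact: ltW (lt_le_trans N1 N3).
have [||||z [u dz a b]] := desc k p (S * r).
- by apply: le_trans pr _; rewrite -mulrA; lra.
- rewrite -[leRHS]mul1r ler_pdivlMr ?mulr_gt0 //; lra.
- exact: qs.
- exact: qs.
have dz' : `|z - p| <= e / 4 by apply: le_trans dz _; rewrite -mulrA; lra.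
exists z; split=> //.
  move=> l; have := cV_coord_le (z - p) l; rewrite addmx_entry [(- p) l 0]mxE distrC => h.
  by apply: le_trans h _; apply: le_trans dz' _; lra.
move=> v vk.
have ve : `|v| <= e / 4.
  apply: le_trans vk _; apply: (@le_trans _ _ (ka * 1)); last by rewrite mulr1; lra.
  by rewrite ler_wpM2l // ltW.
have zz : `|z - z0| <= e / 2.
  rewrite (_ : z - z0 = (z - p) + (p - z0)); last by apply/matrixP => ? ?; rewrite !mxE; ring.
  by apply: le_trans (ler_normD _ _) _; apply: le_trans (lerD dz' pr) _; lra.
have zvz : `|z + v - z0| <= e.
  by rewrite addrAC; apply: le_trans (ler_normD _ _) _; apply: le_trans (lerD zz ve) _; lra.
have zb : `|z| <= B by apply: zB; apply: le_trans zz _; lra.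
have qv Q : integral_form Q -> entry_le Q -> `|qform Q z| <= S * r / 2 ^+ k -> `|qform Q (z + v)| <= d.
  move=> Qs QE qz; have := qform_lip z v Qs QE => h.
  have h1 : `|z| * `|v| <= B * (ka * d) by exact: ler_pM.
  have h2 : `|v| ^+ 2 <= 1 * (ka * d).
    by rewrite expr2; apply: ler_pM => //; apply: le_trans ve _; lra.
  have h3 : 2 * `|z| * `|v| + `|v| ^+ 2 <= 2 * (B * (ka * d)) + ka * d by rewrite -mulrA; lra.
  have h4 := le_trans h (ler_wpM2l A0 h3).
  have h5 : A * (2 * (B * (ka * d)) + ka * d) <= S * ka * d.
    have -> : A * (2 * (B * (ka * d)) + ka * d) = (2 * A * B + A) * (ka * d) by ring.
    rewrite -[leRHS]mulrA; apply: ler_wpM2r; first by apply: mulr_ge0; exact: ltW.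
    have AB : 0 <= A * B by exact: mulr_ge0.
    rewrite /S; have A0' := A0; lra.
  have h6 : S * ka * d <= d / 4.
    have -> : S * ka = e / 4 by lra.
    have : e * d <= 1 * d by rewrite ler_wpM2r // ltW.
    lra.
  have h7 := ler_normD (qform Q (z + v) - qform Q z) (qform Q z).
  rewrite subrK in h7; apply: le_trans h7 _; have := le_trans qz kd; lra.
split; [by have [h _] := good _ zvz; exact: ltW | exact: qv | exact: qv].
Qed.

End RealNewton.

Section RegularizedLower.
Variables (R : realType) (n : nat).
Local Notation T := (measurableTypeR R).
Local Notation mu := (@lebesgue_measure R).

Lemma Rintegral_sum d (X : measurableType d) (m : {measure set X -> \bar R}) I (r : seq I) (f : I -> X -> R) :
  (forall i, m.-integrable setT (EFin \o f i)) ->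
  m.-integrable setT (EFin \o (fun x => \sum_(i <- r) f i x)) /\
  \int[m]_x (\sum_(i <- r) f i x) = \sum_(i <- r) \int[m]_x f i x.
Proof.
move=> fi; elim: r => [|i r [IH1 IH2]].
  have -> : (fun x => \sum_(i <- [::]) f i x) = cst 0 by apply/funext => x; rewrite big_nil.
  by split; [exact: integrable0 | rewrite big_nil Rintegral_cst // mul0r].
have -> : (fun x => \sum_(j <- i :: r) f j x) = (fun x => f i x + \sum_(j <- r) f j x).
  by apply/funext => x; rewrite big_cons.
split; first exact: (integrableD measurableT (fi i) IH1).
by rewrite (RintegralD measurableT (fi i) IH1) IH2 big_cons.
Qed.

Lemma measurable_fejer (L : R) : 0 < L -> measurable_fun setT (fejer L : T -> R).
Proof.
move=> L0.
pose F (u : T * T) := ((1 + cos (2 * pi * u.1 * u.2)) * triangle L u.2)%:E.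
have mc : measurable_fun setT (fun u : T * T => cos (2 * pi * u.1 * u.2)).
  apply: (measurableT_comp (continuous_measurable_fun (@continuous_cos R))).
  by apply: measurable_funM; [apply: measurable_funM; first exact: measurable_cst |].
have mF : measurable_fun setT F.
  apply/measurable_EFinP; apply: measurable_funM; first by apply: measurable_funD => //; exact: measurable_cst.
  exact: (measurableT_comp (continuous_measurable_fun (@continuous_triangle R L)) measurable_snd).
have F0 u : (0 <= F u)%E.
  have cm (x : R) : 0 <= 1 + cos x by have := cos_max x; rewrite ler_norml => /andP[? _]; lra.
  by rewrite lee_fin; apply: mulr_ge0; [exact: cm | exact: triangle_ge0].
have c1 : continuous (fun _ : R => 1 : R) by move=> x; exact: cst_continuous.
have n1 (x : R) : `|1 : R| <= 1 by rewrite normr1.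
have i1 := bsupp_integrable (triangle_bsupp L0 c1 n1).
have cc s : continuous (fun x : R => cos (2 * pi * s * x)).
  move=> x; apply: (@continuous_comp _ _ _ (fun x => 2 * pi * s * x) cos); last exact: continuous_cos.
  by apply: cvgM; [exact: cvg_cst | exact: cvg_id].
have i2 s := bsupp_integrable (triangle_bsupp L0 (cc s) (fun x => cos_max (2 * pi * s * x))).
have -> : fejer L = (fun s => fine (fubini_F mu F s) - \int[mu]_x (1 * triangle L x)).
  apply/funext => s; rewrite /fubini_F /F /=.
  have -> : (fun y => ((1 + cos (2 * pi * s * y)) * triangle L y)%:E) =
     (fun y => (1 * triangle L y + cos (2 * pi * s * y) * triangle L y)%:E).
    by apply/funext => y; rewrite mulrDl.
  have := RintegralD measurableT i1 (i2 s); rewrite {1}/Rintegral => ->.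
  by rewrite addrAC subrr add0r.
apply: measurable_funB; last exact: measurable_cst.
have mfine : measurable_fun setT (@fine R) by exact: fine_measurable.
have mG := measurable_fun_fubini_tonelli_F F mF F0.
exact: (measurableT_comp mfine (mG mu)).
Qed.

Lemma fejer_bounded (L : R) : 0 < L -> exists2 K, 0 <= K & forall s, `|fejer L s| <= K.
Proof.
move=> L0; exists (1 * fine (mu (`[- L, L]%classic : set T))) => [|s].
  by rewrite mul1r fine_ge0 // measure_ge0.
apply: (bsupp_le (triangle_bsupp L0 _ (fun x => cos_max (2 * pi * s * x)))).
move=> x; apply: (@continuous_comp _ _ _ (fun x => 2 * pi * s * x) cos); last exact: continuous_cos.
by apply: cvgM; [exact: cvg_cst | exact: cvg_id].
Qed.

Variables (Q1 Q2 : 'M[int]_n).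
Hypotheses (s1 : integral_form Q1) (s2 : integral_form Q2).
Variables (w : 'cV[R]_n -> R) (b C : R).
Hypotheses (b0 : 0 <= b) (wC : ccs w b C) (w0 : forall z, 0 <= w z).

Let G L (z : 'cV[R]_n) := w z * (fejer L (qform Q1 z) * fejer L (qform Q2 z)).

Let G0 L z : 0 < L -> 0 <= G L z.
Proof. by move=> L0; rewrite mulr_ge0 // mulr_ge0 // fejer_ge0. Qed.

Let shifted L h : 0 < L ->
  (@lebesgue_tuple R n).-integrable setT (EFin \o (fun t => G L (tcol t - h))) /\
  \int[@lebesgue_tuple R n]_t G L (tcol t - h) = Int (G L).
Proof.
move=> L0; have [wc wC' wb] := wC; have [K K0 KP] := fejer_bounded L0.
have mf := measurable_fejer L0.
have mG : measurable_fun setT (G L \o tcol (n := n)).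
  apply: measurable_funM; first exact: measurable_tcol.
  by apply: measurable_funM; apply: (measurableT_comp mf); apply: measurable_tcol; exact: continuous_qform.
have E : (fun t => G L (tcol t - h)) = (G L \o tcol (n := n)) \o tuple_shift (- h).
  by apply/funext => t; rewrite /= tcol_shift.
split; last by rewrite E; exact: (Rintegral_tuple_shift (- h) mG).
apply: (@bsupp_integrable _ _ _ _ _ (C * (K * K)) (cube h b)); split.
- by rewrite E; exact: (measurableT_comp mG (measurable_tuple_shift (- h))).
- exact: measurable_cube.
- by rewrite [X in (X < _)%E](lebesgue_tuple_cube h b0) ltry.
- by move=> t; rewrite /G !normrM ler_pM ?mulr_ge0 // ler_pM.
- move=> t ht; rewrite /G wb ?mul0r // => h'; apply: ht => i.
  by have := h' i; rewrite !mxE.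
Qed.

(* Translates of the region [|Q1|, |Q2| <= 1 / (8 L)] along a grid of [O(L^2)] vectors in the
   coordinates [i], [j] cover a fixed cube around [z0], so that region carries a mass at least
   a constant times [L ^ -2], while the product of the two Fejer factors is at least [L^2 / 4]
   there. *)
Lemma regularized_lower z0 i j : 0 < w z0 ->
  qform Q1 z0 = 0 -> qform Q2 z0 = 0 -> grad_minor Q1 Q2 z0 i j != 0 ->
  exists2 c, 0 < c & forall L, 1 <= L ->
    c <= Int (fun z => w z * (fejer L (qform Q1 z) * fejer L (qform Q2 z))).
Proof.
move=> wz q1 q2 g0; have [wc _ _] := wC.
have ij : i != j by apply: contra_neq g0 => ->; rewrite /grad_minor mulrC subrr.
have [r [ka [c0 [r0 ka0 ka1 c00 P]]]] := zero_nearby s1 s2 wc wz q1 q2 g0.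
(* The factors are the lower bound [c0] of the weight, the volume of the cube, and [(L / 2)^2]
   divided by a bound [(24 L / ka)^2] for the number of grid vectors. *)
exists (c0 * (2 * r) ^+ n * ka ^+ 2 / (4 * (24 * 24))).
  apply: divr_gt0; last by rewrite !mulr_gt0.
  apply: mulr_gt0; last exact: exprn_gt0.
  by apply: mulr_gt0 => //; apply: exprn_gt0; exact: mulr_gt0.
move=> L L1; have L0 : 0 < L by rewrite (lt_le_trans ltr01).
pose d := (8 * L)^-1.
have d0 : 0 < d by rewrite invr_gt0 mulr_gt0.
have d1 : d <= 1 by rewrite invf_le1 ?mulr_gt0 //; lra.
pose st := ka * d.
have st0 : 0 < st by rewrite mulr_gt0.
have st1 : st <= 1 by rewrite mulr_ile1 // ltW.
(* In each of the two coordinates the points [a st - 1] with [a < M] form a grid of mesh [st] over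
   [[-1, 1]], the range of the displacements given by [zero_nearby]. *)
pose M := (Num.truncn (2 / st)).+1.
pose h (u : 'I_M * 'I_M) : 'cV[R]_n :=
  ((u.1 : nat)%:R * st - 1) *: delta_mx i 0 + ((u.2 : nat)%:R * st - 1) *: delta_mx j 0.
have M_le : M%:R <= 24 * L / ka.
  have h1 : (Num.truncn (2 / st))%:R <= 2 / st by rewrite truncn_le divr_ge0 // ltW.
  have h2 : 1 <= st^-1 by rewrite invf_ge1.
  have -> : 24 * L / ka = 3 * st^-1 by rewrite /st /d; field; rewrite !gt_eqF.
  by rewrite /M -natr1; lra.
have cell (x : R) : `|x| <= 1 -> exists a : 'I_M, `|x - (a%:R * st - 1)| <= st.
  rewrite ler_norml => /andP[x1 x2].
  have aM : (Num.truncn ((x + 1) / st) < M)%N.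
    by rewrite ltnS; apply: le_truncn; rewrite ler_pM2r ?invr_gt0 //; lra.
  exists (Ordinal aM) => /=.
  have /andP[] : (Num.truncn ((x + 1) / st))%:R <= (x + 1) / st < (Num.truncn ((x + 1) / st)).+1%:R.
    by apply: truncn_itv; rewrite divr_ge0 ?(ltW st0) //; lra.
  rewrite ler_pdivlMr // ltr_pdivrMr // -natr1 mulrDl mul1r => h1 h2.
  by rewrite ler_norml; apply/andP; split; lra.
(* Subtracting a grid vector within [st] of [t - z] lands in the good neighbourhood of [z], so at
   least one summand is large. *)
have point t : cube z0 r t -> c0 * (L / 2) ^+ 2 <= \sum_u G L (tcol t - h u).
  move=> tr; have pr : `|tcol t - z0| <= r.
    by apply: cV_norm_le (ltW r0) _ => l; have := tr l; rewrite !mxE.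
  have [z [out mv good]] := P d (tcol t) d0 d1 pr.
  have [a aP] := cell _ (mv i); have [c cP] := cell _ (mv j).
  pose v := tcol t - h (a, c) - z.
  have vst : `|v| <= st.
    apply: cV_norm_le (ltW st0) _ => l; rewrite /v /h !mxE !andbT.
    have [->|li] := eqVneq l i.
      rewrite (negbTE ij) mulr1 mulr0 addr0; move: aP; rewrite !mxE /=.
      by rewrite (_ : tnth t i - _ - z i 0 = tnth t i - z i 0 - ((a : nat)%:R * st - 1)) //; ring.
    have [->|lj] := eqVneq l j.
      rewrite mulr1 mulr0 add0r; move: cP; rewrite !mxE /=.
      by rewrite (_ : tnth t j - _ - z j 0 = tnth t j - z j 0 - ((c : nat)%:R * st - 1)) //; ring.
    by rewrite !mulr0 addr0 subr0 out // mxE subrr normr0 ltW.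
  have [wv qv1 qv2] := good v vst.
  have E : tcol t - h (a, c) = z + v by rewrite /v [RHS]addrC subrK.
  rewrite (bigD1 (a, c)) //= E; apply: (@le_trans _ _ (G L (z + v))).
    rewrite /G expr2; apply: ler_pM => //; first exact: ltW.
      by rewrite mulr_ge0 // divr_ge0 // ltW.
    by apply: ler_pM; rewrite ?divr_ge0 ?(ltW L0) //; exact: fejer_lower.
  by rewrite lerDl; apply: sumr_ge0 => u _; exact: G0.
have sh u := shifted (h u) L0.
have [iS ES] := Rintegral_sum (index_enum _) (fun u => (sh u).1).
have Cfin : (@lebesgue_tuple R n (cube z0 r) < +oo)%E.
  by rewrite [X in (X < _)%E](lebesgue_tuple_cube z0 (ltW r0)) ltry.
have iI := integrable_indic_lty (measurable_cube z0 r) Cfin.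
(* By translation invariance all [M^2] translates have the same integral. *)
have main : c0 * (L / 2) ^+ 2 * (2 * r) ^+ n <= (M%:R * M%:R) * Int (G L).
  have <- : \int[@lebesgue_tuple R n]_t (c0 * (L / 2) ^+ 2 * \1_(cube z0 r) t) =
      c0 * (L / 2) ^+ 2 * (2 * r) ^+ n.
    rewrite (RintegralZl _ measurableT iI) -(fine_cube z0 (ltW r0)).
    by rewrite {1}/Rintegral integral_indic ?setIT //; exact: measurable_cube.
  have <- : \int[@lebesgue_tuple R n]_t (\sum_u G L (tcol t - h u)) = M%:R * M%:R * Int (G L).
    rewrite ES (eq_bigr (fun=> Int (G L))) => [|u _]; last by case: (sh u).
    by rewrite sumr_const card_prod card_ord -natrM mulr_natl.
  apply: le_Rintegral => //.
    exact: (integrableZl measurableT _ iI).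
  move=> t _; rewrite indicE; have [tr|tr] := boolP (t \in cube z0 r).
    by rewrite mulr1; apply: point; rewrite inE in tr.
  by rewrite mulr0; apply: sumr_ge0 => u _; exact: G0.
have I0 : 0 <= Int (G L) by apply: Rintegral_ge0 => t _; exact: G0.
have MM : M%:R * M%:R <= (24 * L / ka) * (24 * L / ka) :> R by apply: ler_pM.
have := le_trans main (ler_wpM2r I0 MM).
have -> : c0 * (L / 2) ^+ 2 * (2 * r) ^+ n =
    24 * L / ka * (24 * L / ka) * (c0 * (2 * r) ^+ n * ka ^+ 2 / (4 * (24 * 24))).
  by field; rewrite gt_eqF.
by rewrite ler_pM2l // mulr_gt0 // divr_gt0 // mulr_gt0.
Qed.

End RegularizedLower.

Section SingularIntegral.
Variable R : realType.
Local Notation T := (measurableTypeR R).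
Local Notation mu := (@lebesgue_measure R).

Lemma triangle_cvg (x : R) : (fun m : nat => triangle m.+1%:R x) @ \oo --> (1 : R).
Proof.
have lo : (fun m : nat => 1 - `|x| / m.+1%:R) @ \oo --> (1 : R).
  have h := cvgB (cvg_cst (1 : R)) (cvgM (cvg_cst `|x|) (@cvg_harmonic R)).
  by rewrite mulr0 subr0 in h; exact: h.
apply: (squeeze_cvgr _ lo (cvg_cst (1 : R))).
by near=> m; rewrite triangle_le1 // /triangle le_max lexx orbT.
Unshelve. all: by end_near.
Qed.

(** Dominated convergence with majorant [|g|]: the cut-offs lie between 0 and 1 and tend to 1
    pointwise. *)
Lemma regularized_limit (g : T * T -> R) : (mu \x mu)%E.-integrable setT (EFin \o g) ->
  (fun m : nat => \int[(mu \x mu)%E]_u (g u * triangle2 m.+1%:R u)) @ \oo --> \int[(mu \x mu)%E]_u g u.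
Proof.
move=> ig; have mg := measurable_int _ ig.
have mg' : measurable_fun setT g by exact/measurable_EFinP.
have gle m u : `|g u * triangle2 m.+1%:R u| <= `|g u|.
  by rewrite normrM ler_piMr // ger0_norm ?triangle2_ge0 // triangle2_le1.
pose f_ (m : nat) (u : T * T) := (g u * triangle2 m.+1%:R u)%:E.
have mf m : measurable_fun setT (f_ m).
  by apply/measurable_EFinP; apply: measurable_funM => //; exact: measurable_triangle2.
have iabs : (mu \x mu)%E.-integrable setT (fun u => `|g u|%:E).
  apply: le_integrable ig => //; last by move=> u _ /=; rewrite lee_fin normr_id.
  by apply/measurable_EFinP; exact: (measurableT_comp (@normr_measurable R setT) mg').
have lim u : setT u -> (fun m => f_ m u) @ \oo --> (EFin \o g) u.
  move=> _; apply/fine_cvgP; split; first by near=> m.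
  have h := cvgM (cvg_cst (g u)) (cvgM (triangle_cvg u.1) (triangle_cvg u.2)).
  by rewrite !mulr1 in h; exact: h.
have [_ _ h] := dominated_convergence measurableT mf mg (aeW _ lim) iabs
  (aeW _ (fun u m _ => gle m u)).
have fin := integrable_fin_num measurableT ig.
rewrite -(fineK fin) in h; exact: (fine_cvg h).
Unshelve. all: by end_near.
Qed.

Lemma singular_integral_positive (n : nat) (Q1 Q2 : 'M[int]_n) (w : 'cV[R]_n -> R)
    (s1 : integral_form Q1) (s2 : integral_form Q2) (hC : condition1 Q1 Q2) (n10 : (10 <= n)%N) :
  smooth w -> compactly_supported w -> (forall z, 0 <= w z) ->
  (\forall z \near (0 : 'cV[R]_n), 0 < w z) -> nonzero_solution R Q1 Q2 ->
  singular_integral_converges Q1 Q2 w /\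
  complex.Im (singular_integral Q1 Q2 w) = 0 /\
  0 < complex.Re (singular_integral Q1 Q2 w).
Proof.
move=> ws wK w0 wnear [x [x0 qx1 qx2]].
have n0 : (0 < n)%N by apply: leq_trans n10.
have [b b0 [C wC]] := smooth_ccs ws wK.
have [K K0 KP] := decay s1 s2 hC n10 ws wK.
have ic := integrable_phase_integral b0 wC w0 (@continuous_cos R) (@cos_max R) (fun u => (KP u.1 u.2).1).
have is_ := integrable_phase_integral b0 wC w0 (@continuous_sin R) (@sin_max R) (fun u => (KP u.1 u.2).2).
have EC : (fun u => complex.Re (oscillatory_integral Q1 Q2 w u)) = phase_integral Q1 Q2 w cos.
  by apply/funext => u; exact: Re_oscillatory_integral.
have ES : (fun u => complex.Im (oscillatory_integral Q1 Q2 w u)) = phase_integral Q1 Q2 w sin.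
  by apply/funext => u; exact: Im_oscillatory_integral.
split; first by split; rewrite ?EC ?ES.
have cosL m : \int[(mu \x mu)%E]_u (phase_integral Q1 Q2 w cos u * triangle2 m.+1%:R u) =
    Int (fun z => w z * (fejer m.+1%:R (qform Q1 z) * fejer m.+1%:R (qform Q2 z))).
  exact: (regularized_cos _ Q1 Q2 b0 wC).
have sinL m : \int[(mu \x mu)%E]_u (phase_integral Q1 Q2 w sin u * triangle2 m.+1%:R u) = 0.
  exact: (regularized_sin _ Q1 Q2 b0 wC).
split.
  have := regularized_limit is_; rewrite /singular_integral /= ES.
  under eq_fun do rewrite sinL.
  move=> h; exact: (cvg_unique _ h (cvg_cst (0 : R))).
have [e /= e0 eP] := (nbhs_normP _ _).1 wnear.
(* Both forms being homogeneous, the real zero is scaled into the neighbourhood of the origin where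
   [w] is positive. *)
pose l := e / (`|x| + 1) / 2.
have x1 : 0 < `|x| + 1 by rewrite ltr_wpDl.
have l0 : 0 < l by rewrite !divr_gt0.
pose z0 := l *: x.
have z0e : `|z0| < e.
  rewrite normrZ gtr0_norm // /l mulrAC ltr_pdivrMr // mulrAC ltr_pdivrMr //.
  by have := normr_ge0 x; nra.
have wz : 0 < w z0 by apply: eP; rewrite /= sub0r normrN.
have q1 : qform Q1 z0 = 0 by rewrite qformZ qx1 mulr0.
have q2 : qform Q2 z0 = 0 by rewrite qformZ qx2 mulr0.
have z00 : z0 != 0 by rewrite scaler_eq0 negb_or gt_eqF.
have [i [j g0]] : exists i j, grad_minor Q1 Q2 z0 i j != 0.
  apply: (nonsingular_zero s1 s2 hC n0) => // [a c /eqP|D D0].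
    by rewrite mulf_eq0 => /orP[/eqP|/eqP]; [left | right].
  by rewrite intr_eq0.
have [c c0 cP] := regularized_lower s1 s2 b0 wC w0 wz q1 q2 g0.
have := regularized_limit ic; rewrite /singular_integral /= EC => h.
(* Otherwise some regularized integral, these converging to the present one, would drop below their
   uniform lower bound [c]. *)
rewrite ltNge; apply/negP => neg.
have hc : \int[(mu \x mu)%E]_u phase_integral Q1 Q2 w cos u < c by apply: le_lt_trans neg c0.
have [m /= mP] := filter_ex (@cvgr_lt R _ \oo _ _ _ h c hc).
have := cP m.+1%:R; rewrite -cosL ler1n => /(_ isT); rewrite leNgt => /negP; exact.
Qed.

End SingularIntegral.

Unset Implicit Arguments.

Theorem theorem1p7 (R : realType) (k1 k2 : nat) (hk1 : (5 <= k1)%N)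
    (hk2 : (5 <= k2)%N) (Q1 Q2 : 'M[int]_(k1 + k2))
    (hQ1 : integral_form Q1) (hQ2 : integral_form Q2)
    (hC : condition1 Q1 Q2) (hs1 : split_form Q1) (hs2 : split_form Q2) :
  ((forall p : nat, prime p -> nonzero_solution (padic_int p) Q1 Q2) ->
    cvgn (singular_series_partial R Q1 Q2) /\
    complex.Im (singular_series R Q1 Q2) = 0 /\
    0 < complex.Re (singular_series R Q1 Q2)) /\
  (forall w : 'cV[R]_(k1 + k2) -> R,
    smooth w -> compactly_supported w -> (forall z, 0 <= w z) ->
    (\forall z \near (0 : 'cV[R]_(k1 + k2)), 0 < w z) ->
    nonzero_solution R Q1 Q2 ->
    singular_integral_converges Q1 Q2 w /\
    complex.Im (singular_integral Q1 Q2 w) = 0 /\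
    0 < complex.Re (singular_integral Q1 Q2 w)).
Proof.
have k10 : (10 <= k1 + k2)%N by rewrite -[10%N]/(5 + 5)%N leq_add.
split; first by apply: singular_series_positive => //; exact: leq_trans k10.
by move=> w ws wK w0 wnear sol; exact: singular_integral_positive.
Qed.
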